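(* Let $a\colon\mathbb{R}\to(0,\infty)$ be a locally bounded differentiable function with locally bounded derivative $a'$ such that $\int_0^\infty a(x)^{-1}\,dx=\infty=\int_{-\infty}^0 a(x)^{-1}\,dx$, and let $\rho\colon\mathbb{R}\to(0,\infty)$ be a $C^\infty$-function. On $L_\infty=L_\infty(\mathbb{R};\rho\,dx)$ define $X_{\min}\varphi=a\varphi'$ with domain $D(X_{\min})=C_c^\infty(\mathbb{R})$ and $X_{\max}\varphi=a\varphi'$ with domain $D(X_{\max})=C_c^1(\mathbb{R})$, and set $H_{\min}=-X_{\min}^2$, $H_{\max}=-X_{\max}^2$. Then: (I) The operators $X_{\min}$ and $X_{\max}$ are weak$^*$ closable and $\overline X_{\min}=\overline X_{\max}$, where the bar denotes the weak$^*$ closure. (II) The operator $H_{\max}$ is weak$^*$ closable and its weak$^*$ closure $\overline H_{\max}$ generates a semigroup $S$ on $L_\infty$ which is weak$^*$ continuous, positive, contractive and holomorphic in the open right half-plane. (III) $\overline H_{\max}=-(\overline X_{\max})^2$; in particular $(\overline X_{\max})^2$ is weak$^*$ closed. (IV) If $a\in C^\infty(\mathbb{R})$ then $\overline H_{\min}=\overline H_{\max}$, where $\overline H_{\min}$ is the weak$^*$ closure of $H_{\min}$.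
   Context: The weak$^*$ topology on $L_\infty$ is the one from its predual $L_1(\mathbb{R};\rho\,dx)$. Squares of operators have their natural domain, $D(A^2)=\{\varphi\in D(A): A\varphi\in D(A)\}$; thus $D(X_{\max}^2)=\{\varphi\in C_c^1(\mathbb{R}): a\varphi'\in C_c^1(\mathbb{R})\}$, and similarly for $X_{\min}^2$. Sign convention for generators: an operator $H$ generates the weak$^*$ continuous semigroup $(S_t)_{t>0}$ if $H\varphi=\lim_{t\downarrow0}t^{-1}(I-S_t)\varphi$ in the weak$^*$ sense, with domain exactly those $\varphi$ for which this limit exists (formally $S_t=e^{-tH}$). ''Holomorphic in the open right half-plane'' means $t\mapsto S_t$ extends to a holomorphic operator-valued semigroup on $\{z\in\mathbb{C}:\operatorname{Re}z>0\}$. *)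

(* Defs.v *)
From HB Require Import structures.
From mathcomp Require Import all_boot all_order all_algebra.
From mathcomp Require Import complex.
From mathcomp Require Import all_classical all_reals all_analysis.
From mathcomp Require Import measurable_realfun ess_sup_inf.

Set Implicit Arguments.
Unset Strict Implicit.
Unset Printing Implicit Defensive.

Import Order.TTheory GRing.Theory Num.Theory.
Import numFieldNormedType.Exports.

Local Open Scope classical_set_scope.
Local Open Scope ring_scope.
Local Open Scope complex_scope.

Section weighted_measure.
Context {R : realType}.
Implicit Type rho : R -> R.

(* The guard makes [weighted_lebesgue rho] a measure for every [rho]; it is
   inactive for measurable nonnegative weights, see [weighted_lebesgueE]. *)
Definition weight rho : R -> R :=
  if `[< measurable_fun [set: R] rho /\ forall x, 0 <= rho x >] then rho
  else cst 0.

Lemma measurable_weight rho : measurable_fun [set: R] (weight rho).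
Proof. by rewrite /weight; case: asboolP => [[]|_]. Qed.

Lemma weight_ge0 rho x : 0 <= weight rho x.
Proof. by rewrite /weight; case: asboolP => [[]|_]. Qed.

Definition weighted_lebesgue rho (A : set (measurableTypeR R)) : \bar R :=
  (\int[lebesgue_measure]_(x in A) (weight rho x)%:E)%E.

Section instance.
Variable rho : R -> R.

Let weighted0 : weighted_lebesgue rho set0 = 0%E.
Proof. exact: integral_set0. Qed.

Let weighted_ge0 A : (0 <= weighted_lebesgue rho A)%E.
Proof. by apply: integral_ge0 => x _; rewrite lee_fin weight_ge0. Qed.

Let weighted_sigma_additive : semi_sigma_additive (weighted_lebesgue rho).
Proof.
move=> /= F mF tF mUF; rewrite /weighted_lebesgue; apply: cvg_toP.
  apply: ereal_nondecreasing_is_cvgn => m n mn.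
  apply: lee_sum_nneg_natr => // k _ _.
  by apply: integral_ge0 => /= x _; rewrite lee_fin weight_ge0.
rewrite ge0_integral_bigcup//=.
- apply: (measurable_funS measurableT) => //.
  by apply/measurable_EFinP; exact: measurable_weight.
- by move=> x _; rewrite lee_fin weight_ge0.
Qed.

HB.instance Definition _ := isMeasure.Build _ _ _ (weighted_lebesgue rho)
  weighted0 weighted_ge0 weighted_sigma_additive.

End instance.

Lemma weighted_lebesgueE rho (A : set R) :
  measurable_fun [set: R] rho -> (forall x, 0 <= rho x) ->
  weighted_lebesgue rho A = (\int[lebesgue_measure]_(x in A) (rho x)%:E)%E.
Proof.
by move=> mrho rho0; rewrite /weighted_lebesgue /weight asboolT.
Qed.

End weighted_measure.

(* L_infty is taken with complex scalars, as holomorphy of the semigroup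
   requires. *)
Section Linf_functions.
Context d {T : measurableType d} {R : realType}.
Variable mu : {measure set T -> \bar R}.
Implicit Types f g : T -> R[i].

Definition cmeasurable f :=
  measurable_fun [set: T] (fun x => complex.Re (f x)) /\
  measurable_fun [set: T] (fun x => complex.Im (f x)).

Definition cnorm f : T -> R := fun x => Normc.normc (f x).

Definition cintegrable f :=
  mu.-integrable [set: T] (fun x => (complex.Re (f x))%:E) /\
  mu.-integrable [set: T] (fun x => (complex.Im (f x))%:E).

Definition cintegral f : R[i] :=
  (\int[mu]_x complex.Re (f x))%R +i* (\int[mu]_x complex.Im (f x))%R.

Lemma normc_ge0 (z : R[i]) : 0 <= Normc.normc z.
Proof. by case: z => x y; exact: sqrtr_ge0. Qed.

Definition in_Linf : {pred T -> R[i]} :=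
  mem [set f | cmeasurable f /\ finite_norm mu +oo%E (cnorm f)].

Lemma in_LinfP f : f \in in_Linf <->
  cmeasurable f /\ exists M : R, \forall x \ae mu, cnorm f x <= M.
Proof.
have absE : abse \o (EFin \o cnorm f) = EFin \o cnorm f.
  by apply/funext => x /=; rewrite ger0_norm// /cnorm normc_ge0.
rewrite inE/= /finite_norm unlock /Lnorm absE; split=> -[mf bf]; split=> //.
  move: bf; case: ifPn => [_ fy|].
    have [r rge] : exists r : R, (ess_sup mu (EFin \o cnorm f) <= r%:E)%E.
      case: ess_sup fy => [r _|//|_]; first by exists r.
      by exists 0; rewrite leNye.
    by exists r; move/ess_supP : rge; apply: filterS => x; rewrite lee_fin.
  rewrite lt0e measure_ge0 andbT negbK => /eqP mu0 _; exists 0.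
  by exists setT; split.
case: ifPn => // _; case: bf => M fM.
by apply: (@le_lt_trans _ _ M%:E); rewrite ?ltry//; apply/ess_supP.
Qed.

Lemma in_Linf_submod_closed : submod_closed in_Linf.
Proof.
split.
  apply/in_LinfP; split; first by split; exact: measurable_cst.
  by exists 0; apply: nearW => x; rewrite /cnorm Normc.normc0.
move=> c f g /in_LinfP[[mf1 mf2] [M fM]] /in_LinfP[[mg1 mg2] [N gN]].
apply/in_LinfP; split.
  split.
    rewrite [X in measurable_fun _ X](_ : _ = fun x =>
        complex.Re c * complex.Re (f x) - complex.Im c * complex.Im (f x)
        + complex.Re (g x)).
      apply: measurable_funD => //.
      by apply: measurable_funB; apply: measurable_funM.
    by apply/funext => x; rewrite /= !fctE; case: c (f x) (g x) => ? ? [? ?] [].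
  rewrite [X in measurable_fun _ X](_ : _ = fun x =>
      complex.Re c * complex.Im (f x) + complex.Im c * complex.Re (f x)
      + complex.Im (g x)).
    apply: measurable_funD => //.
    by apply: measurable_funD; apply: measurable_funM.
  by apply/funext => x; rewrite /= !fctE; case: c (f x) (g x) => ? ? [? ?] [].
exists (Normc.normc c * M + N); apply: filterS2 fM gN => x fM gN.
rewrite /cnorm (le_trans (le_normcD _ _))// lerD//.
by rewrite Normc.normcM ler_wpM2l// normc_ge0.
Qed.

HB.instance Definition _ :=
  GRing.isSubmodClosed.Build _ _ in_Linf in_Linf_submod_closed.

Record Linf_fun := LinfFun {
  Linf_fun_val :> T -> R[i];
  Linf_funP : Linf_fun_val \in in_Linf }.

HB.instance Definition _ := [isSub for Linf_fun_val].
HB.instance Definition _ := [Choice of Linf_fun by <:].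
HB.instance Definition _ := [SubChoice_isSubLmodule of Linf_fun by <:].

Definition Linf_ae_eq (f g : Linf_fun) : bool :=
  `[< \forall x \ae mu, f x = g x >].

Lemma Linf_ae_eq_refl : reflexive Linf_ae_eq.
Proof. by move=> f; apply/asboolP; exact: nearW. Qed.

Lemma Linf_ae_eq_sym : symmetric Linf_ae_eq.
Proof.
by move=> f g; apply/idP/idP => /asboolP h; apply/asboolP;
  apply: filterS h => x ->.
Qed.

Lemma Linf_ae_eq_trans : transitive Linf_ae_eq.
Proof.
move=> f g h /asboolP gf /asboolP fh; apply/asboolP.
by apply: filterS2 gf fh => x -> ->.
Qed.

Canonical Linf_ae_eq_canonical :=
  EquivRel Linf_ae_eq Linf_ae_eq_refl Linf_ae_eq_sym Linf_ae_eq_trans.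

Local Open Scope quotient_scope.

Definition Linf : Type := {eq_quot Linf_ae_eq}.
HB.instance Definition _ := Choice.on Linf.
HB.instance Definition _ := EqQuotient.on Linf.
Definition Linf_to_fun (u : Linf) : T -> R[i] := repr u.
Coercion Linf_to_fun : Linf >-> Funclass.

Lemma Linf_eqP (u v : Linf) : u = v <-> \forall x \ae mu, u x = v x.
Proof.
split=> [->|uv]; first exact: nearW.
by rewrite -[u]reprK -[v]reprK; apply/eqmodP/asboolP.
Qed.

Lemma Linf_piE (f : Linf_fun) : \forall x \ae mu, (\pi_Linf f : Linf) x = f x.
Proof. by have /eqmodP/asboolP := reprK (\pi_Linf f). Qed.

Let Linf_add (u v : Linf) : Linf := \pi_Linf (repr u + repr v).
Let Linf_opp (u : Linf) : Linf := \pi_Linf (- repr u).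
Let Linf_scale (c : R[i]) (u : Linf) : Linf := \pi_Linf (c *: repr u).
Let Linf_zero : Linf := \pi_Linf 0.

Let addE u v : \forall x \ae mu, Linf_add u v x = u x + v x.
Proof. exact: Linf_piE. Qed.
Let oppE u : \forall x \ae mu, Linf_opp u x = - u x.
Proof. exact: Linf_piE. Qed.
Let zeroE : \forall x \ae mu, Linf_zero x = 0.
Proof. exact: Linf_piE. Qed.
Let scaleE c u : \forall x \ae mu, Linf_scale c u x = c * u x.
Proof. exact: Linf_piE. Qed.

Let Linf_addA : associative Linf_add.
Proof.
move=> u v w; apply/Linf_eqP.
apply: filterS (filterI (filterI (addE u (Linf_add v w)) (addE v w))
  (filterI (addE (Linf_add u v) w) (addE u v))) => x [[-> ->] [-> ->]].
by rewrite addrA.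
Qed.

Let Linf_addC : commutative Linf_add.
Proof.
move=> u v; apply/Linf_eqP.
by apply: filterS2 (addE u v) (addE v u) => x -> ->; rewrite addrC.
Qed.

Let Linf_add0 : left_id Linf_zero Linf_add.
Proof.
move=> u; apply/Linf_eqP.
by apply: filterS2 (addE Linf_zero u) zeroE => x -> ->; rewrite add0r.
Qed.

Let Linf_addN : left_inverse Linf_zero Linf_opp Linf_add.
Proof.
move=> u; apply/Linf_eqP.
apply: filterS3 (addE (Linf_opp u) u) (oppE u) zeroE => x -> -> ->.
by rewrite addNr.
Qed.

HB.instance Definition _ := GRing.isZmodule.Build Linf
  Linf_addA Linf_addC Linf_add0 Linf_addN.

Let Linf_scaleA a b (u : Linf) :
  Linf_scale a (Linf_scale b u) = Linf_scale (a * b) u.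
Proof.
apply/Linf_eqP.
apply: filterS3 (scaleE a (Linf_scale b u)) (scaleE b u) (scaleE (a * b) u).
by move=> x -> -> ->; rewrite mulrA.
Qed.

Let Linf_scale1 : left_id 1 Linf_scale.
Proof.
move=> u; apply/Linf_eqP.
by apply: filterS (scaleE 1 u) => x ->; rewrite mul1r.
Qed.

Let Linf_scaleDr : right_distributive Linf_scale +%R.
Proof.
move=> a u v; apply/Linf_eqP.
apply: filterS (filterI (filterI (scaleE a (u + v)) (addE u v))
  (filterI (addE (Linf_scale a u) (Linf_scale a v))
    (filterI (scaleE a u) (scaleE a v)))) => x [[-> ->] [-> [-> ->]]].
by rewrite mulrDr.
Qed.

Let Linf_scaleDl u : {morph Linf_scale^~ u : a b / a + b}.
Proof.
move=> a b; apply/Linf_eqP.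
apply: filterS (filterI (filterI (scaleE (a + b) u)
  (addE (Linf_scale a u) (Linf_scale b u)))
  (filterI (scaleE a u) (scaleE b u))).
by move=> x [[-> ->] [-> ->]]; rewrite mulrDl.
Qed.

HB.instance Definition _ := GRing.Zmodule_isLmodule.Build R[i] Linf
  Linf_scaleA Linf_scale1 Linf_scaleDr Linf_scaleDl.

Lemma Linf_addE (u v : Linf) : \forall x \ae mu, (u + v : Linf) x = u x + v x.
Proof. exact: addE. Qed.

Lemma Linf_oppE (u : Linf) : \forall x \ae mu, (- u : Linf) x = - u x.
Proof. exact: oppE. Qed.

Lemma Linf_zeroE : \forall x \ae mu, (0 : Linf) x = 0.
Proof. exact: zeroE. Qed.

Lemma Linf_scaleE c (u : Linf) : \forall x \ae mu, (c *: u : Linf) x = c * u x.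
Proof. exact: scaleE. Qed.

Definition Linf_norm (u : Linf) : R := fine 'N[mu]_+oo[EFin \o cnorm u]%E.

(* The weak* topology: the coarsest one making continuous all the pairings
   with the elements of the predual L_1(mu). *)
Definition L1_fun : Type := {g : T -> R[i] | cintegrable g}.

Definition Linf_pairing (g : L1_fun) (u : Linf) : R[i]^o :=
  cintegral (fun x => u x * sval g x).

HB.instance Definition _ := Topological.copy Linf
  (sup_topology (fun h : L1_fun =>
     Topological.on (initial_topology (Linf_pairing h)))).

Lemma Linf_cvgP (F : set_system Linf) (u : Linf) : Filter F ->
  F --> u <-> forall h : L1_fun, Linf_pairing h @ F --> Linf_pairing h u.
Proof.
move=> FF; split=> [Fu h|Fu].
  move/(cvg_sup _ u FF) : Fu => /(_ h) Fu.
  move=> A /(@initial_continuous _ _ (Linf_pairing h) u); exact: Fu.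
apply/(cvg_sup _ u FF) => h A.
rewrite (@nbhsE (initial_topology (Linf_pairing h))) => -[B [[C oC <-] Cu] BA].
by apply: (@filterS _ F _ _ _ BA); apply: Fu; exact: open_nbhs_nbhs.
Qed.

End Linf_functions.

Arguments Linf {d T R} mu.

Section operators.
Context d {T : measurableType d} {R : realType}.
Variable mu : {measure set T -> \bar R}.
Local Notation L := (Linf mu).

(* A (possibly unbounded) operator on L_infty is identified with its graph, so
   that [closure A] is the graph closed in the product of the weak* topologies
   and equality of operators includes equality of their domains. *)
Definition functional_graph (A : set (L * L)) :=
  forall u v w, A (u, v) -> A (u, w) -> v = w.

Definition weakstar_closable (A : set (L * L)) := functional_graph (closure A).

(* Composing the graphs gives the square its natural domain
   {u in D(A) | A u in D(A)}. *)
Definition op_sqr (A : set (L * L)) : set (L * L) :=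
  [set p | exists2 w, A (p.1, w) & A (w, p.2)].

Definition op_opp (A : set (L * L)) : set (L * L) :=
  [set p | A (p.1, - p.2)].

Definition bounded_op (B : L -> L) :=
  linear B /\ exists M, forall u, Linf_norm (B u) <= M * Linf_norm u.

(* The value [S t] is only relevant for t > 0. *)
Definition weakstar_continuous_semigroup (S : R -> L -> L) :=
  [/\ forall t, 0 < t -> bounded_op (S t) /\ continuous (S t),
      forall s t u, 0 < s -> 0 < t -> S (s + t) u = S s (S t u),
      forall t u, 0 < t -> {for t, continuous (S^~ u)} &
      forall u, S t u @[t --> 0^'+] --> u].

Definition generates (H : set (L * L)) (S : R -> L -> L) := forall u v,
  H (u, v) <-> (t^-1)%:C *: (u - S t u) @[t --> 0^'+] --> v.

Definition Linf_nonneg (u : L) := \forall x \ae mu, 0 <= u x.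

Definition positive_semigroup (S : R -> L -> L) :=
  forall t u, 0 < t -> Linf_nonneg u -> Linf_nonneg (S t u).

Definition contractive_semigroup (S : R -> L -> L) :=
  forall t u, 0 < t -> Linf_norm (S t u) <= Linf_norm u.

(* Complex differentiability in the operator norm. *)
Definition op_differentiable (F : R[i] -> L -> L) (z : R[i]) :=
  exists2 D : L -> L, bounded_op D &
  forall e : R, 0 < e -> exists2 r : R, 0 < r &
  forall w, 0 < Normc.normc (w - z) < r -> forall u,
    Linf_norm ((w - z)^-1 *: (F w u - F z u) - D u) <= e * Linf_norm u.

Definition holomorphic_right_half_plane (S : R -> L -> L) :=
  exists F : R[i] -> L -> L,
  [/\ forall t u, 0 < t -> F t%:C u = S t u,
      forall z, 0 < complex.Re z -> bounded_op (F z),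
      forall z w u, 0 < complex.Re z -> 0 < complex.Re w ->
        F (z + w) u = F z (F w u) &
      forall z, 0 < complex.Re z -> op_differentiable F z].

End operators.

Section differential_operators.
Context {R : realType}.

Definition smooth (f : R -> R) := forall n x, derivable (derive1n n f) x 1.

Definition locally_bounded (f : R -> R) :=
  forall K : set R, compact K -> [bounded f x | x in K].

Definition cderive1 (f : R -> R[i]) : R -> R[i] := fun x =>
  (derive1 (fun y => complex.Re (f y)) x) +i*
  (derive1 (fun y => complex.Im (f y)) x).

Definition C1 (f : R -> R) :=
  (forall x, derivable f x 1) /\ continuous (derive1 f).

Definition compactly_supported (f : R -> R[i]) :=
  compact (closure [set x | f x != 0]).

Definition C1_c : set (R -> R[i]) := [set f |
  [/\ C1 (fun x => complex.Re (f x)), C1 (fun x => complex.Im (f x)) &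
      compactly_supported f]].

Definition Cinfty_c : set (R -> R[i]) := [set f |
  [/\ smooth (fun x => complex.Re (f x)), smooth (fun x => complex.Im (f x)) &
      compactly_supported f]].

Variables (rho a : R -> R).
Local Notation L := (Linf (weighted_lebesgue rho)).

Definition represents (f : R -> R[i]) (u : L) :=
  \forall x \ae weighted_lebesgue rho, u x = f x.

Definition X_op (D : set (R -> R[i])) : set (L * L) :=
  [set p | exists2 f, D f & represents f p.1 /\
                            represents (fun x => (a x)%:C * cderive1 f x) p.2].

Definition X_min : set (L * L) := X_op Cinfty_c.
Definition X_max : set (L * L) := X_op C1_c.
Definition H_min : set (L * L) := op_opp (op_sqr X_min).
Definition H_max : set (L * L) := op_opp (op_sqr X_max).

End differential_operators.

Arguments represents {R} rho.
Arguments X_op {R} rho a.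
Arguments X_min {R} rho a.
Arguments X_max {R} rho a.
Arguments H_min {R} rho a.
Arguments H_max {R} rho a.

(* Main.v *)
(* In the coordinate y = tau(x), tau' = 1/a, which by the divergence of the two
   integrals runs through the whole line, the operator a d/dx becomes d/dy on
   L_infty(dy), and weak* convergence becomes convergence against L1(dy). The
   closure of X is then the distributional derivative Xt, the set of all (u, v)
   with u(y + s) - u(y) equal to the integral of v over [y, y + s]; mollification
   and cutoff approximate it by test functions. An integration by parts expresses
   the middle term of (u, w), (w, v) in Xt by u and v through operators with a
   preadjoint, so Xt^2 is weak* closed, and the semigroup is convolution with the
   complex-time Gaussian kernel. Its normalization N(zeta), the integral of
   exp(- zeta y^2), is handled without a contour integral: scaling gives
   2 zeta N' = - N, so zeta N^2 is constant on the half-plane. *)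
From HB Require Import structures.
Require Import Defs.
From mathcomp Require Import all_boot all_order all_algebra.
From mathcomp Require Import complex.
From mathcomp Require Import all_classical all_reals all_analysis.
From mathcomp Require Import measurable_realfun ess_sup_inf ring lra.

Set Implicit Arguments.
Unset Strict Implicit.
Unset Printing Implicit Defensive.

Import Order.TTheory GRing.Theory Num.Theory.
Import numFieldNormedType.Exports.

Local Open Scope classical_set_scope.
Local Open Scope ring_scope.

(** * Integrals of complex-valued functions *)

(** The weak* topology is not metrizable. A closure is therefore entered along sequences
    ([seq_closure]) but left only through equations between operators with a preadjoint, which
    survive the closure ([closure_eq]). This is why the derivative is encoded by increments:
    [Tr s u - u = Av s v] is such an equation. For the square the obstacle is that convergence of
    the outer terms [u] and [v] does not by itself control the middle term. As [a] need not be
    smooth, the flow coordinate carries C1 functions to C1 functions but not smooth ones to smooth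
    ones. Hence the minimal operator is compared with the maximal one by mollifying in x, while all
    other mollifications take place in y. The identity zeta N^2 = N(1)^2 does double duty: N has no
    zero, and 1/N = zeta N / N(1)^2 is holomorphic without a quotient rule. That the generator has
    no larger domain than the closed operator comes from smoothing: S_e maps everything into that
    domain, and closedness recovers the original vector as e tends to 0. *)

Notation nrm := (@Normc.normc _).
Arguments Normc.normc : simpl never.

Section complex_modulus.
Context {R : realType}.
Implicit Types z w : R[i].

Lemma nrmD z w : nrm (z + w) <= nrm z + nrm w. Proof. exact: le_normcD. Qed.

Lemma nrmN z : nrm (- z) = nrm z. Proof. exact: normcN. Qed.

Lemma nrmB z w : nrm (z - w) = nrm (w - z). Proof. by rewrite -nrmN opprB. Qed.

Lemma nrm_Re z : `|complex.Re z| <= nrm z.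
Proof.
case: z => x y; rewrite /Normc.normc/= -(sqrtr_sqr x) ler_sqrt ?addr_ge0 ?sqr_ge0//.
by rewrite lerDl sqr_ge0.
Qed.

Lemma nrm_Im z : `|complex.Im z| <= nrm z.
Proof.
case: z => x y; rewrite /Normc.normc/= -(sqrtr_sqr y) ler_sqrt ?addr_ge0 ?sqr_ge0//.
by rewrite lerDr sqr_ge0.
Qed.

Lemma nrm_real (r : R) : nrm r%:C%C = `|r|.
Proof. by rewrite /Normc.normc/= expr0n/= addr0 sqrtr_sqr. Qed.

Lemma nrm_imag (r : R) : nrm (Complex 0 r) = `|r|.
Proof. by rewrite /Normc.normc/= expr0n/= add0r sqrtr_sqr. Qed.

Lemma nrm_le_ReIm z : nrm z <= `|complex.Re z| + `|complex.Im z|.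
Proof.
have -> : z = (complex.Re z)%:C%C + Complex 0 (complex.Im z).
  by case: z => x y; apply/eqP; rewrite eq_complex /= addr0 add0r !eqxx.
rewrite (le_trans (nrmD _ _))// nrm_real nrm_imag /=.
by rewrite addr0 add0r.
Qed.

Lemma nrm_sqr z : nrm z ^+ 2 = complex.Re z ^+ 2 + complex.Im z ^+ 2.
Proof. by case: z => x y; rewrite /Normc.normc/= sqr_sqrtr// addr_ge0 ?sqr_ge0. Qed.

Lemma nrm_eq0 z : (nrm z == 0) = (z == 0).
Proof.
apply/eqP/eqP => [|->]; first exact: Normc.eq0_normc.
exact: Normc.normc0.
Qed.

Lemma nrm_gt0 z : (0 < nrm z) = (z != 0).
Proof. by rewrite lt0r normc_ge0 andbT nrm_eq0. Qed.

Lemma normE z : `|z| = (nrm z)%:C%C. Proof. by []. Qed.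

Lemma ReD z w : complex.Re (z + w) = complex.Re z + complex.Re w.
Proof. by case: z w => ? ? []. Qed.

Lemma ImD z w : complex.Im (z + w) = complex.Im z + complex.Im w.
Proof. by case: z w => ? ? []. Qed.

Lemma ReN z : complex.Re (- z) = - complex.Re z. Proof. by case: z. Qed.

Lemma ImN z : complex.Im (- z) = - complex.Im z. Proof. by case: z. Qed.

Lemma ReM z w : complex.Re (z * w) =
  complex.Re z * complex.Re w - complex.Im z * complex.Im w.
Proof. by case: z w => ? ? []. Qed.

Lemma ImM z w : complex.Im (z * w) =
  complex.Re z * complex.Im w + complex.Im z * complex.Re w.
Proof. by case: z w => ? ? []. Qed.

Lemma ReZ (r : R) z : complex.Re (r%:C%C * z) = r * complex.Re z.
Proof. by rewrite ReM/= mul0r subr0. Qed.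

Lemma ImZ (r : R) z : complex.Im (r%:C%C * z) = r * complex.Im z.
Proof. by rewrite ImM/= mul0r addr0. Qed.

Lemma complex_ext z w :
  complex.Re z = complex.Re w -> complex.Im z = complex.Im w -> z = w.
Proof. by case: z w => ? ? [? ?] /= -> ->. Qed.

(** The norm of [R[i]] takes complex values, so that the radii in its neighbourhoods are complex
    numbers with zero imaginary part. This passes to limits of real functions, where squeezing and
    ordering are available. *)
Lemma cvg_nrmP {I : Type} (F : set_system I) {FF : Filter F}
    (f : I -> R[i]^o) (l : R[i]^o) :
  (f x @[x --> F] --> l) <-> (nrm (f x - l) @[x --> F] --> (0 : R)).
Proof.
split=> [/cvgrPdist_lt fl|fl].
  apply/cvgr0Pnorm_lt => e e0.
  have := fl e%:C%C; rewrite ltcE/= eqxx e0 => /(_ isT); apply: filterS => x.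
  by rewrite normE ltcE/= eqxx/= ger0_norm ?normc_ge0// nrmB.
apply/cvgrPdist_lt => e; rewrite ltcE/= => /andP[/eqP eI e0].
move/cvgr0Pnorm_lt : fl => /(_ _ e0); apply: filterS => x.
rewrite normE ltcE/= eI eqxx/= ger0_norm ?normc_ge0//.
by rewrite nrmB.
Qed.

(** Rotating an integral onto the positive axis lets [nrm_cintegral] bound its modulus through a
    real part, without a factor 2. *)
Lemma phase z : exists2 c : R[i], nrm c = 1 & c * z = (nrm z)%:C%C.
Proof.
have [->|z0] := eqVneq z 0; first by exists 1; rewrite ?Normc.normc1// mulr0 Normc.normc0.
exists ((nrm z)%:C%C * z^-1).
  rewrite Normc.normcM nrm_real Normc.normcV ger0_norm ?normc_ge0//.
  by rewrite mulfV// nrm_eq0.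
by rewrite mulfVK.
Qed.

End complex_modulus.

Section complex_measurability.
Context d {T : measurableType d} {R : realType}.
Implicit Types f g : T -> R[i].

Lemma cmeas_cst (c : R[i]) : cmeasurable (fun _ : T => c).
Proof. by split; exact: measurable_cst. Qed.

Lemma cmeasD f g : cmeasurable f -> cmeasurable g ->
  cmeasurable (fun x => f x + g x).
Proof.
move=> [f1 f2] [g1 g2]; split.
  by under eq_fun do rewrite ReD; exact: measurable_funD.
by under eq_fun do rewrite ImD; exact: measurable_funD.
Qed.

Lemma cmeasN f : cmeasurable f -> cmeasurable (fun x => - f x).
Proof.
move=> [f1 f2]; split.
  by under eq_fun do rewrite ReN; exact: measurableT_comp.
by under eq_fun do rewrite ImN; exact: measurableT_comp.
Qed.

Lemma cmeasB f g : cmeasurable f -> cmeasurable g ->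
  cmeasurable (fun x => f x - g x).
Proof. by move=> mf mg; apply: cmeasD => //; exact: cmeasN. Qed.

Lemma cmeasM f g : cmeasurable f -> cmeasurable g ->
  cmeasurable (fun x => f x * g x).
Proof.
move=> [f1 f2] [g1 g2]; split.
  under eq_fun do rewrite ReM.
  by apply: measurable_funB; exact: measurable_funM.
under eq_fun do rewrite ImM.
by apply: measurable_funD; exact: measurable_funM.
Qed.

Lemma cmeas_real (f : T -> R) : measurable_fun [set: T] f ->
  cmeasurable (fun x => (f x)%:C%C).
Proof. by move=> mf; split => //; exact: measurable_cst. Qed.

Lemma cmeas_nrm f : cmeasurable f -> measurable_fun [set: T] (fun x => nrm (f x)).
Proof.
move=> [f1 f2].
rewrite (_ : (fun _ => _) = fun x =>
  Num.sqrt (complex.Re (f x) ^+ 2 + complex.Im (f x) ^+ 2)); last first.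
  by apply/funext => x; case: (f x).
have ms : measurable_fun [set: R] (@Num.sqrt R).
  by apply: continuous_measurable_fun; exact: sqrt_continuous.
apply: (measurableT_comp ms).
by apply: measurable_funD; exact: measurable_funX.
Qed.

Lemma cmeas_comp d' (T' : measurableType d') (h : T' -> T) f :
  measurable_fun [set: T'] h -> cmeasurable f -> cmeasurable (f \o h).
Proof.
by move=> mh [f1 f2]; split; [exact: (measurableT_comp f1)|exact: (measurableT_comp f2)].
Qed.

End complex_measurability.

Section complex_integral.
Context d {T : measurableType d} {R : realType}.
Variable mu : {measure set T -> \bar R}.
Implicit Types f g : T -> R[i].

Local Notation "\L1 f" := (\int[mu]_x nrm (f x))%R (at level 60).

(** Each part is at most the modulus, and the modulus is at most the sum of the two parts. All
    domination arguments below go through the modulus. *)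
Lemma cintegrableP f : cintegrable mu f <->
  cmeasurable f /\ mu.-integrable [set: T] (fun x => (nrm (f x))%:E).
Proof.
split=> [[i1 i2]|[mf /integrableP[mn fin]]].
  have mf : cmeasurable f.
    by split; apply/measurable_EFinP; [exact: measurable_int i1|exact: measurable_int i2].
  split => //.
  apply: (le_integrable measurableT _ _
      (integrableD measurableT (integrable_abse i1) (integrable_abse i2))) => //=.
    by apply/measurable_EFinP; exact: cmeas_nrm.
  move=> x _; rewrite lee_fin ger0_norm ?normc_ge0//.
  rewrite [leRHS]ger0_norm ?addr_ge0//; exact: nrm_le_ReIm.
have [f1 f2] := mf.
split; apply: (le_integrable measurableT _ _ (g := fun x => (nrm (f x))%:E)) => //=.
- exact/measurable_EFinP.
- by move=> x _; rewrite lee_fin [leRHS]ger0_norm ?normc_ge0//; exact: nrm_Re.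
- exact/integrableP.
- exact/measurable_EFinP.
- by move=> x _; rewrite lee_fin [leRHS]ger0_norm ?normc_ge0//; exact: nrm_Im.
- exact/integrableP.
Qed.

Lemma cint_meas f : cintegrable mu f -> cmeasurable f.
Proof. by move=> /cintegrableP[]. Qed.

Lemma cint_nrm f : cintegrable mu f ->
  mu.-integrable [set: T] (fun x => (nrm (f x))%:E).
Proof. by move=> /cintegrableP[]. Qed.

Lemma cint_dom f (g : T -> R) : cmeasurable f ->
  mu.-integrable [set: T] (EFin \o g) -> (forall x, nrm (f x) <= g x) ->
  cintegrable mu f.
Proof.
move=> mf ig fg; apply/cintegrableP; split => //.
apply: (le_integrable measurableT _ _ ig) => //=.
  by apply/measurable_EFinP; exact: cmeas_nrm.
move=> x _; rewrite lee_fin ger0_norm ?normc_ge0// (le_trans (fg x))//.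
exact: ler_norm.
Qed.

Lemma cintD f g : cintegrable mu f -> cintegrable mu g ->
  cintegrable mu (fun x => f x + g x).
Proof.
move=> /cintegrableP[mf i] /cintegrableP[mg j].
apply: (cint_dom _ (integrableD measurableT i j)); first exact: cmeasD.
by move=> x /=; exact: nrmD.
Qed.

Lemma cintZ c f : cintegrable mu f -> cintegrable mu (fun x => c * f x).
Proof.
move=> /cintegrableP[mf i].
apply: (cint_dom _ (integrableZl measurableT (nrm c) i)).
  by apply: cmeasM => //; exact: cmeas_cst.
by move=> x /=; rewrite Normc.normcM.
Qed.

Lemma cintN f : cintegrable mu f -> cintegrable mu (fun x => - f x).
Proof.
by move=> /(cintZ (-1)); under eq_fun do rewrite mulN1r.
Qed.

Lemma cintB f g : cintegrable mu f -> cintegrable mu g ->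
  cintegrable mu (fun x => f x - g x).
Proof. by move=> i j; apply: cintD => //; exact: cintN. Qed.

Lemma cintMb f g (M : R) : cintegrable mu g -> cmeasurable f ->
  (forall x, nrm (f x) <= M) -> cintegrable mu (fun x => f x * g x).
Proof.
move=> /cintegrableP[mg i] mf fM.
apply: (cint_dom _ (integrableZl measurableT M i)); first exact: cmeasM.
by move=> x /=; rewrite Normc.normcM ler_wpM2r ?normc_ge0.
Qed.

Lemma eq_cintegral f g : f =1 g -> cintegral mu f = cintegral mu g.
Proof. by move=> /funext ->. Qed.

Lemma cintegralD f g : cintegrable mu f -> cintegrable mu g ->
  cintegral mu (fun x => f x + g x) = cintegral mu f + cintegral mu g.
Proof.
move=> [f1 f2] [g1 g2]; apply: complex_ext => /=.
  by rewrite -(RintegralD measurableT f1 g1); apply: eq_Rintegral => x _; rewrite ReD.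
by rewrite -(RintegralD measurableT f2 g2); apply: eq_Rintegral => x _; rewrite ImD.
Qed.

Lemma cintegralZ c f : cintegrable mu f ->
  cintegral mu (fun x => c * f x) = c * cintegral mu f.
Proof.
move=> [f1 f2].
apply: complex_ext => /=.
  rewrite ReM/= -(RintegralZl _ measurableT f1) -(RintegralZl _ measurableT f2).
  rewrite -RintegralB//;
    [|exact: (integrableZl measurableT _ f1)|exact: (integrableZl measurableT _ f2)].
  by apply: eq_Rintegral => x _; rewrite ReM.
rewrite ImM/= -(RintegralZl _ measurableT f1) -(RintegralZl _ measurableT f2).
rewrite -RintegralD//;
  [|exact: (integrableZl measurableT _ f2)|exact: (integrableZl measurableT _ f1)].
by apply: eq_Rintegral => x _; rewrite ImM.
Qed.

Lemma cintegralN f : cintegrable mu f ->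
  cintegral mu (fun x => - f x) = - cintegral mu f.
Proof.
move=> i; rewrite -mulN1r -cintegralZ//.
by apply: eq_cintegral => x; rewrite mulN1r.
Qed.

Lemma cintegralB f g : cintegrable mu f -> cintegrable mu g ->
  cintegral mu (fun x => f x - g x) = cintegral mu f - cintegral mu g.
Proof. by move=> i j; rewrite cintegralD ?cintegralN//; exact: cintN. Qed.

Lemma cintegral0 : cintegral mu (fun=> 0) = 0.
Proof.
by apply: complex_ext; rewrite /= /Rintegral integral_cst//= mul0e.
Qed.

Lemma nrm_cintegral f : cintegrable mu f -> nrm (cintegral mu f) <= \L1 f.
Proof.
move=> i; have [c c1 cI] := phase (cintegral mu f).
rewrite -[leLHS]/(complex.Re (nrm (cintegral mu f))%:C%C) -cI -cintegralZ//.
rewrite [leLHS]/=; apply: le_Rintegral => //.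
- by have [] := cintZ c i.
- by have := cint_nrm i.
move=> x _; apply: (le_trans (ler_norm _)); apply: (le_trans (nrm_Re _)).
by rewrite Normc.normcM c1 mul1r.
Qed.

Lemma L1_ge0 f : 0 <= \L1 f.
Proof. by apply: Rintegral_ge0 => x _; exact: normc_ge0. Qed.

Lemma L1D f g : cintegrable mu f -> cintegrable mu g ->
  \L1 (fun x => f x + g x) <= (\L1 f) + (\L1 g).
Proof.
move=> i j; rewrite -RintegralD//; [|exact: cint_nrm|exact: cint_nrm].
apply: le_Rintegral => //; first exact: (cint_nrm (cintD i j)).
  exact: (integrableD measurableT (cint_nrm i) (cint_nrm j)).
by move=> x _; exact: nrmD.
Qed.

Lemma L1Z c f : cintegrable mu f -> \L1 (fun x => c * f x) = nrm c * \L1 f.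
Proof.
move=> i; rewrite -RintegralZl//; last exact: cint_nrm.
by apply: eq_Rintegral => x _; rewrite Normc.normcM.
Qed.

Lemma L1_le f (g : T -> R) : cintegrable mu f -> mu.-integrable [set: T] (EFin \o g) ->
  (forall x, nrm (f x) <= g x) -> \L1 f <= (\int[mu]_x g x)%R.
Proof. by move=> i ig fg; apply: le_Rintegral => //; exact: cint_nrm. Qed.

Lemma L1Mb f g (M : R) : cintegrable mu g -> cmeasurable f ->
  (forall x, nrm (f x) <= M) -> \L1 (fun x => f x * g x) <= M * \L1 g.
Proof.
move=> i mf fM; rewrite -RintegralZl//; last exact: cint_nrm.
apply: L1_le; first exact: cintMb i mf fM.
  by apply: (integrableZl measurableT M (cint_nrm i)).
by move=> x /=; rewrite Normc.normcM ler_wpM2r ?normc_ge0.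
Qed.

Lemma nrm_cintegralMb f g (M : R) : cintegrable mu g -> cmeasurable f ->
  (forall x, nrm (f x) <= M) ->
  nrm (cintegral mu (fun x => f x * g x)) <= M * \L1 g.
Proof.
move=> i mf fM; apply: le_trans (L1Mb i mf fM).
exact/nrm_cintegral/(cintMb i mf fM).
Qed.

Lemma ae_eq_cintegral f g : cmeasurable f -> cmeasurable g ->
  (\forall x \ae mu, f x = g x) -> cintegral mu f = cintegral mu g.
Proof.
move=> [f1 f2] [g1 g2] fg; apply: complex_ext => /=; congr fine;
  apply: ae_eq_integral => //; try exact/measurable_EFinP;
  by apply: filterS fg => x ->.
Qed.

Lemma ae_L1_eq0 f : cintegrable mu f -> \L1 f = 0 -> \forall x \ae mu, f x = 0.
Proof.
move=> i; rewrite /Rintegral => L0.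
have mn : measurable_fun setT (fun x => (nrm (f x))%:E).
  by apply/measurable_EFinP/cmeas_nrm/(cint_meas i).
have fin : (\int[mu]_x (nrm (f x))%:E)%E \is a fin_num.
  exact: integrable_fin_num (cint_nrm i).
have : (\int[mu]_x `|(nrm (f x))%:E| = 0)%E.
  under eq_integral do rewrite gee0_abs ?lee_fin ?normc_ge0//.
  by rewrite -(fineK fin) L0.
move/(ae_eq_integral_abs _ measurableT mn).1; apply: filterS => x /(_ I)/=.
by case=> /Normc.eq0_normc.
Qed.

(** The differences are dominated by [2 * g]. The conclusion is convergence in L1, stronger than
    convergence of the integrals; continuity of translations needs this form. *)
Lemma cdominated (f_ : (T -> R[i])^nat) f (g : T -> R) :
  (forall n, cmeasurable (f_ n)) -> cmeasurable f ->
  (\forall x \ae mu, nrm (f_ n x - f x) @[n --> \oo] --> (0 : R)) ->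
  mu.-integrable [set: T] (EFin \o g) ->
  (forall n x, nrm (f_ n x) <= g x) ->
  (forall x, nrm (f x) <= g x) ->
  (\L1 (fun x => f_ n x - f x)) @[n --> \oo] --> (0 : R).
Proof.
move=> mf_ mf f_f ig f_g fg.
have mn n : measurable_fun setT (fun x => nrm (f_ n x - f x)).
  by apply: cmeas_nrm; exact: cmeasB.
have [] := @dominated_convergence _ _ _ mu setT measurableT
    (fun n x => (nrm (f_ n x - f x))%:E) (cst 0) (fun x => (2 * g x)%:E).
- by move=> n; exact/measurable_EFinP.
- exact: measurable_cst.
- apply: filterS f_f => x cx _; apply/fine_cvgP; split; first exact: nearW.
  exact: cx.
- by apply: (integrableZl measurableT 2 ig).
- apply: nearW => x n _ /=; rewrite lee_fin ger0_norm ?normc_ge0//.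
  by rewrite (le_trans (nrmD _ _))// nrmN mulrDl mul1r lerD.
move=> _ _; rewrite integral_cst//= mul0e => /fine_cvgP[_]/=; exact.
Qed.

Lemma cdominated_cintegral (f_ : (T -> R[i])^nat) f (g : T -> R) :
  (forall n, cmeasurable (f_ n)) -> cmeasurable f ->
  (\forall x \ae mu, nrm (f_ n x - f x) @[n --> \oo] --> (0 : R)) ->
  mu.-integrable [set: T] (EFin \o g) ->
  (forall n x, nrm (f_ n x) <= g x) ->
  (forall x, nrm (f x) <= g x) ->
  nrm (cintegral mu (f_ n) - cintegral mu f) @[n --> \oo] --> (0 : R).
Proof.
move=> mf_ mf f_f ig f_g fg.
have := cdominated mf_ mf f_f ig f_g fg; apply: squeeze_cvgr; last exact: cvg_cst.
apply: nearW => n; apply/andP; split; first exact: normc_ge0.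
have i_ := cint_dom (mf_ n) ig (f_g n); have i := cint_dom mf ig fg.
by rewrite -(cintegralB i_ i); apply/nrm_cintegral/cintB.
Qed.

End complex_integral.

(** * Integration against a density and substitution *)

Section weighted_integral.
Context {R : realType}.
Variable J : R -> R.
Hypotheses (mJ : measurable_fun [set: R] J) (J0 : forall x, 0 <= J x).
Local Notation leb := (@lebesgue_measure R).
Local Notation W := (weighted_lebesgue J).
Local Open Scope ereal_scope.

Import HBNNSimple.

Let mJE : measurable_fun [set: R] (EFin \o J).
Proof. exact/measurable_EFinP. Qed.

Let weighted_indic (E : set R) : measurable E ->
  \int[W]_x (\1_E x)%:E = \int[leb]_x ((\1_E x)%:E * (J x)%:E).
Proof.
move=> mE; rewrite integral_indic// setIT [LHS](weighted_lebesgueE _ mJ J0).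
rewrite integral_mkcond; apply: eq_integral => x _.
by rewrite /= patchE indicE; case: (x \in E); rewrite ?mul1e ?mul0e.
Qed.

Let weighted_nnsfun (h : {nnsfun measurableTypeR R >-> R}) :
  \int[W]_x (h x)%:E = \int[leb]_x ((h x)%:E * (J x)%:E).
Proof.
under [LHS]eq_integral do rewrite fimfunE -fsumEFin//.
rewrite [LHS]ge0_integral_fsum//; last 2 first.
  - by move=> r; exact/measurable_EFinP/measurableT_comp.
  - by move=> n x _; rewrite EFinM nnfun_muleindic_ge0.
under [RHS]eq_integral.
  move=> x xD; rewrite fimfunE -fsumEFin// ge0_mule_fsuml; last first.
    by move=> r; rewrite EFinM nnfun_muleindic_ge0.
  over.
rewrite [RHS]ge0_integral_fsum//; last 2 first.
  - move=> r; apply: emeasurable_funM => //.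
    by apply/measurable_EFinP; exact/measurableT_comp.
  - by move=> n x _; rewrite mule_ge0 ?lee_fin//; have := nnfun_muleindic_ge0 h n x.
apply: eq_fsbigr => r _.
rewrite (_ : (fun x : measurableTypeR R => (r * \1_(h @^-1` [set r]) x)%:E) =
  fun x => r%:E * (\1_(h @^-1` [set r]) x)%:E)//.
rewrite integralZl_indic_nnsfun//= weighted_indic; last exact: (measurable_sfunP h).
(* A negative [r] is not a value of [h]; its level set is empty and both sides vanish. *)
have [r0|r0] := leP 0%R r.
  under [RHS]eq_integral do rewrite EFinM -muleA.
  rewrite ge0_integralZl//.
  - by apply: emeasurable_funM => //; apply/measurable_EFinP.
  - by move=> x _; rewrite mule_ge0// lee_fin.
have -> : h @^-1` [set r] = set0.
  by rewrite preimage_nnfun0.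
rewrite integral0_eq ?mule0; last by move=> x _; rewrite indic0 mul0e.
by rewrite integral0_eq// => x _; rewrite indic0 mulr0 mul0e.
Qed.

(** Monotone convergence on both sides along the same increasing simple functions, for which the
    formula was checked indicator by indicator. *)
Lemma ge0_integral_weighted (f : R -> \bar R) :
  measurable_fun [set: R] f -> (forall x, 0 <= f x) ->
  \int[W]_x f x = \int[leb]_x (f x * (J x)%:E).
Proof.
move=> mf f0; pose f_ := @nnsfun_approx _ (measurableTypeR R) _ _ measurableT f mf.
transitivity (limn (fun n => \int[W]_x (f_ n x)%:E)).
  rewrite -monotone_convergence//=.
  - by apply: eq_integral => x _; apply/esym/cvg_lim => //=; exact: cvg_nnsfun_approx.
  - by move=> n; exact: measurableT_comp.
  - by move=> n x _; rewrite lee_fin.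
  - by move=> x _ a b ab; rewrite lee_fin//; exact/lefP/nd_nnsfun_approx.
transitivity (limn (fun n => \int[leb]_x ((f_ n x)%:E * (J x)%:E))).
  by congr (limn _); apply/funext => n; exact: weighted_nnsfun.
rewrite -monotone_convergence//=.
- apply: eq_integral => x _; apply/cvg_lim => //=.
  by apply: cvgeZr => //; exact: cvg_nnsfun_approx.
- move=> n; apply: emeasurable_funM => //.
  by apply/measurable_EFinP.
- by move=> n x _; rewrite mule_ge0 ?lee_fin.
- move=> x _ a b ab; rewrite lee_wpmul2r ?lee_fin//.
  exact/lefP/nd_nnsfun_approx.
Qed.

End weighted_integral.

Section image_density.
Context {R : realType}.
Variables (J : R -> R) (phi : R -> R) (mu : {measure set (measurableTypeR R) -> \bar R}).
Hypotheses (mJ : measurable_fun [set: R] J) (J0 : forall x, 0 <= J x).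
Hypothesis mphi : measurable_fun [set: measurableTypeR R] (phi : _ -> measurableTypeR R).
Hypothesis muE : forall A : set (measurableTypeR R), measurable A ->
  mu A = weighted_lebesgue J (phi @^-1` A).
Local Notation leb := (@lebesgue_measure R).

(** By [muE], [mu] is the push-forward under [phi] of the measure with density [J]. The same
    substitution formula serves for the affine maps of the line and for the flow coordinate. *)
Lemma ge0_integral_image (f : R -> \bar R) :
  measurable_fun [set: R] f -> (forall x, 0 <= f x)%E ->
  (\int[mu]_x f x = \int[leb]_x (f (phi x) * (J x)%:E))%E.
Proof.
move=> mf f0.
have mfp : measurable_fun [set: R] (f \o phi) by exact: measurableT_comp.
rewrite -(ge0_integral_weighted mJ J0 mfp) => [|x]; last exact: f0.
pose mphi_mixin := isMeasurableFun.Build _ _ _ _ _ mphi.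
pose mphi_pack : {mfun _ >-> _} := HB.pack (phi : measurableTypeR R -> measurableTypeR R) mphi_mixin.
transitivity (\int[pushforward (weighted_lebesgue J) mphi_pack]_x f x)%E.
  by apply: eq_measure_integral => A mA _; rewrite muE.
by rewrite (ge0_integral_pushforward mphi)// => y _.
Qed.

Let integral_image_real (f : R -> R) : measurable_fun [set: R] f ->
  (mu.-integrable [set: R] (EFin \o f) <->
   leb.-integrable [set: R] (fun x => (J x * f (phi x))%:E)) /\
  (\int[mu]_x (f x)%:E = \int[leb]_x (J x * f (phi x))%:E)%E.
Proof.
move=> mf.
have mfp : measurable_fun [set: R] (f \o phi) by exact: measurableT_comp.
have mg : measurable_fun [set: R] (fun x => J x * f (phi x)).
  exact: measurable_funM.
split.
  have E : (\int[mu]_x `|(f x)%:E| = \int[leb]_x `|(J x * f (phi x))%:E|)%E.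
    rewrite ge0_integral_image//; last by apply: measurableT_comp => //; exact/measurable_EFinP.
    by apply: eq_integral => x _; rewrite /= normrM (ger0_norm (J0 x)) -EFinM mulrC.
  split=> /integrableP[_ fin]; apply/integrableP; split; try exact/measurable_EFinP.
    by rewrite -E.
  by rewrite /= E.
rewrite integralE [RHS]integralE.
have mE : measurable_fun [set: R] (EFin \o f) by exact/measurable_EFinP.
rewrite ge0_integral_image//; last exact: measurable_funepos.
rewrite ge0_integral_image//; last exact: measurable_funeneg.
congr (_ - _)%E; apply: eq_integral => x _.
  by rewrite !funeposE -!EFin_max -EFinM maxr_pMl// mul0r mulrC.
by rewrite !funenegE -!EFinN -!EFin_max -EFinM maxr_pMl// mul0r mulNr mulrC.
Qed.

Lemma cintegrable_image (f : R -> R[i]) : cmeasurable (f : measurableTypeR R -> _) ->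
  cintegrable mu (f : measurableTypeR R -> _) <->
  cintegrable leb (fun x => (J x)%:C%C * f (phi x)).
Proof.
move=> [f1 f2]; rewrite /cintegrable.
under [X in _ <-> leb.-integrable _ X /\ _]eq_fun do rewrite ReZ.
under [X in _ <-> _ /\ leb.-integrable _ X]eq_fun do rewrite ImZ.
by split=> -[i1 i2]; split; first [exact/(integral_image_real f1).1|exact/(integral_image_real f2).1].
Qed.

Lemma cintegral_image (f : R -> R[i]) : cmeasurable (f : measurableTypeR R -> _) ->
  cintegral mu (f : measurableTypeR R -> _) =
  cintegral leb (fun x => (J x)%:C%C * f (phi x)).
Proof.
move=> [f1 f2]; apply: complex_ext => /=.
  rewrite /Rintegral (integral_image_real f1).2; congr fine.
  by apply: eq_integral => x _; rewrite ReZ.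
rewrite /Rintegral (integral_image_real f2).2; congr fine.
by apply: eq_integral => x _; rewrite ImZ.
Qed.

Lemma Rintegral_image (f : R -> R) : measurable_fun [set: R] f ->
  (\int[mu]_x f x = \int[leb]_x (J x * f (phi x)))%R.
Proof. by move=> mf; rewrite /Rintegral (integral_image_real mf).2. Qed.

End image_density.

Notation mR R := (measurableTypeR R).
Notation leb := (@lebesgue_measure _).
Notation cmes f := (cmeasurable (f : measurableTypeR _ -> _)).
Notation cL1 f := (cintegrable (@lebesgue_measure _) f).
Notation cint f := (cintegral (@lebesgue_measure _) f).
Notation nL1 f := (\int[@lebesgue_measure _]_x nrm (f x))%R.

Section lebesgue_affine.
Context {R : realType}.
Implicit Types (c s : R) (f : R -> R[i]).

Let affine_measurable c s :
  measurable_fun [set: mR R] ((fun x => c * x + s) : mR R -> mR R).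
Proof. by apply: measurable_funD => //; apply: measurable_funM. Qed.

Let weighted_cst c (A : set (mR R)) : 0 <= c -> measurable A ->
  weighted_lebesgue (cst c) A = (c%:E * lebesgue_measure A)%E.
Proof.
move=> c0 mA; rewrite (weighted_lebesgueE A (measurable_cst c) (fun=> c0)).
exact: (integral_cst leb mA c%:E).
Qed.

(** Lebesgue measure is determined by half-open intervals, whose preimages are computed. A negative
    [c] turns them into intervals closed on the left; that case supplies the reflections used for
    convolutions. *)
Lemma lebesgue_affine c s (A : set (mR R)) : c != 0 -> measurable A ->
  lebesgue_measure A =
  weighted_lebesgue (cst `|c|) ((fun x => c * x + s) @^-1` A).
Proof.
move=> c0 mA.
pose mm := isMeasurableFun.Build _ _ _ _ _ (affine_measurable c s).
pose phi : {mfun mR R >-> mR R} := HB.pack ((fun x => c * x + s) : mR R -> mR R) mm.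
rewrite -[RHS]/(pushforward (weighted_lebesgue (cst `|c|)) phi A).
apply: lebesgue_measure_unique => // _ [[a b] _ <-].
rewrite -[RHS]/(weighted_lebesgue (cst `|c|) ((fun x => c * x + s) @^-1` _)).
rewrite weighted_cst//; last first.
  by rewrite -[X in measurable X]setTI; apply: affine_measurable.
have [cn|cp|/eqP] := ltgtP c 0; last by rewrite (negbTE c0).
- have -> : (fun x => c * x + s) @^-1` `]a, b] = `[(b - s) / c, (a - s) / c[%classic.
    apply/seteqP; split => x /=; rewrite !in_itv/= ler_ndivrMr// ltr_ndivlMr//.
      by move=> /andP[? ?]; apply/andP; split; lra.
    by move=> /andP[? ?]; apply/andP; split; lra.
  rewrite !lebesgue_measure_itv/= !lte_fin ltr_nM2r ?invr_lt0// ltrD2r.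
  case: ifPn => _; last by rewrite mule0.
  rewrite -!EFinD -EFinM ltr0_norm//; congr EFin; field.
  by rewrite ltr0_neq0.
- have -> : (fun x => c * x + s) @^-1` `]a, b] = `](a - s) / c, (b - s) / c]%classic.
    apply/seteqP; split => x /=; rewrite !in_itv/= ltr_pdivrMr// ler_pdivlMr//.
      by move=> /andP[? ?]; apply/andP; split; lra.
    by move=> /andP[? ?]; apply/andP; split; lra.
  rewrite !lebesgue_measure_itv/= !lte_fin ltr_pM2r ?invr_gt0// ltrD2r.
  case: ifPn => _; last by rewrite mule0.
  rewrite -!EFinD -EFinM gtr0_norm//; congr EFin; field.
  by rewrite lt0r_neq0.
Qed.

Let image_affine c s : c != 0 -> forall A : set (mR R), measurable A ->
  lebesgue_measure A =
  weighted_lebesgue (cst `|c|) ((fun x => c * x + s) @^-1` A).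
Proof. by move=> c0 A; exact: lebesgue_affine. Qed.

Lemma cL1_affine c s f : c != 0 -> cL1 f -> cL1 (fun x => f (c * x + s)).
Proof.
move=> c0 i; have [H _] := cintegrable_image (measurable_cst _) (fun=> normr_ge0 c)
  (affine_measurable c s) (image_affine s c0) (cint_meas i).
have := cintZ (`|c|^-1)%:C%C (H i); congr cintegrable; apply/funext => x.
by rewrite mulrA -rmorphM/= mulVf ?normr_eq0// mul1r.
Qed.

Lemma cint_affine c s f : c != 0 -> cL1 f ->
  cint (fun x => f (c * x + s)) = (`|c|^-1)%:C%C * cint f.
Proof.
move=> c0 i; have := cintegral_image (measurable_cst _) (fun=> normr_ge0 c)
  (affine_measurable c s) (image_affine s c0) (cint_meas i).
rewrite /= cintegralZ => [->|]; last exact: cL1_affine.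
by rewrite mulrA -rmorphM/= mulVf ?normr_eq0// mul1r.
Qed.

Lemma nL1_affine c s f : c != 0 -> cL1 f ->
  nL1 (fun x => f (c * x + s)) = `|c|^-1 * nL1 f.
Proof.
move=> c0 i; have := Rintegral_image (measurable_cst _) (fun=> normr_ge0 c)
  (affine_measurable c s) (image_affine s c0) (cmeas_nrm (cint_meas i)).
rewrite RintegralZl//= => [->|]; last exact: (cint_nrm (cL1_affine s c0 i)).
by rewrite mulrA mulVf ?normr_eq0// mul1r.
Qed.

Lemma cmes_affine c s f : cmes f -> cmes (fun x => f (c * x + s)).
Proof. exact: cmeas_comp (affine_measurable c s). Qed.

Lemma cmes_shift s f : cmes f -> cmes (fun x => f (x + s)).
Proof. by move/(cmes_affine 1 s); under eq_fun do rewrite mul1r. Qed.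

Lemma cL1_shift s f : cL1 f -> cL1 (fun x => f (x + s)).
Proof. by move/(cL1_affine s (oner_neq0 R)); under eq_fun do rewrite mul1r. Qed.

Lemma Rint_shift s (r : R -> R) : measurable_fun [set: R] r ->
  (\int[leb]_x r (x + s) = \int[leb]_x r x)%R.
Proof.
move=> mr; rewrite [RHS](Rintegral_image (measurable_cst _) (fun=> normr_ge0 (1 : R))
  (affine_measurable 1 s) (image_affine s (oner_neq0 R)) mr).
by apply: eq_Rintegral => x _; rewrite normr1 !mul1r.
Qed.

(** Since the density is 1, no constant has to leave the integral and measurability suffices. This
    spares integrability conditions in the convolution identities. *)
Lemma cint_shift s f : cmes f -> cint (fun x => f (x + s)) = cint f.
Proof.
move=> mf; rewrite [RHS](cintegral_image (measurable_cst _) (fun=> normr_ge0 (1 : R))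
  (affine_measurable 1 s) (image_affine s (oner_neq0 R)) mf).
by apply: eq_cintegral => x; rewrite /cst normr1 !mul1r.
Qed.

Lemma nL1_shift s f : cL1 f -> nL1 (fun x => f (x + s)) = nL1 f.
Proof.
move/(nL1_affine s (oner_neq0 R)); rewrite normr1 invr1 mul1r => <-.
by apply: eq_Rintegral => x _; rewrite mul1r.
Qed.

Let N1 : (-1 : R) != 0. Proof. by rewrite oppr_eq0 oner_neq0. Qed.

Lemma cmes_refl s f : cmes f -> cmes (fun x => f (s - x)).
Proof. by move/(cmes_affine (-1) s); under eq_fun do rewrite mulN1r addrC. Qed.

Lemma cL1_refl s f : cL1 f -> cL1 (fun x => f (s - x)).
Proof. by move/(cL1_affine s N1); under eq_fun do rewrite mulN1r addrC. Qed.

Lemma cint_refl s f : cmes f -> cint (fun x => f (s - x)) = cint f.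
Proof.
move=> mf; rewrite [RHS](cintegral_image (measurable_cst _) (fun=> normr_ge0 (-1 : R))
  (affine_measurable (-1) s) (image_affine s N1) mf).
by apply: eq_cintegral => x; rewrite /cst normrN normr1 mul1r mulN1r addrC.
Qed.

Lemma nL1_refl s f : cL1 f -> nL1 (fun x => f (s - x)) = nL1 f.
Proof.
move/(nL1_affine s N1); rewrite normrN normr1 invr1 mul1r => <-.
by apply: eq_Rintegral => x _; rewrite mulN1r addrC.
Qed.

End lebesgue_affine.

Lemma ae_eq_integrableT d (T : measurableType d) (R : realType)
    (mu : {measure set T -> \bar R}) (f g : T -> \bar R) :
  measurable_fun [set: T] f -> (\forall x \ae mu, f x = g x) ->
  mu.-integrable [set: T] g -> mu.-integrable [set: T] f.
Proof.
move=> mf fg /integrableP[mg ig]; apply/integrableP; split => //.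
rewrite (@ae_eq_integral _ _ _ mu setT (abse \o g) (abse \o f))//.
- exact: measurableT_comp.
- exact: measurableT_comp.
- by apply: filterS fg => x /= ->.
Qed.

(** * Exchange of integrals for complex kernels *)

Section fubini.
Context {R : realType}.

Section real.
Variable f : mR R * mR R -> R.
Hypothesis i : ((@lebesgue_measure R) \x (@lebesgue_measure R))%E.-integrable
  [set: mR R * mR R] (EFin \o f).

(** The inner integral as a real number agrees with the extended one where the section is
    integrable, hence only almost everywhere. *)
Let fubini_F_fin : \forall x \ae (@lebesgue_measure R),
  ((\int[leb]_y f (x, y))%R)%:E = (\int[leb]_y (f (x, y))%:E)%E.
Proof.
apply: filterS (ae_integrable1 i) => x ix.
by rewrite fineK//; exact: integrable_fin_num ix.
Qed.

Let fubini_G_fin : \forall y \ae (@lebesgue_measure R),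
  ((\int[leb]_x f (x, y))%R)%:E = (\int[leb]_x (f (x, y))%:E)%E.
Proof.
apply: filterS (ae_integrable2 i) => y iy.
by rewrite fineK//; exact: integrable_fin_num iy.
Qed.

Let mF : measurable_fun [set: mR R] (fun x => ((\int[leb]_y f (x, y))%R)%:E).
Proof.
apply/measurable_EFinP/measurableT_comp => //.
exact: (measurable_fubini_F i).
Qed.

Let mG : measurable_fun [set: mR R] (fun y => ((\int[leb]_x f (x, y))%R)%:E).
Proof.
apply/measurable_EFinP/measurableT_comp => //.
exact: (measurable_fubini_G i).
Qed.

Lemma Rintegrable_fubini_G :
  (@lebesgue_measure R).-integrable [set: mR R] (fun y => ((\int[leb]_x f (x, y))%R)%:E).
Proof.
have mf := measurable_int _ i.
have msw : measurable_fun [set: mR R * mR R] (fun p => f (p.2, p.1)).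
  apply/measurable_EFinP.
  exact: (measurableT_comp mf (measurable_swap (T1 := mR R) (T2 := mR R))).
have isw : ((@lebesgue_measure R) \x (@lebesgue_measure R))%E.-integrable
    [set: mR R * mR R] (fun p => (f (p.2, p.1))%:E).
  apply/integrable12ltyP; first exact/measurable_EFinP.
  exact/(integrable21ltyP _ _ mf).1.
exact: ae_eq_integrableT fubini_G_fin (integrable_fubini_F isw).
Qed.

Lemma RFubini : (\int[leb]_x \int[leb]_y f (x, y) = \int[leb]_y \int[leb]_x f (x, y))%R.
Proof.
congr fine; transitivity (\int[leb]_x \int[leb]_y (f (x, y))%:E)%E.
  apply: ae_eq_integral => //; first exact: (measurable_fubini_F i).
  by apply: filterS fubini_F_fin => x -> _.
rewrite (Fubini i); apply: ae_eq_integral => //; first exact: (measurable_fubini_G i).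
by apply: filterS fubini_G_fin => x -> _.
Qed.

End real.

Variable F : R -> R -> R[i].
Hypothesis mF : cmeasurable (fun p : mR R * mR R => F p.1 p.2).
Hypothesis iF : forall x, cL1 (F x).
Variable G : R -> R.
Hypothesis iG : (@lebesgue_measure R).-integrable [set: R] (EFin \o G).
Hypothesis FG : forall x, nL1 (F x) <= G x.

(** Tonelli: the iterated integral of the modulus is at most the integral of [G], which is
    finite. *)
Let i : cintegrable ((@lebesgue_measure R) \x (@lebesgue_measure R))%E
  (fun p => F p.1 p.2).
Proof.
apply/cintegrableP; split => //; apply/integrable12ltyP.
  exact/measurable_EFinP/cmeas_nrm.
have mn := cmeas_nrm mF.
have [mG fG] := integrableP _ _ _ iG; apply: le_lt_trans fG.
apply: ge0_le_integral => //=.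
- by move=> x _; apply: integral_ge0.
- apply: (@measurable_fun_fubini_tonelli_F _ _ _ _ _ _
    (fun p : mR R * mR R => `|(nrm (F p.1 p.2))%:E|)%E) => //=.
  by apply/measurable_EFinP; exact: measurableT_comp.
- by apply/measurable_EFinP; apply: measurableT_comp => //; exact/measurable_EFinP.
- move=> x _; under eq_integral do rewrite ger0_norm ?normc_ge0//.
  rewrite -(fineK (integrable_fin_num _ (cint_nrm (iF x))))// lee_fin.
  by rewrite (le_trans (FG x))// ler_norm.
Qed.

Let ae2 : \forall y \ae (@lebesgue_measure R), cL1 (fun x => F x y).
Proof. by case: i => i1 i2; apply: filterS2 (ae_integrable2 i1) (ae_integrable2 i2). Qed.

Lemma cfubini_ae : \forall y \ae (@lebesgue_measure R), cL1 (fun x => F x y).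
Proof. exact: ae2. Qed.

Lemma cfubini_int2 : cL1 (fun y => cint (fun x => F x y)).
Proof. by case: i => i1 i2; split; [exact: (Rintegrable_fubini_G i1)|exact: (Rintegrable_fubini_G i2)]. Qed.

Lemma cFubini : cint (fun x => cint (F x)) = cint (fun y => cint (fun x => F x y)).
Proof.
case: i => i1 i2; apply: complex_ext; [exact: (RFubini i1)|exact: (RFubini i2)].
Qed.

End fubini.

Lemma cvg_seqP {R : realType} (f : R -> R) (p l : R) : f x @[x --> p] --> l <->
  forall u : nat -> R, u n @[n --> \oo] --> p -> f (u n) @[n --> \oo] --> l.
Proof. exact: (@cvg_nbhsP _ R^o). Qed.

(** * Continuity of translations in L1 *)

Section L1_translation.
Context {R : realType}.
Implicit Types (f g : R -> R[i]).

Lemma eq_nL1 f g : f =1 g -> nL1 f = nL1 g.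
Proof. by move=> /funext ->. Qed.

Definition L1_shift_cont f :=
  nL1 (fun x => f (x + s) - f x) @[s --> (0 : R)] --> (0 : R).

Lemma L1_shift_contP f : L1_shift_cont f <->
  forall e, 0 < e -> \forall s \near (0 : R), nL1 (fun x => f (x + s) - f x) < e.
Proof.
split=> [/cvgr0Pnorm_lt h e e0|h].
  by apply: filterS (h e e0) => s; rewrite ger0_norm// L1_ge0.
apply/cvgr0Pnorm_lt => e e0; apply: filterS (h e e0) => s.
by rewrite ger0_norm// L1_ge0.
Qed.

(** The usual e/3 argument: the increment of [f] is the increment of [g] plus two copies of [f - g],
    one translated, which have the same L1 norm by invariance. *)
Lemma L1_shift_cont_approx f : cL1 f ->
  (forall e, 0 < e -> exists g, [/\ cL1 g, L1_shift_cont g & nL1 (fun x => f x - g x) < e]) ->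
  L1_shift_cont f.
Proof.
move=> i H; apply/L1_shift_contP => e e0.
have [|g [ig /L1_shift_contP/(_ (e / 3)) gc fg]] := H (e / 3); first by rewrite divr_gt0.
apply: filterS (gc _); last by rewrite divr_gt0.
move=> s gs.
have ifg := cintB i ig.
have igs := cintB (cL1_shift s ig) ig.
have ifgs := cL1_shift s ifg.
rewrite (@eq_nL1 _ (fun x =>
    (f (x + s) - g (x + s)) + ((g (x + s) - g x) + (-1) * (f x - g x)))); last first.
  by move=> x; ring.
apply: le_lt_trans (L1D ifgs (cintD igs (cintZ (-1) ifg))) _.
rewrite (nL1_shift s ifg).
have := L1D igs (cintZ (-1) ifg); rewrite (L1Z (-1) ifg) nrmN Normc.normc1 mul1r.
lra.
Qed.

Lemma L1_shift_contD f g : cL1 f -> cL1 g -> L1_shift_cont f -> L1_shift_cont g ->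
  L1_shift_cont (fun x => f x + g x).
Proof.
move=> i j /L1_shift_contP F /L1_shift_contP G; apply/L1_shift_contP => e e0.
have e2 : 0 < e / 2 by rewrite divr_gt0.
apply: filterS2 (F _ e2) (G _ e2) => s fs gs.
rewrite (@eq_nL1 _ (fun x => (f (x + s) - f x) + (g (x + s) - g x))); last first.
  by move=> x; ring.
have := L1D (cintB (cL1_shift s i) i) (cintB (cL1_shift s j) j); lra.
Qed.

Lemma L1_shift_contZ c f : cL1 f -> L1_shift_cont f -> L1_shift_cont (fun x => c * f x).
Proof.
move=> i /L1_shift_contP F; apply/L1_shift_contP => e e0.
have n0 : 0 < nrm c + 1 by rewrite ltr_wpDl// normc_ge0.
apply: filterS (F (e / (nrm c + 1)) _); last by rewrite divr_gt0.
move=> s fs.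
rewrite (@eq_nL1 _ (fun x => c * (f (x + s) - f x))); last first.
  by move=> x; ring.
rewrite (L1Z c (cintB (cL1_shift s i) i)).
rewrite ltr_pdivlMr// in fs; apply: le_lt_trans fs.
by rewrite mulrC ler_wpM2l ?L1_ge0// lerDl.
Qed.

Lemma cutoff_continuous (g : R -> R) (N x : R) : continuous g -> ~ (x = - N \/ x = N) ->
  {for x, continuous (fun y => g y * \1_(`[- N, N]%classic : set R) y)}.
Proof.
move=> cg xN; have [xN1|xN1] := ltP N `|x|.
  have : \forall y \near x, N < `|y|.
    exact: (@cvgr_gt R R (nbhs x) _ _ _ (@norm_continuous _ R^o x) N xN1).
  move=> nx; apply: (@cvg_trans _ ((fun=> 0 : R) @ nbhs x)); last first.
    rewrite indicE memNset ?mulr0; first exact: cvg_cst.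
    by rewrite /= in_itv/= -ler_norml; apply/negP; rewrite -ltNge.
  apply: near_eq_cvg; apply: filterS nx => y yN.
  rewrite indicE memNset ?mulr0//=.
  by rewrite in_itv/= -ler_norml; apply/negP; rewrite -ltNge.
have {}xN1 : `|x| < N.
  rewrite lt_neqAle xN1 andbT; apply/eqP => xN2; apply: xN.
  by have [x0|x0] := leP 0 x; [right|left];
    rewrite -xN2; [rewrite ger0_norm|rewrite ltr0_norm// opprK].
have : \forall y \near x, `|y| < N.
  exact: (@cvgr_lt R R (nbhs x) _ _ _ (@norm_continuous _ R^o x) N xN1).
move=> nx; apply: (@cvg_trans _ (g @ nbhs x)); last first.
  rewrite indicE mem_set ?mulr1; first exact: cg.
  by rewrite /= in_itv/= -ler_norml ltW.
apply: near_eq_cvg; apply: filterS nx => y yN.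
by rewrite indicE mem_set ?mulr1//= in_itv/= -ler_norml ltW.
Qed.

(* Discontinuities only at the two endpoints, hence almost everywhere convergence. *)
Lemma L1_shift_cont_cutoff (g : R -> R) (N : R) : 0 < N -> continuous g ->
  cL1 (fun x => (g x * \1_(`[- N, N]%classic : set R) x)%:C%C) /\
  L1_shift_cont (fun x => (g x * \1_(`[- N, N]%classic : set R) x)%:C%C).
Proof.
move=> N0 cg; set h := fun x => _.
have [M [_ gM]] : [bounded g x | x in `[- N, N]%classic].
  have := @continuous_compact _ _ g _ (continuous_subspaceT cg) (@segment_compact R (- N) N).
  move/compact_bounded => [M [Mr gM]]; exists M; split => // y My x xN.
  by apply: gM => //; exists x.
pose K : R := `|M| + 1.
have hK x : nrm (h x) <= K * \1_(`[- N, N]%classic : set R) x.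
  rewrite /h nrm_real normrM indicE; case: (boolP (x \in _)) => /= [xN|_].
    rewrite normr1 !mulr1; apply: gM; first by rewrite /K ltr_pwDr// ler_norm.
    by move: xN; rewrite inE.
  by rewrite normr0 !mulr0.
have iK B : (@lebesgue_measure R).-integrable [set: R]
    (EFin \o (fun x => K * \1_(`[- B, B]%classic : set R) x)).
  have i1 : (@lebesgue_measure R).-integrable [set: mR R]
      (fun x => (\1_(`[- B, B]%classic : set R) x)%:E).
    exact: (integrable_indic_itv (- B) B true false).
  exact: (integrableZl measurableT K i1).
have mh : cmes h.
  apply: cmeas_real; apply: measurable_funM => //.
  exact: continuous_measurable_fun.
have ih : cL1 h by exact: cint_dom (iK N) hK.
split => //; rewrite /L1_shift_cont; apply/cvg_seqP => u u0.
(* The shifts are bounded by [|B| + 1], so that one enlarged interval contains the supports of all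
   translates and provides a single dominating function. *)
have [B [_ uB]] := cvg_seq_bounded (cvgP _ u0).
have {}uB n : `|u n| <= `|B| + 1 by apply: uB => //; rewrite ltr_pwDr// ler_norm.
apply: (@cdominated _ (mR R) R leb (fun n x => h (x + u n)) h
  (fun x => K * \1_(`[- (N + (`|B| + 1)), N + (`|B| + 1)]%classic : set R) x)).
- by move=> n; exact: cmes_shift.
- by [].
- have aN : \forall x \ae (@lebesgue_measure R), x \notin [set (- N); N].
    exists [set (- N); N]; split.
    + by apply: measurableU; exact: measurable_set1.
    + by apply: countable_lebesgue_measure0; apply/finite_set_countable.
    + by move=> x /= /negP; rewrite negbK inE.
  apply: (@filterS _ _ (ae_filter_ringOfSetsType (@lebesgue_measure R)) _ _ _ aN) => x.
  rewrite notin_setE => xN.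
  have xN' : ~ (x = - N \/ x = N) by [].
  have cc := cutoff_continuous cg xN'.
  have xu : x + u n @[n --> \oo] --> x.
    by rewrite -[X in _ --> X]addr0; apply: cvgD => //; exact: cvg_cst.
  have hxu := cvg_comp _ _ xu cc.
  rewrite (_ : (fun n => _) = fun n => `|g (x + u n) * \1_(`[- N, N]%classic : set R) (x + u n) -
      g x * \1_(`[- N, N]%classic : set R) x|); last first.
    by apply/funext => n; rewrite /h -rmorphB nrm_real.
  rewrite -(normr0 R); apply: cvg_norm.
  rewrite -(subrr (g x * \1_(`[- N, N]%classic : set R) x)).
  by apply: cvgB; [exact: hxu|exact: cvg_cst].
- exact: iK.
- move=> n x; apply: (le_trans (hK _)); rewrite ler_wpM2l ?addr_ge0//.
  rewrite !indicE; case: (boolP (_ \in `[- N, N]%classic)) => // /[!inE]/=.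
  rewrite in_itv/= => /andP[x1 x2].
  rewrite (_ : (x \in _) = true)//; apply/mem_set; rewrite /= in_itv/=.
  by move: (uB n); rewrite ler_norml => /andP[? ?]; apply/andP; split; lra.
- move=> x; apply: (le_trans (hK _)); rewrite ler_wpM2l ?addr_ge0//.
  rewrite !indicE; case: (boolP (_ \in `[- N, N]%classic)) => // /[!inE]/=.
  rewrite in_itv/= => /andP[x1 x2].
  rewrite (_ : (x \in _) = true)//; apply/mem_set; rewrite /= in_itv/=.
  by have := normr_ge0 B; move=> ?; apply/andP; split; lra.
Qed.

(** Two approximations at cost [e / 2] each: truncation to a bounded interval, then a continuous
    function on that interval, cut off at its ends. *)
Let L1_shift_cont_real (f : R -> R) :
  (@lebesgue_measure R).-integrable [set: mR R] (EFin \o f) ->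
  L1_shift_cont (fun x => (f x)%:C%C).
Proof.
move=> i.
have mf : measurable_fun [set: mR R] f by case/integrableP : i => /measurable_EFinP.
have ic : cL1 (fun x => (f x)%:C%C) by split => //; exact: integrable0.
apply: L1_shift_cont_approx => // e e0; have e2 : 0 < e / 2 by rewrite divr_gt0.
have inn : (@lebesgue_measure R).-integrable [set: mR R] (EFin \o (fun x => `|f x|)).
  exact: integrable_norm.
pose f_ (n : nat) x : R[i] := (f x * \1_(`[- n.+1%:R, n.+1%:R]%classic : set R) x)%:C%C.
have mf_ n : cmes (f_ n).
  by apply: cmeas_real; apply: measurable_funM.
have f_f n x : nrm (f_ n x) <= `|f x|.
  rewrite nrm_real normrM indicE.
  by case: (_ \in _); rewrite ?normr1 ?normr0 ?mulr1 ?mulr0.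
have if_ n : cL1 (f_ n) by exact: cint_dom (mf_ n) inn (f_f n).
have := @cdominated _ (mR R) R leb f_ (fun x => (f x)%:C%C) (fun x => `|f x|) mf_ (cint_meas ic) _ inn f_f _.
have cvf : \forall x \ae (@lebesgue_measure R), nrm (f_ n x - (f x)%:C%C) @[n --> \oo] --> (0 : R).
  apply: nearW => x; apply: (@cvg_trans _ ((fun=> 0 : R) @ \oo)); last exact: cvg_cst.
  apply: near_eq_cvg; exists (Num.truncn `|x|) => // n xn.
  rewrite /f_ indicE mem_set ?mulr1; first by rewrite subrr Normc.normc0.
  rewrite /= in_itv/= -ler_norml ltW//; apply: lt_le_trans (truncnS_gt _) _.
  by rewrite ler_nat ltnS.
move/(_ cvf) => {}cvf; have {cvf} := cvf (fun x => ltac:(by rewrite nrm_real)).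
move=> /cvgr0Pnorm_lt/(_ _ e2) [n _ /(_ n (leqnn n))].
rewrite ger0_norm ?L1_ge0// => fn.
have N0 : 0 < n.+1%:R :> R by [].
have [] := @approximation_continuous_integrable R `[- n.+1%:R, n.+1%:R]%classic f.
- by [].
- rewrite [ltLHS](@lebesgue_measure_itv R `[- n.+1%:R, n.+1%:R]).
  by rewrite /=; case: ifP => _; rewrite -?EFinB ltry.
- exact: integrableS i.
move=> g_ [cg_ ig_ /fine_cvgP[fin_g_ /cvgr0Pnorm_lt/(_ _ e2)]] g_e.
have [m _ /(_ m (leqnn m)) [gfin gm]] := filterI fin_g_ g_e.
pose h x : R[i] := (g_ m x * \1_(`[- n.+1%:R, n.+1%:R]%classic : set R) x)%:C%C.
have [ih sh] := L1_shift_cont_cutoff N0 (cg_ m).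
exists h; split => //.
rewrite (@eq_nL1 _ (fun x => (f_ n x - h x) + (-1) * (f_ n x - (f x)%:C%C))); last first.
  by move=> x; ring.
apply: le_lt_trans (L1D (cintB (if_ n) ih) (cintZ (-1) (cintB (if_ n) ic))) _.
rewrite (L1Z (-1) (cintB (if_ n) ic)) nrmN Normc.normc1 mul1r.
suff: nL1 (fun x => f_ n x - h x) < e / 2 by move: fn; lra.
apply: le_lt_trans gm; rewrite ger0_norm; last first.
  by apply: fine_ge0; apply: integral_ge0.
rewrite le_eqVlt; apply/orP; left; apply/eqP; congr fine.
rewrite [RHS]integral_mkcond; apply: eq_integral => x _.
rewrite patchE /f_ /h -rmorphB nrm_real indicE.
by case: ifPn => xA; rewrite ?mulr1 ?mulr0 ?subrr ?normr0.
Qed.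

Lemma L1_shift_contT f : cL1 f -> L1_shift_cont f.
Proof.
move=> [f1 f2].
have i1 : cL1 (fun x => (complex.Re (f x))%:C%C) by split => //; exact: integrable0.
have i2 : cL1 (fun x => (complex.Im (f x))%:C%C) by split => //; exact: integrable0.
have -> : f = fun x => (complex.Re (f x))%:C%C + Complex 0 1 * (complex.Im (f x))%:C%C.
  by apply/funext => x; exact: complexE.
apply: L1_shift_contD => //; first exact: cintZ.
  exact: L1_shift_cont_real.
by apply: L1_shift_contZ => //; exact: L1_shift_cont_real.
Qed.

End L1_translation.

(** * Calculus and convolution on the line *)

Section complex_calculus.
Context {R : realType}.
Implicit Types (f g F G : R -> R[i]).

Definition ccont f := continuous (fun x => complex.Re (f x)) /\
  continuous (fun x => complex.Im (f x)).

(** A relation naming the derivative, rather than an equation with [derive1]: derivability is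
    carried along, and the product and chain rules compute the derivative. *)
Definition cD F f := forall x,
  is_derive x (1 : R) (fun y => complex.Re (F y)) (complex.Re (f x)) /\
  is_derive x (1 : R) (fun y => complex.Im (F y)) (complex.Im (f x)).

Lemma ccont_meas f : ccont f -> cmes f.
Proof. by move=> [c1 c2]; split; exact: continuous_measurable_fun. Qed.

Lemma cD_cont F f : cD F f -> ccont F.
Proof.
move=> D; split => x.
  by apply/differentiable_continuous/derivable1_diffP; case: (D x).1.
by apply/differentiable_continuous/derivable1_diffP; case: (D x).2.
Qed.

Lemma cD_cderive1 F f : cD F f -> cderive1 F = f.
Proof.
move=> D; apply/funext => x; apply: complex_ext; rewrite /cderive1/= derive1E.
  by case: (D x).1.
by case: (D x).2.
Qed.

Lemma C1_cD F : C1 (fun x => complex.Re (F x)) -> C1 (fun x => complex.Im (F x)) ->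
  cD F (cderive1 F) /\ ccont (cderive1 F).
Proof.
move=> [d1 c1] [d2 c2]; split; last exact: conj c1 c2.
move=> x; split; rewrite /cderive1 [X in is_derive _ _ _ X]derive1E.
  exact: derivableP (d1 x).
exact: derivableP (d2 x).
Qed.

Lemma ccont_cst (c : R[i]) : ccont (fun=> c).
Proof. by split => x; exact: cvg_cst. Qed.

Lemma ccontD f g : ccont f -> ccont g -> ccont (fun x => f x + g x).
Proof.
move=> [f1 f2] [g1 g2]; split.
  by under eq_fun do rewrite ReD; move=> x; apply: cvgD; [exact: f1|exact: g1].
by under eq_fun do rewrite ImD; move=> x; apply: cvgD; [exact: f2|exact: g2].
Qed.

Lemma ccontM f g : ccont f -> ccont g -> ccont (fun x => f x * g x).
Proof.
move=> [f1 f2] [g1 g2]; split.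
  under eq_fun do rewrite ReM.
  by move=> x; apply: cvgB; apply: cvgM; [exact: f1|exact: g1|exact: f2|exact: g2].
under eq_fun do rewrite ImM.
by move=> x; apply: cvgD; apply: cvgM; [exact: f1|exact: g2|exact: f2|exact: g1].
Qed.

Lemma cD_cst (c : R[i]) : cD (fun=> c) (fun=> 0).
Proof. by move=> x; split; exact: is_derive_cst. Qed.

Lemma cDD F f G g : cD F f -> cD G g -> cD (fun x => F x + G x) (fun x => f x + g x).
Proof.
move=> DF DG x; have [F1 F2] := DF x; have [G1 G2] := DG x; split.
  by under eq_fun do rewrite ReD; rewrite ReD; exact: is_deriveD.
by under eq_fun do rewrite ImD; rewrite ImD; exact: is_deriveD.
Qed.

Lemma cDM F f G g : cD F f -> cD G g ->
  cD (fun x => F x * G x) (fun x => f x * G x + F x * g x).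
Proof.
move=> DF DG x; have [F1 F2] := DF x; have [G1 G2] := DG x; split.
  under eq_fun do rewrite ReM; rewrite ReD !ReM.
  apply: is_derive_eq; rewrite /GRing.scale/=; ring.
under eq_fun do rewrite ImM; rewrite ImD !ImM.
apply: is_derive_eq; rewrite /GRing.scale/=; ring.
Qed.

Lemma cDZ c F f : cD F f -> cD (fun x => c * F x) (fun x => c * f x).
Proof.
by move/(cDM (cD_cst c)); congr cD; apply/funext => x; rewrite mul0r add0r.
Qed.

Lemma cD_real (F f : R -> R) : (forall x, is_derive x (1 : R) F (f x)) ->
  cD (fun x => (F x)%:C%C) (fun x => (f x)%:C%C).
Proof. by move=> D x; split => //=; exact: is_derive_cst. Qed.

Lemma cD_comp F f (u u' : R -> R) : cD F f -> (forall x, is_derive x (1 : R) u (u' x)) ->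
  cD (fun x => F (u x)) (fun x => (u' x)%:C%C * f (u x)).
Proof.
move=> D Du x; have [D1 D2] := D (u x); rewrite ReZ ImZ; split.
  have /= := @is_derive1_comp R (fun y => complex.Re (F y)) u x _ _ D1 (Du x).
  by rewrite mulrC.
have /= := @is_derive1_comp R (fun y => complex.Im (F y)) u x _ _ D2 (Du x).
by rewrite mulrC.
Qed.

Lemma is_derive_addr (s x : R) : is_derive x (1 : R) (fun y : R => y + s) 1.
Proof. by rewrite -[X in is_derive _ _ _ X]addr0; exact: is_deriveD. Qed.

Lemma is_derive_addl (s x : R) : is_derive x (1 : R) (fun y : R => s + y) 1.
Proof. by rewrite -[X in is_derive _ _ _ X]add0r; exact: is_deriveD. Qed.

Lemma is_derive_subr (s x : R) : is_derive x (1 : R) (fun y : R => s - y) (-1).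
Proof. by rewrite -[X in is_derive _ _ _ X]add0r; exact: is_deriveB. Qed.

Lemma cD_shift F f (s : R) : cD F f -> cD (fun x => F (x + s)) (fun x => f (x + s)).
Proof.
move=> D; have := @cD_comp F f (fun x => x + s) (fun=> 1) D (is_derive_addr s).
by congr cD; apply/funext => x; rewrite mul1r.
Qed.

Lemma cD0_cst F : cD F (fun=> 0) -> forall x y, F x = F y.
Proof.
move=> D x y; apply: complex_ext.
  by apply: (@is_derive_0_is_cst R (fun y => complex.Re (F y))) => z; case: (D z).
by apply: (@is_derive_0_is_cst R (fun y => complex.Im (F y))) => z; case: (D z).
Qed.

Lemma cD_unique F f g : cD F f -> cD F g -> f = g.
Proof. by move=> /cD_cderive1 <- /cD_cderive1 <-. Qed.

Lemma ccont_comp f (u : R -> R) : ccont f -> continuous u -> ccont (fun x => f (u x)).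
Proof.
move=> [f1 f2] cu; split => x.
  by apply: (@continuous_comp _ _ _ u (fun y => complex.Re (f y))); [exact: cu|exact: f1].
by apply: (@continuous_comp _ _ _ u (fun y => complex.Im (f y))); [exact: cu|exact: f2].
Qed.

End complex_calculus.

Section fundamental_theorem.
Context {R : realType}.

Definition cind (h q : R) : R[i] := (\1_(`[0, h]%classic : set R) q)%:C%C.

Lemma cind_L1 h : cL1 (cind h).
Proof.
split; last exact: integrable0.
exact: (integrable_indic_itv 0 h true false).
Qed.

Let FTC_real (r r' : R -> R) (y h : R) : 0 < h ->
  (forall x, is_derive x (1 : R) r (r' x)) -> continuous r' ->
  (\int[leb]_q (\1_(`[0, h]%classic : set R) q * r' (y + q)) = r (y + h) - r y)%R.
Proof.
move=> h0 D c.
have Du x : is_derive x (1 : R) (fun q => r (y + q)) (r' (y + x)).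
  have /= := @is_derive1_comp R r (fun q => y + q) x _ _ (D (y + x)) (is_derive_addl y x).
  by rewrite mulr1.
have cu : continuous (fun q => r' (y + q)).
  move=> x; apply: (@continuous_comp _ _ _ (fun q => y + q) r'); last exact: c.
  by apply: cvgD; [exact: cvg_cst|exact: cvg_id].
have cru : continuous (fun q => r (y + q)).
  by move=> x; apply/differentiable_continuous/derivable1_diffP; case: (Du x).
have := @continuous_FTC2 R (fun q => r' (y + q)) (fun q => r (y + q)) 0 h h0.
rewrite addr0 -EFinB => E.
rewrite /Rintegral -[RHS]/(fine (r (y + h) - r y)%:E) -E.
- congr fine; rewrite [RHS]integral_mkcond; apply: eq_integral => q _.
  by rewrite patchE indicE; case: ifPn => _; rewrite ?mul1r ?mul0r.
- exact: continuous_subspaceT.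
- split.
  + by move=> x _; case: (Du x).
  + by apply: cvg_at_right_filter; exact: cru.
  + by apply: cvg_at_left_filter; exact: cru.
- by move=> x _; rewrite derive1E; case: (Du x).
Qed.

(** The integral over [[y, y + h]] is written over the whole line against an indicator, so that
    taking increments becomes a convolution with an L1 kernel. *)
Lemma cFTC (F f : R -> R[i]) (y h : R) : 0 < h -> cD F f -> ccont f ->
  cint (fun q => cind h q * f (y + q)) = F (y + h) - F y.
Proof.
move=> h0 D [c1 c2]; apply: complex_ext.
  rewrite ReD ReN -(@FTC_real (fun z => complex.Re (F z)) _ _ _ h0 _ c1); last by move=> x; case: (D x).
  by apply: eq_Rintegral => q _; rewrite ReZ.
rewrite ImD ImN -(@FTC_real (fun z => complex.Im (F z)) _ _ _ h0 _ c2); last by move=> x; case: (D x).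
by apply: eq_Rintegral => q _; rewrite ImZ.
Qed.

Let FTC1_real (r r' : R -> R) : continuous r' ->
  (forall y h, 0 < h ->
    (\int[leb]_q (\1_(`[0, h]%classic : set R) q * r' (y + q)) = r (y + h) - r y)%R) ->
  forall x, is_derive x (1 : R) r (r' x).
Proof.
move=> c E x.
(* compare with an antiderivative of r', which satisfies the same increments *)
pose G z := (\int[leb]_(t in `[x - 1, z]) r' t)%R.
have iG : (@lebesgue_measure R).-integrable `[x - 1, x + 1] (EFin \o r').
  apply: continuous_compact_integrable; first exact: segment_compact.
  exact: continuous_subspaceT.
have [dG G'] := @continuous_FTC1_closed R r' (x - 1) x (x + 1) ltac:(lra) iG ltac:(lra) (c x).
have rG : forall z, x - 1 < z -> r z = r (x - 1) + G z.
  move=> z xz; have h0 : 0 < z - (x - 1) by lra.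
  rewrite -[X in r X](subrKC (x - 1)) -[LHS](subrK (r (x - 1))) -(E _ _ h0).
  rewrite addrC; congr (_ + _).
  rewrite /G [RHS]Rintegral_mkcond.
  rewrite -[RHS](Rint_shift (x - 1)); last first.
    by apply/(measurable_restrictT r') => //; apply: measurable_funTS; exact: continuous_measurable_fun.
  apply: eq_Rintegral => q _; rewrite patchE indicE [q + _]addrC.
  rewrite (_ : (x - 1 + q \in _) = (q \in `[0, z - (x - 1)]%classic)); last first.
    by apply/idP/idP; rewrite !inE/= !in_itv/= => /andP[? ?]; apply/andP; split; lra.
  by case: ifPn => _; rewrite ?mul1r ?mul0r.
have DG : is_derive x (1 : R) G (r' x).
  by apply: DeriveDef; [exact: dG|rewrite -derive1E; exact: G'].
have DG2 : is_derive x (1 : R) (fun z => r (x - 1) + G z) (r' x).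
  by rewrite -[X in is_derive _ _ _ X]add0r; exact: is_deriveD.
apply: near_eq_is_derive DG2.
have : \forall z \near x, x - 1 < z by apply: lt_nbhsr; lra.
by apply: filterS => z /rG.
Qed.

(** Convolutions are differentiated through this converse: Fubini yields their increments, and no
    derivative is taken under an integral sign. *)
Lemma cFTC1 (F f : R -> R[i]) : ccont f ->
  (forall y h, 0 < h -> cint (fun q => cind h q * f (y + q)) = F (y + h) - F y) ->
  cD F f.
Proof.
move=> [c1 c2] E x; split.
  apply: (FTC1_real (r' := fun z => complex.Re (f z)) c1) => y h h0.
  have /(congr1 (@complex.Re R)) := E y h h0; rewrite ReD ReN => <-.
  by apply: eq_Rintegral => q _; rewrite ReZ.
apply: (FTC1_real (r' := fun z => complex.Im (f z)) c2) => y h h0.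
have /(congr1 (@complex.Im R)) := E y h h0; rewrite ImD ImN => <-.
by apply: eq_Rintegral => q _; rewrite ImZ.
Qed.

End fundamental_theorem.

Lemma aeS {R : realType} (P Q : mR R -> Prop) : (forall x, P x -> Q x) ->
  (\forall x \ae (@lebesgue_measure R), P x) -> \forall x \ae (@lebesgue_measure R), Q x.
Proof. exact: (@filterS _ _ (ae_filter_ringOfSetsType (@lebesgue_measure R))). Qed.

Lemma aeS2 {R : realType} (P Q S : mR R -> Prop) : (forall x, P x -> Q x -> S x) ->
  (\forall x \ae (@lebesgue_measure R), P x) ->
  (\forall x \ae (@lebesgue_measure R), Q x) ->
  \forall x \ae (@lebesgue_measure R), S x.
Proof. by move=> H; exact: (@filterS2 _ _ (ae_filter_ringOfSetsType _) _ _ _ H). Qed.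

Lemma aeS3 {R : realType} (P Q S V : mR R -> Prop) :
  (forall x, P x -> Q x -> S x -> V x) ->
  (\forall x \ae (@lebesgue_measure R), P x) ->
  (\forall x \ae (@lebesgue_measure R), Q x) ->
  (\forall x \ae (@lebesgue_measure R), S x) ->
  \forall x \ae (@lebesgue_measure R), V x.
Proof. by move=> H; exact: (@filterS3 _ _ (ae_filter_ringOfSetsType _) _ _ _ _ H). Qed.

Lemma ae_shift {R : realType} (P : R -> Prop) (s : R) :
  (\forall y \ae (@lebesgue_measure R), P y) ->
  \forall y \ae (@lebesgue_measure R), P (y + s).
Proof.
move=> [N [mN N0 PN]]; exists ((fun y => 1 * y + s) @^-1` N).
have mN' : measurable ((fun y => 1 * y + s : mR R) @^-1` N : set (mR R)).
  rewrite -[X in measurable X]setTI.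
  suff : measurable_fun [set: mR R] ((fun y => 1 * y + s) : mR R -> mR R) by apply.
  by apply: measurable_funD => //; apply: measurable_funM.
split => //; last by move=> y Py; apply: PN; rewrite /= mul1r.
move: N0; rewrite (lebesgue_affine s (oner_neq0 R) mN) normr1.
rewrite (weighted_lebesgueE _ (measurable_cst (1 : R)) (fun=> ler01)).
by rewrite [X in X = _ -> _](integral_cst leb mN' 1%E) mul1e.
Qed.

Section convolution.
Context {R : realType}.
Implicit Types (k l f g h : R -> R[i]).

Definition bdd f := cmes f /\ exists M, forall x, nrm (f x) <= M.

Definition conv k f : R -> R[i] := fun y => cint (fun r => k (y - r) * f r).

Lemma bddP f : bdd f -> exists2 M, 0 <= M & forall x, nrm (f x) <= M.
Proof.
move=> [_ [M fM]]; exists M => //; exact: le_trans (normc_ge0 _) (fM 0).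
Qed.

Lemma bddD f g : bdd f -> bdd g -> bdd (fun x => f x + g x).
Proof.
move=> [mf [M fM]] [mg [N gN]]; split; first exact: cmeasD.
by exists (M + N) => x; rewrite (le_trans (nrmD _ _))// lerD.
Qed.

Lemma bddM f g : bdd f -> bdd g -> bdd (fun x => f x * g x).
Proof.
move=> [mf [M fM]] [mg [N gN]]; split; first exact: cmeasM.
by exists (M * N) => x; rewrite Normc.normcM ler_pM ?normc_ge0.
Qed.

Lemma bdd_cst c : bdd (fun=> c).
Proof. by split; [exact: cmeas_cst|exists (nrm c)]. Qed.

Lemma bddZ c f : bdd f -> bdd (fun x => c * f x).
Proof. by move=> bf; apply: bddM => //; exact: bdd_cst. Qed.

Lemma bddB f g : bdd f -> bdd g -> bdd (fun x => f x - g x).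
Proof.
by move=> bf /(bddZ (-1)) /(bddD bf); congr bdd; apply/funext => x; rewrite mulN1r.
Qed.

Lemma bdd_shift s f : bdd f -> bdd (fun x => f (x + s)).
Proof. by move=> [mf [M fM]]; split; [exact: cmes_shift|exists M]. Qed.

Lemma bdd_refl s f : bdd f -> bdd (fun x => f (s - x)).
Proof. by move=> [mf [M fM]]; split; [exact: cmes_refl|exists M]. Qed.

Lemma cL1_bdd f h : bdd f -> cL1 h -> cL1 (fun x => f x * h x).
Proof. by move=> [mf [M fM]] ih; exact: cintMb ih mf fM. Qed.

Lemma cL1_bddr f h : bdd f -> cL1 h -> cL1 (fun x => h x * f x).
Proof. by move=> bf /(cL1_bdd bf); congr cintegrable; apply/funext => x; rewrite mulrC. Qed.

Lemma conv_int k f y : cL1 k -> bdd f -> cL1 (fun r => k (y - r) * f r).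
Proof. by move=> ik bf; apply: cL1_bddr => //; exact: cL1_refl. Qed.

Lemma convE k f y : cmes k -> cmes f -> conv k f y = cint (fun s => k s * f (y - s)).
Proof.
move=> mk mf; rewrite /conv -[LHS](cint_refl y).
  by apply: eq_cintegral => x; rewrite subKr.
by apply: cmeasM => //; exact: cmes_refl.
Qed.

Lemma conv_comm k l : cmes k -> cmes l -> conv k l = conv l k.
Proof.
move=> mk ml; apply/funext => y; rewrite convE//.
by apply: eq_cintegral => x; rewrite mulrC.
Qed.

Lemma conv_bound k f M y : cL1 k -> cmes f -> (forall x, nrm (f x) <= M) ->
  nrm (conv k f y) <= M * nL1 k.
Proof.
move=> ik mf fM; rewrite -(nL1_refl y ik).
have := nrm_cintegralMb (cL1_refl y ik) mf fM; congr (nrm _ <= _).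
by apply: eq_cintegral => x; rewrite mulrC.
Qed.

(** The increment is itself a convolution, with kernel [k (x + s) - k x]. Continuity of translations
    in L1 then makes the convolution of an L1 kernel with a merely bounded function uniformly
    continuous. *)
Lemma conv_incr k f M y s : cL1 k -> cmes f -> (forall x, nrm (f x) <= M) ->
  nrm (conv k f (y + s) - conv k f y) <= M * nL1 (fun x => k (x + s) - k x).
Proof.
move=> ik mf fM; have bf : bdd f by split => //; exists M.
have id := cintB (cL1_shift s ik) ik.
rewrite -(cintegralB (conv_int _ ik bf) (conv_int _ ik bf)).
have := conv_bound y id mf fM; congr (nrm _ <= _).
apply: eq_cintegral => x; rewrite mulrBl; congr (k _ * _ - _); ring.
Qed.

Lemma ccont_nrm f : (forall y, nrm (f (y + s) - f y) @[s --> (0 : R)] --> (0 : R)) -> ccont f.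
Proof.
move=> H.
have key (p : R[i] -> R) : (forall z w, p (z - w) = p z - p w) ->
    (forall z, `|p z| <= nrm z) -> continuous (fun x => p (f x)).
  move=> pB pn y; apply/cvgrPdist_lt => e e0.
  have /cvgr0Pnorm_lt/(_ _ e0) Hy := H y.
  apply: (@nbhs0P R R^o (fun t => `|p (f y) - p (f t)| < e) y).2.
  apply: filterS Hy => s; rewrite ger0_norm ?normc_ge0//.
  by apply: le_lt_trans; rewrite -pB nrmB; exact: pn.
split; apply: key => *; rewrite ?ReD ?ReN ?ImD ?ImN//; [exact: nrm_Re|exact: nrm_Im].
Qed.

Lemma conv_cont k f : cL1 k -> bdd f -> ccont (conv k f).
Proof.
move=> ik [mf [M fM]]; apply: ccont_nrm => y.
apply: (@squeeze_cvgr _ _ _ _ (fun=> 0) (fun s => M * nL1 (fun x => k (x + s) - k x))).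
- by apply: nearW => s; rewrite normc_ge0; exact: conv_incr.
- exact: cvg_cst.
- by rewrite -[X in _ --> X](mulr0 M); apply: cvgMr; exact: L1_shift_contT.
Qed.

Lemma conv_bdd k f : cL1 k -> bdd f -> bdd (conv k f).
Proof.
move=> ik bf; split; first exact/ccont_meas/conv_cont.
by have [mf [M fM]] := bf; exists (M * nL1 k) => y; exact: conv_bound.
Qed.

Definition avg s f : R -> R[i] := fun y => cint (fun q => cind s q * f (y + q)).

Lemma convDl k l f y : cL1 k -> cL1 l -> bdd f ->
  conv (fun x => k x + l x) f y = conv k f y + conv l f y.
Proof.
move=> ik il bf; rewrite /conv -cintegralD; [|exact: conv_int|exact: conv_int].
by apply: eq_cintegral => x; rewrite mulrDl.
Qed.

Lemma convZl c k f y : cL1 k -> bdd f -> conv (fun x => c * k x) f y = c * conv k f y.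
Proof.
move=> ik bf; rewrite /conv -cintegralZ; last exact: conv_int.
by apply: eq_cintegral => x; rewrite mulrA.
Qed.

Lemma convDr k f g y : cL1 k -> bdd f -> bdd g ->
  conv k (fun x => f x + g x) y = conv k f y + conv k g y.
Proof.
move=> ik bf bg; rewrite /conv -cintegralD; [|exact: conv_int|exact: conv_int].
by apply: eq_cintegral => x; rewrite mulrDr.
Qed.

Lemma convZr c k f y : cL1 k -> bdd f -> conv k (fun x => c * f x) y = c * conv k f y.
Proof.
move=> ik bf; rewrite /conv -cintegralZ; last exact: conv_int.
by apply: eq_cintegral => x; rewrite mulrCA.
Qed.

Lemma conv_ae k f g : cmes k -> cmes f -> cmes g ->
  (\forall x \ae (@lebesgue_measure R), f x = g x) -> conv k f = conv k g.
Proof.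
move=> mk mf mg fg; apply/funext => y; apply: ae_eq_cintegral.
- by apply: cmeasM => //; exact: cmes_refl.
- by apply: cmeasM => //; exact: cmes_refl.
- by apply: aeS fg => x ->.
Qed.

(* The kernel p(s) q(s - r) f(r) covers the adjoint of a convolution operator,
   the composition of two of them and the commutation with averages. *)
Section core.
Variables p q f : R -> R[i].
Hypotheses (ip : cL1 p) (iq : cL1 q) (bf : bdd f).

Let F s r := p s * (q (s - r) * f r).

Let mF : cmeasurable (fun x : mR R * mR R => F x.1 x.2).
Proof.
apply: cmeasM.
  exact: (@cmeas_comp _ (mR R) R _ _ (fst : mR R * mR R -> mR R) p measurable_fst (cint_meas ip)).
apply: cmeasM.
  apply: (@cmeas_comp _ (mR R) R _ _ (fun x : mR R * mR R => (x.1 - x.2 : mR R)) q _ (cint_meas iq)).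
  by apply: measurable_funB; [exact: measurable_fst|exact: measurable_snd].
exact: (@cmeas_comp _ (mR R) R _ _ (snd : mR R * mR R -> mR R) f measurable_snd bf.1).
Qed.

Let iF s : cL1 (F s).
Proof. by apply: cintZ; apply: conv_int. Qed.

Let FG : exists2 G : R -> R, (@lebesgue_measure R).-integrable [set: R] (EFin \o G) &
  forall s, nL1 (F s) <= G s.
Proof.
have [M M0 fM] := bddP bf; have [mf _] := bf.
exists (fun s => (M * nL1 q) * nrm (p s)).
  by apply: (integrableZl measurableT (M * nL1 q) (cint_nrm ip)).
move=> s; rewrite L1Z; last exact: conv_int.
rewrite mulrC ler_wpM2r ?normc_ge0// -(nL1_refl s iq).
have := L1Mb (cL1_refl s iq) mf fM; congr (_ <= _).
by apply: eq_nL1 => x; rewrite mulrC.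
Qed.

Lemma fubini_core_int : cL1 (fun r => cint (fun s => p s * (q (s - r) * f r))).
Proof. by have [G iG G1] := FG; exact: (cfubini_int2 mF iF iG G1). Qed.

Lemma fubini_core : cint (fun s => p s * conv q f s) =
  cint (fun r => cint (fun s => p s * (q (s - r) * f r))).
Proof.
have [G iG G1] := FG; rewrite -(cFubini mF iF iG G1).
by apply: eq_cintegral => s; rewrite /F cintegralZ//; exact: conv_int.
Qed.

Lemma fubini_core_ae : \forall r \ae (@lebesgue_measure R), cL1 (fun s => p s * (q (s - r) * f r)).
Proof. by have [G iG G1] := FG; exact: (cfubini_ae mF iF iG G1). Qed.

End core.

(** The preadjoint of convolution with [k], that is, convolution of [h] with the reflected
    kernel. *)
Definition adj k h : R -> R[i] := fun r => cint (fun s => h s * k (s - r)).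

Lemma adj_L1 k h : cL1 k -> cL1 h -> cL1 (adj k h).
Proof.
move=> ik ih; have := fubini_core_int ih ik (bdd_cst 1); congr cintegrable.
by apply/funext => r; apply: eq_cintegral => s; rewrite mulr1.
Qed.

Lemma fubini_core' p q f : cL1 p -> cL1 q -> bdd f ->
  cint (fun s => p s * conv q f s) = cint (fun r => adj q p r * f r).
Proof.
move=> ip iq bf; rewrite (fubini_core ip iq bf).
apply: ae_eq_cintegral.
- exact: cint_meas (fubini_core_int ip iq bf).
- by apply: cmeasM; [exact: cint_meas (adj_L1 iq ip)|exact: bf.1].
(* The factor [f r] leaves the inner integral only where the section is integrable. Applying Fubini
   with the constant 1 gives this for almost every [r], also where [f r] is 0. *)
apply: aeS (fubini_core_ae ip iq (bdd_cst 1)) => r ir.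
rewrite /adj mulrC -cintegralZ; last first.
  by move: ir; congr cintegrable; apply/funext => s; rewrite mulr1.
by apply: eq_cintegral => s; ring.
Qed.

Lemma conv_adj k f h : cL1 k -> bdd f -> cL1 h ->
  cint (fun y => conv k f y * h y) = cint (fun y => f y * adj k h y).
Proof.
move=> ik bf ih; have := fubini_core' ih ik bf.
under eq_cintegral do rewrite mulrC.
by move=> ->; apply: eq_cintegral => r; rewrite mulrC.
Qed.

Lemma conv_L1 k l : cL1 k -> cL1 l -> cL1 (conv k l).
Proof.
move=> ik il; have := adj_L1 (cL1_refl 0 ik) il; congr cintegrable.
apply/funext => y; apply: eq_cintegral => s.
by rewrite mulrC sub0r opprB.
Qed.

(** At a point [y] the left side pairs [conv l f] with the reflected translate of [k]. The
    preadjoint moves [l] onto that kernel, and a translation by [r] recognizes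
    [conv k l (y - r)]. *)
Lemma conv_assoc k l f : cL1 k -> cL1 l -> bdd f ->
  conv k (conv l f) = conv (conv k l) f.
Proof.
move=> ik il bf; apply/funext => y.
rewrite [LHS](fubini_core' (cL1_refl y ik) il bf); apply: eq_cintegral => r.
congr (_ * _); rewrite /adj /conv.
rewrite -(cint_shift r); last first.
  apply: cmeasM; first exact/cmes_refl/(cint_meas ik).
  exact/(cmes_shift (- r))/(cint_meas il).
apply: eq_cintegral => s; congr (k _ * l _); last by rewrite addrK.
by rewrite opprD addrA addrAC.
Qed.

Lemma convC k l f : cL1 k -> cL1 l -> bdd f -> conv k (conv l f) = conv l (conv k f).
Proof.
move=> ik il bf; rewrite (conv_assoc ik il bf) (conv_assoc il ik bf).
by rewrite (conv_comm (cint_meas ik) (cint_meas il)).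
Qed.

(** Convolving a constant multiplies it by the integral of the kernel, so this is associativity
    applied to the constant 1. *)
Lemma conv_cint k l : cL1 k -> cL1 l -> cint (conv k l) = cint k * cint l.
Proof.
move=> ik il.
have := conv_assoc ik il (bdd_cst 1) => /(congr1 (fun f => f 0)).
have cst1 m c : cL1 m -> conv m (fun=> c) = fun=> c * cint m.
  move=> im; apply/funext => y; rewrite (convE y (cint_meas im) (cmeas_cst c)).
  by rewrite -cintegralZ//; apply: eq_cintegral => x; rewrite mulrC.
by rewrite (cst1 l 1 il) (cst1 k _ ik) (cst1 _ 1 (conv_L1 ik il)) !mul1r mulrC => <-.
Qed.

(** Reflecting the indicator turns the average over [[y, y + s]] into a convolution, which thereby
    commutes with all other convolutions. *)
Definition kavg s x : R[i] := cind s (- x).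

Lemma kavg_L1 s : cL1 (kavg s).
Proof.
have := cL1_refl 0 (cind_L1 s); congr cintegrable.
by apply/funext => x; rewrite /kavg sub0r.
Qed.

Lemma avgE s f : bdd f -> avg s f = conv (kavg s) f.
Proof.
move=> [mf _]; apply/funext => z; rewrite (convE z (cint_meas (kavg_L1 s)) mf) /avg.
rewrite -[RHS](cint_refl 0); last first.
  by apply: cmeasM; [exact: cint_meas (kavg_L1 s)|exact: cmes_refl].
by apply: eq_cintegral => q; rewrite /kavg !sub0r !opprK.
Qed.

Lemma conv_avg k f s : cL1 k -> bdd f -> conv k (avg s f) = avg s (conv k f).
Proof.
by move=> ik bf; rewrite (avgE s bf) (avgE s (conv_bdd ik bf)) (convC ik (kavg_L1 s) bf).
Qed.

Lemma avg_bdd s f : bdd f -> bdd (avg s f).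
Proof. by move=> bf; rewrite (avgE s bf); exact: conv_bdd (kavg_L1 s) bf. Qed.

(** The increment of the kernel is an integral of [k'] over an interval of length [s]; Fubini
    exchanges it with the integral against [f]. *)
Lemma conv_FTC k k' f y s : cL1 k -> cL1 k' -> cD k k' -> ccont k' -> bdd f -> 0 < s ->
  conv k f (y + s) - conv k f y = avg s (conv k' f) y.
Proof.
move=> ik ik' D c bf s0.
rewrite -(cintegralB (conv_int _ ik bf) (conv_int _ ik bf)).
have := fubini_core' (cind_L1 s) (cL1_shift y ik') bf.
rewrite /avg => E; transitivity (cint (fun t => cind s t * conv (fun x => k' (x + y)) f t)); last first.
  apply: eq_cintegral => q; congr (_ * _); apply: eq_cintegral => r.
  by congr (k' _ * _); rewrite addrAC [q + y]addrC.
rewrite E; apply: eq_cintegral => r; rewrite -mulrBl; congr (_ * _).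
have -> : y + s - r = (y - r) + s by rewrite addrAC.
rewrite -(cFTC (y - r) s0 D c); apply: eq_cintegral => q.
by congr (_ * k' _); rewrite addrC addrA addrAC.
Qed.

Lemma conv_cD k k' f : cL1 k -> cL1 k' -> cD k k' -> ccont k' -> bdd f ->
  cD (conv k f) (conv k' f).
Proof.
move=> ik ik' D c bf; apply: cFTC1; first exact: conv_cont.
by move=> y s s0; rewrite (conv_FTC y ik ik' D c bf s0).
Qed.

End convolution.

Section approximate_identity.
Context {R : realType}.
Implicit Types (k f h : R -> R[i]) (e : R).

Definition scale e k : R -> R[i] := fun x => (e^-1)%:C%C * k (e^-1 * x).

Lemma scale_L1 e k : 0 < e -> cL1 k -> cL1 (scale e k).
Proof.
move=> e0 ik; apply: cintZ.
have e1 : e^-1 != 0 by rewrite invr_eq0 gt_eqF.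
by have := cL1_affine 0 e1 ik; under eq_fun do rewrite addr0.
Qed.

Lemma nL1_scale e k : 0 < e -> cL1 k -> nL1 (scale e k) = nL1 k.
Proof.
move=> e0 ik; have e1 : e^-1 != 0 by rewrite invr_eq0 gt_eqF.
have i2 : cL1 (fun x => k (e^-1 * x)).
  by have := cL1_affine 0 e1 ik; under eq_fun do rewrite addr0.
rewrite L1Z// nrm_real (@eq_nL1 _ _ (fun x => k (e^-1 * x + 0))); last by move=> x; rewrite addr0.
by rewrite nL1_affine// mulrA mulfV ?mul1r// normr_eq0.
Qed.

Lemma cint_scale_mul e k f : 0 < e -> cL1 k -> bdd f ->
  cint (fun x => scale e k x * f x) = cint (fun x => k x * f (e * x)).
Proof.
move=> e0 ik bf; have e1 : e != 0 by rewrite gt_eqF.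
have i2 := cL1_bddr bf (scale_L1 e0 ik).
have := cint_affine 0 e1 i2; under eq_cintegral do rewrite addr0.
move/(congr1 (fun z => e%:C%C * z)); rewrite mulrA -rmorphM/= gtr0_norm// mulfV// mul1r => <-.
rewrite -cintegralZ; last first.
  by have := cL1_affine 0 e1 i2; under eq_fun do rewrite addr0.
apply: eq_cintegral => x; rewrite /scale !mulrA -rmorphM/= mulfV// mul1r.
by rewrite mulVf// mul1r.
Qed.

(* Pairing with h is a convolution evaluated at 0, so the commutation of
   convolutions moves the approximate identity onto the continuous function
   conv h (f \o -%R). *)
Lemma pairing_conv f h : cmes f -> cmes h ->
  cint (fun y => f y * h y) = conv h (fun x => f (- x)) 0.
Proof.
move=> mf mh; rewrite /conv -[LHS](cint_refl 0); last exact: cmeasM.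
by apply: eq_cintegral => x; rewrite mulrC sub0r.
Qed.

Lemma bdd_opp f : bdd f -> bdd (fun x => f (- x)).
Proof. by move/(bdd_refl 0); under eq_fun do rewrite sub0r. Qed.

Lemma cL1_opp f : cL1 f -> cL1 (fun x => f (- x)).
Proof. by move/(cL1_refl 0); under eq_fun do rewrite sub0r. Qed.

Lemma conv_opp k f : cL1 k -> bdd f ->
  (fun x => conv k f (- x)) = conv (fun x => k (- x)) (fun x => f (- x)).
Proof.
move=> ik bf; apply/funext => x; rewrite /conv -[LHS](cint_refl 0); last first.
  by apply: cmeasM; [exact/cmes_refl/(cint_meas ik)|exact: bf.1].
by apply: eq_cintegral => r; rewrite !sub0r opprK opprB [- x + _]addrC.
Qed.

Lemma pairing_conv_scale e k f h : 0 < e -> cL1 k -> bdd f -> cL1 h ->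
  cint (fun y => conv (scale e k) f y * h y) =
  cint (fun x => k x * conv h (fun x => f (- x)) (e * x)).
Proof.
move=> e0 ik bf ih; have isk := scale_L1 e0 ik.
have bo := conv_bdd ih (bdd_opp bf).
rewrite (pairing_conv (conv_bdd isk bf).1 (cint_meas ih)) (conv_opp isk bf).
rewrite (convC ih (cL1_opp isk) (bdd_opp bf)).
rewrite -(cint_scale_mul e0 ik bo); apply: eq_cintegral => x.
by rewrite sub0r opprK.
Qed.

Lemma conv_approx k f h (e : nat -> R) : cL1 k -> cint k = 1 -> bdd f -> cL1 h ->
  (forall n, 0 < e n) -> e n @[n --> \oo] --> (0 : R) ->
  nrm (cint (fun y => conv (scale (e n) k) f y * h y) - cint (fun y => f y * h y))
    @[n --> \oo] --> (0 : R).
Proof.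
move=> ik k1 bf ih e0 ce.
set w := conv h (fun x => f (- x)).
have bw : bdd w by exact: conv_bdd ih (bdd_opp bf).
have [M M0 wM] := bddP bw.
(* As [k] has integral 1, the limit is the same integral with [w] frozen at 0, and it remains to let
   [w (e n * x)] tend to [w 0] under the bound [M * nrm (k x)]. *)
have fw : cint (fun y => f y * h y) = cint (fun x => k x * w 0).
  rewrite (pairing_conv bf.1 (cint_meas ih)) -/w.
  rewrite -[LHS]mulr1 -k1 -cintegralZ//; apply: eq_cintegral => x.
  by rewrite mulrC.
rewrite fw; under eq_fun do rewrite (pairing_conv_scale (e0 _) ik bf ih) -/w.
have ce' (x : R) : e n * x @[n --> \oo] --> (0 : R).
  by rewrite -(mul0r x); apply: cvgM => //; exact: cvg_cst.
have [mf [N fN]] := bdd_opp bf.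
apply: (@cdominated_cintegral _ (mR R) R leb (fun n x => k x * w (e n * x))
  (fun x => k x * w 0) (fun x => M * nrm (k x))).
- move=> n; apply: cmeasM; first exact: cint_meas ik.
  by have := cmes_affine (e n) 0 bw.1; under eq_fun do rewrite addr0.
- by apply: cmeasM; [exact: cint_meas ik|exact: cmeas_cst].
- apply: aeW => x.
  apply: (@squeeze_cvgr _ _ _ _ (fun=> 0) (fun n => nrm (k x) *
      (N * nL1 (fun y => h (y + e n * x) - h y)))).
  + apply: nearW => n; rewrite normc_ge0/= -mulrBr Normc.normcM ler_wpM2l ?normc_ge0//.
    by have := conv_incr 0 (e n * x) ih mf fN; rewrite add0r.
  + exact: cvg_cst.
  + rewrite -[X in _ --> X](mulr0 (nrm (k x))); apply: cvgMr.
    rewrite -[X in _ --> X](mulr0 N); apply: cvgMr.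
    exact: (cvg_comp _ _ (ce' x) (L1_shift_contT ih)).
- by apply: (integrableZl measurableT M (cint_nrm ik)).
- by move=> n x; rewrite Normc.normcM mulrC ler_wpM2r ?normc_ge0.
- by move=> x; rewrite Normc.normcM mulrC ler_wpM2r ?normc_ge0.
Qed.

End approximate_identity.

Section smooth_functions.
Context {R : realType}.
Implicit Types (F f g : R -> R[i]).

(** The derivatives are existential witnesses, unique by [cD_unique]; stability under sums, products
    and composition becomes an induction on [n]. *)
Fixpoint diffn n F : Prop :=
  if n is m.+1 then exists2 f, cD F f & diffn m f else True.

Definition csmooth F := forall n, diffn n F.

Definition csupp (N : R) F := forall x, N < `|x| -> F x = 0.

Lemma diffnS n F : diffn n.+1 F -> diffn n F.
Proof.
elim: n F => [//|n IH] F [f Df /IH Hf]; by exists f.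
Qed.

Lemma csmooth_deriv F : csmooth F -> exists2 f, cD F f & csmooth f.
Proof.
move=> sF; have [f Df _] := sF 1; exists f => // n.
by have [g /(cD_unique Df) <-] := sF n.+1.
Qed.

Lemma csmooth_cD F f : csmooth F -> cD F f -> csmooth f.
Proof. by move=> /csmooth_deriv[g Dg sg] /cD_unique/(_ Dg) ->. Qed.

Lemma csmooth_ccont F : csmooth F -> ccont F.
Proof. by move=> /csmooth_deriv[f /cD_cont]. Qed.

Lemma diffnD n F g : diffn n F -> diffn n g -> diffn n (fun x => F x + g x).
Proof.
elim: n F g => [//|n IH] F g [f Df df] [g' Dg dg].
by exists (fun x => f x + g' x); [exact: cDD|exact: IH].
Qed.

Lemma diffnM n F g : diffn n F -> diffn n g -> diffn n (fun x => F x * g x).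
Proof.
elim: n F g => [//|n IH] F g dF dg'.
have [[f Df df] [g' Dg dg]] := (dF, dg').
exists (fun x => f x * g x + F x * g' x); first exact: cDM.
by apply: diffnD; apply: IH => //; exact: diffnS.
Qed.

Lemma diffn_cst n (c : R[i]) : diffn n (fun=> c).
Proof. by elim: n c => [//|n IH] c; exists (fun=> 0); [exact: cD_cst|exact: IH]. Qed.

Lemma csmoothM F g : csmooth F -> csmooth g -> csmooth (fun x => F x * g x).
Proof. by move=> sF sg n; exact: diffnM. Qed.

Lemma csmooth_cst c : csmooth (fun=> c). Proof. by move=> n; exact: diffn_cst. Qed.

Lemma csmooth_comp F (u : R -> R) (u' : R -> R) :
  (forall x, is_derive x (1 : R) u (u' x)) -> csmooth (fun x => (u' x)%:C%C) ->
  csmooth F -> csmooth (fun x => F (u x)).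
Proof.
move=> Du su sF n; elim: n F sF => [//|n IH] F sF.
have [f Df sf] := csmooth_deriv sF.
exists (fun x => (u' x)%:C%C * f (u x)); first exact: cD_comp.
by apply: diffnM => //; exact: IH.
Qed.

Lemma csmooth_affine F (c s : R) : csmooth F -> csmooth (fun x => F (c * x + s)).
Proof.
apply: (@csmooth_comp F (fun x => c * x + s) (fun=> c)) => [x|]; last exact: csmooth_cst.
apply: is_derive_eq; rewrite /GRing.scale/=; ring.
Qed.

Lemma csmooth_smooth F : csmooth F ->
  smooth (fun x => complex.Re (F x)) /\ smooth (fun x => complex.Im (F x)).
Proof.
move=> sF; split => n; elim: n F sF => [|n IH] F sF x.
- by have [f Df _] := csmooth_deriv sF; case: (Df x).1.
- have [f Df sf] := csmooth_deriv sF.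
  rewrite /derive1n iterSr (_ : derive1 _ = fun x => complex.Re (f x)); first exact: IH.
  by apply/funext => y; rewrite derive1E; case: (Df y).1.
- by have [f Df _] := csmooth_deriv sF; case: (Df x).2.
- have [f Df sf] := csmooth_deriv sF.
  rewrite /derive1n iterSr (_ : derive1 _ = fun x => complex.Im (f x)); first exact: IH.
  by apply/funext => y; rewrite derive1E; case: (Df y).2.
Qed.

Lemma smooth_csmooth (r : R -> R) : smooth r -> csmooth (fun x => (r x)%:C%C).
Proof.
move=> sr n; elim: n r sr => [//|n IH] r sr.
exists (fun x => (derive1 r x)%:C%C).
  by apply: cD_real => x; rewrite derive1E; exact: derivableP (sr 0 x).
by apply: IH => m x; have := sr m.+1 x; rewrite /derive1n iterSr.
Qed.

Lemma smooth_continuous (r : R -> R) : smooth r -> continuous r.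
Proof. by move=> sr x; apply/differentiable_continuous/derivable1_diffP; exact: (sr 0 x). Qed.

(** The derivative is the product of [- r'] with two factors 1/r, which are already [n] times
    differentiable by the induction hypothesis. *)
Lemma csmooth_inv (r : R -> R) : (forall x, 0 < r x) -> csmooth (fun x => (r x)%:C%C) ->
  csmooth (fun x => (r x)^-1%:C%C).
Proof.
move=> r0 sr n; elim: n => [//|n IH].
have [f Df sf] := csmooth_deriv sr.
have fE x : f x = (complex.Re (f x))%:C%C.
  apply: complex_ext => //=; have := (Df x).2 => /= D0.
  by case: D0 => _ <-; rewrite derive_cst.
exists (fun x => -1 * (f x * ((r x)^-1%:C%C * (r x)^-1%:C%C))).
  have D x : is_derive x (1 : R) (fun y => (r y)^-1)
      (- (complex.Re (f x) * ((r x)^-1 * (r x)^-1))).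
    have rx : r x != 0 by rewrite gt_eqF.
    have /= := @is_deriveV R r x _ 1 rx (Df x).1.
    move/is_derive_eq; apply; rewrite /GRing.scale/=; field.
    by [].
  have := cD_real D; congr cD; apply/funext => x.
  by rewrite [X in _ = -1 * (X * _)]fE mulN1r rmorphN !rmorphM.
apply: diffnM; first exact: diffn_cst.
by apply: diffnM; [exact: sf|exact: diffnM].
Qed.

Lemma csupp_deriv N F f : cD F f -> csupp N F -> csupp N f.
Proof.
move=> D sF x Nx.
have : \forall y \near x, N < `|y|.
  exact: (@cvgr_gt R R (nbhs x) _ _ _ (@norm_continuous _ R^o x) N Nx).
move=> near_x; have [D1 D2] := D x; apply: complex_ext.
  have D0 : is_derive x (1 : R) (fun y => complex.Re (F y)) 0.
    apply: near_eq_is_derive (is_derive_cst (0 : R) x (1 : R)).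
    by apply: filterS near_x => y /sF ->.
  by case: D1 => _ <-; case: D0 => _ ->.
have D0 : is_derive x (1 : R) (fun y => complex.Im (F y)) 0.
  apply: near_eq_is_derive (is_derive_cst (0 : R) x (1 : R)).
  by apply: filterS near_x => y /sF ->.
by case: D2 => _ <-; case: D0 => _ ->.
Qed.

Lemma ccont_csupp_bdd N F : ccont F -> csupp N F -> bdd F.
Proof.
move=> cF sF; split; first exact: ccont_meas.
have bnd (r : R -> R) : continuous r -> (forall x, N < `|x| -> r x = 0) ->
    exists M, forall x, `|r x| <= M.
  move=> cr sr.
  have := @continuous_compact _ _ r _ (continuous_subspaceT cr) (@segment_compact R (- N) N).
  move/compact_bounded => [M [Mr rM]]; exists (`|M| + 1) => x.
  have [/sr ->|xN] := ltP N `|x|; first by rewrite normr0 addr_ge0.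
  by apply: rM; [rewrite ltr_pwDr// ler_norm|exists x => //; rewrite /= in_itv/= -ler_norml].
have [|M1 H1] := bnd _ cF.1; first by move=> x /sF ->.
have [|M2 H2] := bnd _ cF.2; first by move=> x /sF ->.
by exists (M1 + M2) => x; rewrite (le_trans (nrm_le_ReIm _))// lerD.
Qed.

Lemma ccont_csupp_L1 N F : ccont F -> csupp N F -> cL1 F.
Proof.
move=> cF sF; have bF := ccont_csupp_bdd cF sF.
have iN : cL1 (fun x => (\1_(`[- N, N]%classic : set R) x)%:C%C).
  split; last exact: integrable0.
  exact: (integrable_indic_itv (- N) N true false).
have := cL1_bdd bF iN; congr cintegrable; apply/funext => x.
rewrite indicE; case: (boolP (x \in _)) => xN; rewrite ?mulr1// mulr0.
apply/esym/sF; rewrite ltNge; apply: contra xN => xN.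
by rewrite inE/= in_itv/= -ler_norml.
Qed.

Lemma conv_csmooth N k f : csmooth k -> csupp N k -> bdd f -> csmooth (conv k f).
Proof.
move=> sk kN bf n; elim: n k sk kN => [//|n IH] k sk kN.
have [k' Dk sk'] := csmooth_deriv sk; have kN' := csupp_deriv Dk kN.
exists (conv k' f); last exact: IH.
have [ck ck'] := (csmooth_ccont sk, csmooth_ccont sk').
by apply: conv_cD => //; [exact: ccont_csupp_L1 ck kN|exact: ccont_csupp_L1 ck' kN'].
Qed.

End smooth_functions.

Section bump.
Context {R : realType}.

(** The powers of 1/x make the family closed under differentiation up to linear combinations, so
    that smoothness of e^(-1/x) is proved for all members at once. *)
Definition flat (n : nat) (x : R) : R :=
  if 0 < x then (x^-1) ^+ n * expR (- x^-1) else 0.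

(** From e^t >= t^(n+2) / (n+2)! at t = 1/x. A quadratic bound is what makes the derivative at 0
    vanish. *)
Let flat_le n x : `|flat n x| <= (n.+2)`!%:R * x ^+ 2.
Proof.
rewrite /flat; case: ifPn => x0; last by rewrite normr0 mulr_ge0// sqr_ge0.
rewrite ger0_norm ?mulr_ge0 ?exprn_ge0 ?invr_ge0 ?expR_ge0 ?(ltW x0)//.
have xi : 0 <= x^-1 by rewrite invr_ge0 ltW.
have := expR_ge1Dxn n.+1 xi.
rewrite expRN ler_pdivrMr ?expR_gt0// => h.
have : (x^-1) ^+ n.+2 / (n.+2)`!%:R <= expR x^-1 by apply: le_trans h; rewrite lerDr.
rewrite ler_pdivrMr ?ltr0n ?fact_gt0// => {}h.
have := ler_wpM2r (sqr_ge0 x) h; rewrite -addn2 exprD -mulrA -exprMn mulVf ?gt_eqF// expr1n mulr1.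
by rewrite -mulrA mulrC => {}h; apply: le_trans h _; rewrite addn2 mulrAC.
Qed.

Lemma flat_derive n x :
  is_derive x (1 : R) (flat n) (flat n.+2 x - n%:R * flat n.+1 x).
Proof.
have [x0|x0|x0] := ltgtP (x : R) 0; last rewrite x0.
- have -> : flat n.+2 x - n%:R * flat n.+1 x = 0.
    by rewrite /flat ltNge (ltW x0)/= mulr0 subr0.
  apply: near_eq_is_derive (is_derive_cst (0 : R) x (1 : R)).
  by apply: filterS (lt_nbhsl x0) => y y0; rewrite /flat ltNge (ltW y0).
- have D : is_derive x (1 : R) (fun y => (y^-1) ^+ n * expR (- y^-1))
      (flat n.+2 x - n%:R * flat n.+1 x).
    have xn0 : x != 0 by rewrite gt_eqF.
    have Di := @is_deriveV R id x 1 1 xn0 (is_derive_id x 1).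
    have DE := @is_derive1_comp R expR (fun y => - y^-1) x _ _ (is_derive_expR _) (is_deriveN Di).
    have DX := is_deriveX n Di; rewrite exprfctE in DX.
    apply: (is_derive_eq (is_deriveM DX DE)).
    rewrite /flat x0 /GRing.scale/=.
    case: n {DX} => [|n]; first by rewrite !expr0 !mul0r mulr0; field.
    by rewrite -addn1 natrD !addn1 !exprS /=; field.
  apply: near_eq_is_derive D.
  by apply: filterS (lt_nbhsr x0) => y y0; rewrite /flat y0.
- have -> : flat n.+2 0 - n%:R * flat n.+1 0 = 0 by rewrite /flat ltxx mulr0 subr0.
  have H : h^-1 *: (flat n (h + 0) - flat n 0) @[h --> 0^'] --> (0 : R).
    have -> : flat n 0 = 0 by rewrite /flat ltxx.
    apply: (@norm_cvg0 _ R^o).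
    apply: (@squeeze_cvgr _ _ _ _ (fun=> 0) (fun h : R => (n.+2)`!%:R * `|h|)).
    + near=> h; rewrite normr_ge0/= addr0 subr0 normrM normfV.
      have h0 : h != 0 by near: h; exact: nbhs_dnbhs_neq.
      rewrite mulrC ler_pdivrMr ?normr_gt0//; apply: (le_trans (flat_le n h)).
      by rewrite -mulrA -normrM -expr2 ger0_norm// sqr_ge0.
    + exact: cvg_cst.
    + rewrite -[X in _ --> X](mulr0 (n.+2)`!%:R); apply: cvgMr.
      rewrite -[X in _ --> X](normr0 R); apply: cvg_norm.
      exact: (@cvg_within _ (nbhs (0 : R)) _).
  apply: DeriveDef.
    by apply/cvg_ex; exists 0; move: H; under eq_fun do rewrite -[X in X + 0]scaler1.
  by apply: cvg_lim => //; move: H; under eq_fun do rewrite -[X in X + 0]scaler1.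
Unshelve. all: by end_near. Qed.

Lemma flat_csmooth n : csmooth (fun x => (flat n x)%:C%C).
Proof.
move=> m; elim: m n => [//|m IH] n.
exists (fun x => (flat n.+2 x - n%:R * flat n.+1 x)%:C%C).
  by apply: cD_real => x; exact: flat_derive.
have -> : (fun x => (flat n.+2 x - n%:R * flat n.+1 x)%:C%C) =
  fun x => (flat n.+2 x)%:C%C + (- n%:R)%:C%C * (flat n.+1 x)%:C%C.
  by apply/funext => x; rewrite -rmorphM -rmorphD/= mulNr.
by apply: diffnD => //; apply: diffnM => //; exact: diffn_cst.
Qed.

Definition bump (x : R) : R := flat 0 (1 + x) * flat 0 (1 - x).

Let bump_gt0 x : `|x| < 1 -> 0 < bump x.
Proof.
rewrite ltr_norml => /andP[x1 x2]; rewrite /bump /flat.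
rewrite !ifT; [|lra|lra]; by rewrite !expr0 !mul1r mulr_gt0// expR_gt0.
Qed.

Let bump_ge0 x : 0 <= bump x.
Proof.
by rewrite /bump /flat !expr0 !mul1r mulr_ge0//; case: ifP => // _; exact: expR_ge0.
Qed.

Let bump_csmooth : csmooth (fun x => (bump x)%:C%C).
Proof.
have -> : (fun x => (bump x)%:C%C) =
   fun x => (flat 0 (1 * x + 1))%:C%C * (flat 0 (-1 * x + 1))%:C%C.
  by apply/funext => x; rewrite /bump rmorphM mul1r mulN1r ![_ + 1]addrC.
have s0 := flat_csmooth 0.
by apply: csmoothM; [exact: (csmooth_affine 1 1 s0)|exact: (csmooth_affine (-1) 1 s0)].
Qed.

Let bump_csupp : csupp 1 (fun x => (bump x)%:C%C).
Proof.
move=> x x1; suff -> : bump x = 0 by [].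
rewrite /bump /flat; have [x0|x0] := leP 0 x.
  by rewrite ger0_norm// in x1; rewrite [X in _ * X]ifF ?mulr0//; apply/negbTE; rewrite -leNgt; lra.
by rewrite ltr0_norm// in x1; rewrite ifF ?mul0r//; apply/negbTE; rewrite -leNgt; lra.
Qed.

(** A nonnegative function with integral 0 vanishes almost everywhere, whereas [bump] is positive on
    an interval of length 2. *)
Let bump_cint : cint (fun x => (bump x)%:C%C) != 0.
Proof.
have i := ccont_csupp_L1 (csmooth_ccont bump_csmooth) bump_csupp.
apply/eqP => I0.
have L0 : nL1 (fun x => (bump x)%:C%C) = 0.
  rewrite -[RHS]/(complex.Re (0 : R[i])) -I0; apply: eq_Rintegral => x _.
  by rewrite nrm_real ger0_norm// bump_ge0.
have [N [mN N0 bN]] := ae_L1_eq0 i L0.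
have : ((@lebesgue_measure R) `](-1)%R, 1%R[%classic <= (@lebesgue_measure R) N)%E.
  apply: le_measure; rewrite ?inE//.
  move=> x; rewrite /= in_itv/= -ltr_norml => x1; apply: bN => /= /eqP.
  by rewrite eq_complex/= gt_eqF// bump_gt0.
rewrite N0 lebesgue_measure_itv/= lte_fin ifT; last by lra.
by rewrite -EFinB lee_fin; lra.
Qed.

Lemma bump_kernel : exists b : R -> R[i], [/\ csmooth b, csupp 1 b & cint b = 1].
Proof.
exists (fun x => (cint (fun x => (bump x)%:C%C))^-1 * (bump x)%:C%C); split.
- by apply: csmoothM => //; exact: csmooth_cst.
- by move=> x /bump_csupp ->; rewrite mulr0.
- rewrite cintegralZ; first by rewrite mulVf// bump_cint.
  exact: ccont_csupp_L1 (csmooth_ccont bump_csmooth) bump_csupp.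
Qed.

(** The function of [bump_kernel] with another normalization: value 1 at 0 makes its dilates tend to
    1 pointwise. *)
Lemma cutoff : exists c : R -> R[i], [/\ csmooth c, csupp 1 c & c 0 = 1].
Proof.
exists (fun x => (bump 0)^-1%:C%C * (bump x)%:C%C); split.
- by apply: csmoothM => //; exact: csmooth_cst.
- by move=> x /bump_csupp ->; rewrite mulr0.
- by rewrite -rmorphM/= mulVf// gt_eqF// bump_gt0// normr0.
Qed.

End bump.

(** * The flow coordinate *)

Section antiderivative.
Context {R : realType}.
Implicit Types b F : R -> R.

Let P b c z := (\int[leb]_(t in `[c, z]) b t)%R.

Let int_itv b c z : continuous b ->
  (@lebesgue_measure R).-integrable `[c, z] (EFin \o b).
Proof.
move=> cb; apply: continuous_compact_integrable; first exact: segment_compact.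
exact: continuous_subspaceT.
Qed.

Let P_chasles b c c' z : continuous b -> c <= c' -> c' <= z ->
  P b c z = P b c c' + P b c' z.
Proof.
move=> cb cc' c'z; apply/eqP; rewrite addrC -subr_eq; apply/eqP.
rewrite /P (Rintegral_itvB (int_itv _ _ cb)) ?bnd_simp//.
rewrite Rintegral_itv_obnd_cbnd//.
apply: integrableS (int_itv c' z cb) => // x.
by rewrite /= !in_itv/= => /andP[/ltW -> ->].
Qed.

(** An integral from a fixed base point has the right sign only to the right of that point. The
    moving base [- (|z| + 1)] lies below both [z] and 0, and its choice cancels by Chasles, which
    makes [F] the oriented integral from 0 to [z]. *)
Lemma continuous_antiderivative b : continuous b ->
  exists F, forall x, is_derive x (1 : R) F (b x).
Proof.
move=> cb; pose base (z : R) : R := - (`|z| + 1).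
pose F z := P b (base z) z - P b (base z) 0.
have FE c z : c < z -> c < 0 -> F z = P b c z - P b c 0.
  move=> cz c0; rewrite /F.
  have bz : base z < z by rewrite /base; have := ler_norm (- z); rewrite normrN; lra.
  have b0 : base z < 0 by rewrite /base; have := normr_ge0 z; lra.
  have [h|/ltW h] := leP c (base z).
    rewrite (P_chasles cb h (ltW bz)) (P_chasles cb h (ltW b0)); ring.
  rewrite (P_chasles cb h (ltW cz)) (P_chasles cb h (ltW c0)); ring.
(* Near [x] one fixed base point [c] below [x] and 0 serves for all [z], so that the fundamental
   theorem applies. *)
exists F => x; pose c : R := - (`|x| + 2).
have cx : c < x by rewrite /c; have := ler_norm (- x); rewrite normrN; lra.
have c0 : c < 0 by rewrite /c; have := normr_ge0 x; lra.
have [dG G'] := @continuous_FTC1_closed R b c x (x + 1) ltac:(lra) (int_itv _ _ cb) cx (cb x).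
have DG : is_derive x (1 : R) (fun z => P b c z) (b x).
  by apply: DeriveDef; [exact: dG|rewrite -derive1E; exact: G'].
have DG2 : is_derive x (1 : R) (fun z => P b c z - P b c 0) (b x).
  by rewrite -[X in is_derive _ _ _ X]subr0; exact: is_deriveB.
apply: near_eq_is_derive DG2.
by apply: filterS (lt_nbhsr cx) => z cz; rewrite (FE c).
Qed.

Lemma is_derive_continuous F b : (forall x, is_derive x (1 : R) F (b x)) -> continuous F.
Proof. by move=> D x; apply/differentiable_continuous/derivable1_diffP; case: (D x). Qed.

Lemma is_derive_gt0_incr F b : (forall x, is_derive x (1 : R) F (b x)) ->
  (forall x, 0 < b x) -> {homo F : x y / x < y}.
Proof.
move=> D b0 x y xy.
have [z _ /eqP] := MVT xy (fun z _ => D z) (continuous_subspaceT (is_derive_continuous D)).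
by rewrite subr_eq => /eqP ->; rewrite ltrDr mulr_gt0// subr_gt0.
Qed.

(** A bounded increasing [F] would have a finite limit at infinity, and the improper integral of [b]
    would be finite. *)
Lemma antiderivative_unbounded F b : (forall x, is_derive x (1 : R) F (b x)) ->
  continuous b -> (forall x, 0 < b x) ->
  (\int[@lebesgue_measure R]_(x in `[0%R, +oo[) (b x)%:E = +oo)%E ->
  forall M, exists x, M < F x.
Proof.
move=> D cb b0 div M; apply: contrapT => /forallNP FM.
have ndF : nondecreasing_fun F.
  by apply: ltW_homo; exact: is_derive_gt0_incr D b0.
have ub : has_ubound (range F).
  by exists M => _ [x _ <-]; rewrite leNgt; apply/negP; exact: FM.
have := @ge0_continuous_FTC2y R b F 0 _ (fun x _ => ltW (b0 x))
  (continuous_subspaceT cb) (nondecreasing_cvgr ndF ub).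
rewrite div => /(_ _ _ _)/wrap[] => [x _||x _|//].
- by case: (D x).
- by apply: cvg_at_right_filter; exact: is_derive_continuous D 0.
- by rewrite derive1E; case: (D x).
Qed.

End antiderivative.

Section travel_time.
Context {R : realType}.
Variable a : R -> R.
Hypotheses (a_gt0 : forall x, 0 < a x) (a_cont : continuous a).
Hypothesis a_posdiv :
  (\int[@lebesgue_measure R]_(x in `[0%R, +oo[) (a x)^-1%:E = +oo)%E.
Hypothesis a_negdiv :
  (\int[@lebesgue_measure R]_(x in `]-oo, 0%R]) (a x)^-1%:E = +oo)%E.

(* the travel time of the flow x' = a(x), and the flow itself *)
Lemma travel_time : exists tau sigma : R -> R,
  [/\ cancel tau sigma, cancel sigma tau,
      forall x, is_derive x (1 : R) tau (a x)^-1,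
      forall y, is_derive y (1 : R) sigma (a (sigma y)) &
      {homo sigma : x y / x < y}].
Proof.
have b0 x : 0 < (a x)^-1 by rewrite invr_gt0.
have cb : continuous (fun x => (a x)^-1).
  by move=> x; apply: cvgV; [rewrite gt_eqF|exact: a_cont].
have [tau D] := continuous_antiderivative cb.
have ct := is_derive_continuous D.
have it := is_derive_gt0_incr D b0.
have up := antiderivative_unbounded D cb b0 a_posdiv.
(* The function [- tau (- z)] has the positive derivative [(a (- z))^-1]; the reflection carries the
   divergence at minus infinity to plus infinity. *)
have down M : exists x, tau x < M.
  have Dm x : is_derive x (1 : R) (fun z => - tau (- z)) (a (- x))^-1.
    have := @is_derive1_comp R tau -%R x _ _ (D (- x)) (is_deriveN (is_derive_id x 1)).
    by move/is_deriveN; rewrite mulrN1 opprK.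
  have cbm : continuous (fun x => (a (- x))^-1).
    by move=> x; apply: (@continuous_comp _ _ _ -%R (fun x => (a x)^-1)); [exact: opp_continuous|exact: cb].
  have [|x xM] := antiderivative_unbounded Dm cbm (fun x => b0 (- x)) _ (- M).
    rewrite (@ge0_integration_by_substitution0 R (fun x => ((a (- x))^-1)%:E)).
    - by rewrite -a_negdiv; apply: eq_integral => x _; rewrite opprK.
    - by apply/measurable_EFinP; exact: continuous_measurable_fun.
    - by move=> x; rewrite lee_fin ltW.
  by exists (- x); rewrite ltrN2 in xM.
have surj y : exists x, tau x = y.
  have [x1 h1] := down y; have [x2 h2] := up y.
  have x12 : x1 <= x2.
    rewrite leNgt; apply/negP => /it h; have := lt_trans h1 h2.
    by move=> /(lt_trans h); rewrite ltxx.
  have [|c _ <-] := @IVT R tau x1 x2 y x12 (continuous_subspaceT ct).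
    by rewrite ge_min le_max (ltW h1) (ltW h2) orbT.
  by exists c.
pose sigma y := sval (cid (surj y)).
have stK : cancel sigma tau by move=> y; rewrite /sigma; case: cid.
have tinj : injective tau.
  move=> x y xy; have [/it|/it|//] := ltgtP x y; by rewrite xy ltxx.
have tsK : cancel tau sigma by move=> x; apply: tinj; rewrite stK.
exists tau, sigma; split => //.
  move=> y; have := @is_derive_inverse R tau sigma _ (sigma y) _ _ (D (sigma y)) _.
  rewrite stK invrK; apply.
  - exact: (@filterE _ (nbhs (sigma y : R^o)) _ _ tsK).
  - exact: (@filterE _ (nbhs (sigma y : R^o)) _ _ ct).
  - by rewrite gt_eqF.
move=> x y xy; rewrite ltNge le_eqVlt; apply/negP => /orP[/eqP|/it].
  by move/(congr1 tau); rewrite !stK => yx; rewrite yx ltxx in xy.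
by rewrite !stK => /(lt_trans xy); rewrite ltxx.
Qed.

End travel_time.

Section flow_coordinate.
Context {R : realType}.
Variables (a rho tau sigma : R -> R).
Hypotheses (a_gt0 : forall x, 0 < a x) (a_cont : continuous a).
Hypotheses (rho_gt0 : forall x, 0 < rho x) (rho_cont : continuous rho).
Hypotheses (tauK : cancel tau sigma) (sigmaK : cancel sigma tau).
Hypothesis Dtau : forall x, is_derive x (1 : R) tau (a x)^-1.
Hypothesis Dsigma : forall y, is_derive y (1 : R) sigma (a (sigma y)).
Hypothesis sigma_incr : {homo sigma : x y / x < y}.
Local Notation mu := (weighted_lebesgue rho).

(** The measure rho dx in the coordinate y, where dx = a dy. *)
Definition flow_density (y : R) : R := rho (sigma y) * a (sigma y).
Local Notation J := flow_density.

Lemma sigma_cont : continuous sigma. Proof. exact: is_derive_continuous Dsigma. Qed.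

Lemma tau_cont : continuous tau. Proof. exact: is_derive_continuous Dtau. Qed.

Lemma sigma_meas : measurable_fun [set: mR R] (sigma : mR R -> mR R).
Proof. by apply: continuous_measurable_fun; exact: sigma_cont. Qed.

Lemma tau_meas : measurable_fun [set: mR R] (tau : mR R -> mR R).
Proof. by apply: continuous_measurable_fun; exact: tau_cont. Qed.

Let as_cont : continuous (fun y => a (sigma y)).
Proof. by move=> y; apply: (@continuous_comp _ _ _ sigma a); [exact: sigma_cont|exact: a_cont]. Qed.

Lemma flow_density_gt0 y : 0 < J y. Proof. exact: mulr_gt0. Qed.

Lemma flow_density_cont : continuous J.
Proof.
move=> y; apply: cvgM; last exact: as_cont.
by apply: (@continuous_comp _ _ _ sigma rho); [exact: sigma_cont|exact: rho_cont].
Qed.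

Lemma flow_density_meas : measurable_fun [set: R] J.
Proof. by apply: continuous_measurable_fun; exact: flow_density_cont. Qed.

Let rho_meas : measurable_fun [set: R] rho.
Proof. exact: continuous_measurable_fun. Qed.

(** On an interval []x1, x2]] the right side integrates sigma' = a(sigma) from [tau x1] to [tau x2],
    which gives [x2 - x1]; uniqueness of Lebesgue measure does the rest. *)
Let lebesgue_flow (A : set (mR R)) : measurable A ->
  lebesgue_measure A = weighted_lebesgue (fun y => a (sigma y)) (sigma @^-1` A).
Proof.
move=> mA.
pose mm := isMeasurableFun.Build _ _ _ _ _ sigma_meas.
pose phi : {mfun mR R >-> mR R} := HB.pack (sigma : mR R -> mR R) mm.
rewrite -[RHS]/(pushforward (weighted_lebesgue (fun y => a (sigma y))) phi A).
apply: lebesgue_measure_unique => // _ [[x1 x2] _ <-].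
rewrite -[RHS]/(weighted_lebesgue (fun y => a (sigma y)) (sigma @^-1` _)) /=.
rewrite weighted_lebesgueE; last 2 first.
- exact: continuous_measurable_fun.
- by move=> x; exact: ltW.
have sle : {mono sigma : x y / x <= y} := le_mono sigma_incr.
have slt : {mono sigma : x y / x < y} := leW_mono sle.
have -> : sigma @^-1` `]x1, x2] = `]tau x1, tau x2]%classic.
  have e1 y : (x1 < sigma y) = (tau x1 < y) by rewrite -[in LHS](tauK x1) slt.
  have e2 y : (sigma y <= x2) = (y <= tau x2) by rewrite -[in LHS](tauK x2) sle.
  by apply/seteqP; split => y /=; rewrite !in_itv/= e1 e2.
have [x21|x12] := leP x2 x1.
  rewrite !set_itv_ge ?bnd_simp; last 2 first.
  - by rewrite -leNgt -sle !tauK.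
  - by rewrite -leNgt.
  by rewrite measure0 integral_set0.
rewrite lebesgue_measure_itv/= lte_fin x12 -EFinB.
rewrite integral_itv_obnd_cbnd; last first.
  by apply/measurable_EFinP; apply: measurable_funTS; exact: continuous_measurable_fun.
rewrite (@continuous_FTC2 R (fun y => a (sigma y)) sigma).
- by rewrite !tauK EFinB.
- by rewrite -slt !tauK.
- exact: continuous_subspaceT.
- split.
  + by move=> x _; case: (Dsigma x).
  + by apply: cvg_at_right_filter; exact: sigma_cont.
  + by apply: cvg_at_left_filter; exact: sigma_cont.
- by move=> x _; rewrite derive1E; case: (Dsigma x).
Qed.

Lemma weighted_flow (A : set (mR R)) : measurable A ->
  mu A = weighted_lebesgue J (sigma @^-1` A).
Proof.
move=> mA; rewrite (weighted_lebesgueE _ rho_meas (fun x => ltW (rho_gt0 x))).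
rewrite (weighted_lebesgueE _ flow_density_meas (fun x => ltW (flow_density_gt0 x))).
rewrite integral_mkcond [RHS]integral_mkcond.
rewrite (ge0_integral_image (J := fun y => a (sigma y)) (phi := sigma)).
- apply: eq_integral => y _; rewrite !patchE.
  have -> : (y \in sigma @^-1` A) = (sigma y \in A) by apply/idP/idP; rewrite !inE.
  by case: ifPn => _; rewrite ?mul0e// -EFinM.
- exact: continuous_measurable_fun.
- by move=> x; exact: ltW.
- exact: sigma_meas.
- exact: lebesgue_flow.
- apply/(measurable_restrictT _ mA); apply: measurable_funTS.
  exact/measurable_EFinP.
- by move=> x; rewrite patchE; case: ifPn => // _; rewrite lee_fin ltW.
Qed.

Lemma weighted_flow_null (A : set (mR R)) : measurable A ->
  weighted_lebesgue J A = 0 <-> (@lebesgue_measure R) A = 0.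
Proof.
move=> mA; rewrite (weighted_lebesgueE _ flow_density_meas (fun x => ltW (flow_density_gt0 x))).
split => [|A0]; last first.
  apply: null_set_integral => //; apply/measurable_EFinP/measurable_funTS.
  exact: flow_density_meas.
move=> I0; apply: measure_negligible => //.
have mJ : measurable_fun A (EFin \o J).
  by apply: measurable_funTS; apply/measurable_EFinP; exact: flow_density_meas.
have := (ae_eq_integral_abs (@lebesgue_measure R) mA mJ).1.
have -> : (\int[leb]_(x in A) `|(EFin \o J) x| = 0)%E.
  by rewrite -I0; apply: eq_integral => x _; rewrite gee0_abs// lee_fin ltW ?flow_density_gt0.
move=> /(_ erefl) [N [mN N0 AN]]; exists N; split => // x Ax; apply: AN => /= /(_ Ax).
by case=> /eqP; rewrite gt_eqF ?flow_density_gt0.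
Qed.

(** The density is positive and finite, so the transported measure has the Lebesgue null sets. The
    essential supremum sees only null sets, hence L_infty of [mu] is L_infty(dy) in the new
    coordinate. *)
Lemma ae_flow (P : mR R -> Prop) : (\forall x \ae mu, P x) <->
  (\forall y \ae (@lebesgue_measure R), P (sigma y)).
Proof.
split=> -[N [mN N0 PN]].
  have mN' : measurable (sigma @^-1` N).
    by rewrite -[X in measurable X]setTI; exact: sigma_meas.
  exists (sigma @^-1` N); split => //; last by move=> y Py; exact: PN.
  by apply/(weighted_flow_null mN'); rewrite -weighted_flow.
have mN' : measurable (tau @^-1` N).
  by rewrite -[X in measurable X]setTI; exact: tau_meas.
exists (tau @^-1` N); split => //; last first.
  by move=> x Px; apply: PN => /=; rewrite tauK.
rewrite weighted_flow//.
have -> : sigma @^-1` (tau @^-1` N) = N.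
  by apply/seteqP; split => y /=; rewrite sigmaK.
exact/(weighted_flow_null mN).
Qed.

End flow_coordinate.

(** * Compact supports and pointwise mollification *)

Section compact_supports.
Context {R : realType}.
Implicit Types (k f : R -> R[i]).

Lemma compactly_supported_csupp f : compactly_supported f -> exists N, csupp N f.
Proof.
move=> /compact_bounded[M [Mr fM]]; exists (`|M| + 1) => x xM.
apply/eqP; apply/negP => /negP fx; move: xM; apply/negP; rewrite -leNgt.
by apply: fM; [rewrite ltr_pwDr// ler_norm|exact: subset_closure].
Qed.

Lemma csupp_compactly_supported N f : csupp N f -> compactly_supported f.
Proof.
move=> fN; apply: subclosed_compact (@segment_compact R (- N) N) _.
  exact: closed_closure.
have <- : closure (`[- N, N]%classic : set R) = `[- N, N]%classic.
  by apply/esym/closure_id; exact: interval_closed.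
apply: closure_subset => x /= fx; rewrite in_itv/= -ler_norml leNgt; apply/negP => /fN fx0.
by rewrite fx0 eqxx in fx.
Qed.

Lemma conv_csupp M N k f : csupp M k -> csupp N f -> csupp (M + N) (conv k f).
Proof.
move=> kM fN x xMN; rewrite /conv -[RHS](@cintegral0 _ (mR R) R leb).
apply: eq_cintegral => r; have [/fN ->|rN] := ltP N `|r|; first by rewrite mulr0.
rewrite kM ?mul0r//; have := ler_normD (x - r) r; rewrite subrK => xr.
by rewrite -(ltrD2r N); apply: lt_le_trans xMN (le_trans xr _); rewrite lerD2l.
Qed.

Lemma scale_csupp e N k : 0 < e -> e <= 1 -> csupp N k -> csupp N (scale e k).
Proof.
move=> e0 e1 kN x xN; rewrite /scale kN ?mulr0//.
rewrite normrM gtr0_norm ?invr_gt0//; apply: lt_le_trans xN _.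
by rewrite ler_peMl// invf_ge1.
Qed.

Lemma scale_csmooth e k : csmooth k -> csmooth (scale e k).
Proof.
move=> sk; apply: csmoothM; first exact: csmooth_cst.
have := csmooth_affine e^-1 0 sk.
by have -> : (fun x => k (e^-1 * x + 0)) = (fun x => k (e^-1 * x));
  first by apply/funext => x; rewrite addr0.
Qed.

Lemma ccont_seq f (x_ : nat -> R) x : ccont f -> x_ n @[n --> \oo] --> x ->
  nrm (f (x_ n) - f x) @[n --> \oo] --> (0 : R).
Proof.
move=> [c1 c2] cx.
have H (r : R -> R) : continuous r -> `|r (x_ n) - r x| @[n --> \oo] --> (0 : R).
  move=> cr; apply/norm_cvg0P; rewrite -(subrr (r x)).
  by apply: cvgB; [exact: (cvg_comp _ _ cx (cr x))|exact: cvg_cst].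
apply: (@squeeze_cvgr _ _ _ _ (fun=> 0) (fun n =>
  `|complex.Re (f (x_ n)) - complex.Re (f x)| + `|complex.Im (f (x_ n)) - complex.Im (f x)|)).
- by apply: nearW => n; rewrite normc_ge0/= -ReN -ImN -ReD -ImD nrm_le_ReIm.
- exact: cvg_cst.
- by rewrite -[X in _ --> X](addr0 (0 : R)); apply: cvgD; [exact: (H _ c1)|exact: (H _ c2)].
Qed.

Lemma conv_approx_pt k f (e : nat -> R) x : cL1 k -> cint k = 1 -> bdd f -> ccont f ->
  (forall n, 0 < e n) -> e n @[n --> \oo] --> (0 : R) ->
  nrm (conv (scale (e n) k) f x - f x) @[n --> \oo] --> (0 : R).
Proof.
move=> ik k1 bf cf0 e0 ce; have [M M0 fM] := bddP bf; have mf := bf.1.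
have mk := cint_meas ik.
have mfx : cmes (fun y => f (x - y)) by exact: cmes_refl.
have E1 n : conv (scale (e n) k) f x = cint (fun s => k s * f (x - e n * s)).
  rewrite (convE _ (cint_meas (scale_L1 (e0 n) ik)) mf).
  exact: (cint_scale_mul (e0 n) ik (bdd_refl x bf)).
have E2 : f x = cint (fun s => k s * f x).
  rewrite -[LHS]mulr1 -k1 -cintegralZ//; apply: eq_cintegral => s.
  by rewrite mulrC.
under eq_fun do rewrite E1 [f x]E2.
have ce' (s : R) : e n * s @[n --> \oo] --> (0 : R).
  by rewrite -(mul0r s); apply: cvgM => //; exact: cvg_cst.
apply: (@cdominated_cintegral _ (mR R) R leb (fun n s => k s * f (x - e n * s))
  (fun s => k s * f x) (fun s => M * nrm (k s))).
- move=> n; apply: cmeasM => //.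
  by have := cmes_affine (e n) 0 mfx; under eq_fun do rewrite addr0.
- by apply: cmeasM => //; exact: cmeas_cst.
- apply: aeW => s.
  have cxs : x - e n * s @[n --> \oo] --> x.
    by rewrite -[X in _ --> X]subr0; apply: cvgB; [exact: cvg_cst|exact: ce'].
  have cf := ccont_seq cf0 cxs.
  have -> : (fun n => nrm (k s * f (x - e n * s) - k s * f x)) =
      fun n => nrm (k s) * nrm (f (x - e n * s) - f x).
    by apply/funext => n; rewrite -mulrBr Normc.normcM.
  by rewrite -(mulr0 (nrm (k s))); apply: cvgMr.
- by apply: (integrableZl measurableT M (cint_nrm ik)).
- by move=> n s; rewrite Normc.normcM mulrC ler_wpM2r ?normc_ge0.
- by move=> s; rewrite Normc.normcM mulrC ler_wpM2r ?normc_ge0.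
Qed.

(** Here the derivative falls on [f] and the kernel is only integrable: the increments of [f] are
    averages of [f'], and averages commute with convolutions. *)
Lemma conv_cDr k f f' : cL1 k -> cD f f' -> ccont f' -> bdd f -> bdd f' ->
  cD (conv k f) (conv k f').
Proof.
move=> ik D c' bf bf'; apply: cFTC1; first exact: conv_cont ik bf'.
move=> y s s0; rewrite -/(avg s _ y) -(conv_avg s ik bf').
have -> : avg s f' = fun y => f (y + s) - f y.
  by apply/funext => z; exact: cFTC s0 D c'.
have bsf := bdd_shift s bf.
have -> : (fun z => f (z + s) - f z) = fun z => f (z + s) + (-1) * f z.
  by apply/funext => z; rewrite mulN1r.
rewrite (convDr y ik bsf (bddZ (-1) bf)) (convZr _ y ik bf) mulN1r.
congr (_ - _); rewrite (convE y (cint_meas ik) bsf.1).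
rewrite (convE (y + s) (cint_meas ik) bf.1); apply: eq_cintegral => r.
by rewrite addrAC.
Qed.

End compact_supports.

(** * Additive rearrangements for equations between operators *)

Lemma subr_eqD (V : zmodType) (x y z : V) : x - y = z -> x = y + z.
Proof. by move=> <-; rewrite addrC subrK. Qed.

Lemma subr_eqK (V : zmodType) (x y z : V) : x = y + z -> x - z = y.
Proof. by move=> ->; rewrite addrK. Qed.

Lemma subBBr (V : zmodType) (x y : V) : x - y - x = - y.
Proof. by rewrite addrAC subrr add0r. Qed.

Lemma subr_eq_opp (V : zmodType) (x y z : V) : x - y = - z -> x = y - z.
Proof. exact: subr_eqD. Qed.

Lemma subBB (V : zmodType) (x y z t : V) : x - y - (z - t) = x - z - (y - t).
Proof. by rewrite !opprD !opprK addrACA. Qed.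

Lemma subr_eq_subN (V : zmodType) (x y z : V) : x - y = z -> x = y - (- z).
Proof. by rewrite opprK; exact: subr_eqD. Qed.

Lemma subN_subr_eq (V : zmodType) (x y z : V) : x = y - (- z) -> x - y = z.
Proof. by rewrite opprK => ->; rewrite addrAC subrr add0r. Qed.

(** * The Gaussian kernel at complex times *)

Section complex_exponential.
Context {R : realType}.
Implicit Types (z w : R[i]) (F f : R -> R[i]).

Definition cexp z : R[i] :=
  (expR (complex.Re z))%:C%C * (cos (complex.Im z) +i* sin (complex.Im z))%C.

Lemma cexpD z w : cexp (z + w) = cexp z * cexp w.
Proof.
by apply: complex_ext; rewrite /cexp ?ReD ?ImD expRD !(ReM, ImM)/= ?cosD ?sinD; ring.
Qed.

Lemma nrm_cexp z : nrm (cexp z) = expR (complex.Re z).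
Proof.
rewrite Normc.normcM nrm_real ger0_norm ?expR_ge0//.
by rewrite /Normc.normc cos2Dsin2 sqrtr1 mulr1.
Qed.

Lemma cexp_real (r : R) : cexp r%:C%C = (expR r)%:C%C.
Proof. by apply: complex_ext; rewrite /cexp/= cos0 sin0; ring. Qed.

Lemma cexp0 : cexp 0 = 1. Proof. by rewrite (cexp_real 0) expR0. Qed.

Lemma cD_eq F f g : cD F f -> (forall x, f x = g x) -> cD F g.
Proof. by move=> D /funext <-. Qed.

Lemma cexp_cD F f : cD F f -> cD (fun x => cexp (F x)) (fun x => f x * cexp (F x)).
Proof.
move=> D.
have De : cD (fun x => (expR (complex.Re (F x)))%:C%C)
    (fun x => (complex.Re (f x) * expR (complex.Re (F x)))%:C%C).
  apply: cD_real => x; have [D1 _] := D x.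
  have H := @is_derive1_comp R expR (fun y => complex.Re (F y)) x _ _ (is_derive_expR _) D1.
  by apply: (is_derive_eq H); rewrite /GRing.scale/=; ring.
have Dt : cD (fun x => (cos (complex.Im (F x)) +i* sin (complex.Im (F x)))%C)
    (fun x => ((- sin (complex.Im (F x)) * complex.Im (f x)) +i*
      (cos (complex.Im (F x)) * complex.Im (f x)))%C).
  move=> x; have [_ D2] := D x; split => /=.
    have H := @is_derive1_comp R cos (fun y => complex.Im (F y)) x _ _ (is_derive_cos _) D2.
    by apply: (is_derive_eq H); rewrite /GRing.scale/=; ring.
  have H := @is_derive1_comp R sin (fun y => complex.Im (F y)) x _ _ (is_derive_sin _) D2.
  by apply: (is_derive_eq H); rewrite /GRing.scale/=; ring.
apply: cD_eq (cDM De Dt) _ => x; rewrite /cexp; apply: complex_ext; rewrite !(ReD, ImD, ReM, ImM)/=; ring.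
Qed.

(** Integrating the derivative, instead of applying the mean value theorem to both parts, keeps the
    constant [M] without a factor 2. *)
Lemma cD_incr_le F f (y h M : R) : 0 < h -> cD F f -> ccont f ->
  (forall q, 0 <= q <= h -> nrm (f (y + q)) <= M) -> nrm (F (y + h) - F y) <= M * h.
Proof.
move=> h0 D c fM; rewrite -(cFTC y h0 D c).
have mf : cmes (fun q => f (y + q)).
  have cy : continuous (fun q : R => y + q).
    by apply: is_derive_continuous => x; exact: is_derive_addl.
  exact/ccont_meas/(ccont_comp c cy).
have M0 : 0 <= M by apply: le_trans (normc_ge0 _) (fM 0 _); rewrite lexx ltW.
have ind q : 0 <= (\1_(`[0, h]%classic : set R) q : R) by rewrite indicE.
have nc q : nrm (cind h q) = \1_(`[0, h]%classic : set R) q.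
  by rewrite /cind nrm_real ger0_norm.
have ig : (@lebesgue_measure R).-integrable [set: R] (EFin \o (fun q => M * nrm (cind h q))).
  by apply: (integrableZl measurableT M (cint_nrm (cind_L1 h))).
have le q : nrm (cind h q * f (y + q)) <= M * nrm (cind h q).
  rewrite Normc.normcM nc indicE; case: (boolP (q \in _)) => qh.
    rewrite mul1r mulr1 fM//; move: qh; rewrite inE/= in_itv/=.
    by [].
  by rewrite mul0r mulr0.
have ic : cL1 (fun q => cind h q * f (y + q)).
  apply: cint_dom ig le; apply: cmeasM => //; exact: cint_meas (cind_L1 h).
apply: le_trans (nrm_cintegral ic) _; apply: le_trans (L1_le ic ig le) _.
rewrite RintegralZl//; last exact: cint_nrm (cind_L1 h).
rewrite ler_wpM2l// (_ : (\int[leb]_x nrm (cind h x))%R = h)//.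
transitivity (fine (\int[@lebesgue_measure R]_x (\1_(`[0, h]%classic : set R) x)%:E)%E).
  by congr fine; apply: eq_integral => x _; rewrite nc.
have -> : (\int[@lebesgue_measure R]_x (\1_(`[0, h]%classic : set R) x)%:E)%E =
    leb (`[0, h]%classic : set (mR R)).
  by rewrite (integral_indic leb (measurableT : measurable [set: mR R])) ?setIT.
by rewrite (@lebesgue_measure_itv R `[0, h])/= lte_fin h0 -EFinB subr0.
Qed.

Lemma cD_scalel w : cD (fun s : R => s%:C%C * w) (fun=> w).
Proof.
have D1 : cD (fun s : R => s%:C%C) (fun=> 1).
  by apply: (cD_real (f := fun=> 1)) => x; exact: is_derive_id.
by apply: cD_eq (cDM D1 (cD_cst w)) _ => x; rewrite mul1r mulr0 addr0.
Qed.

Let cexp_ray w : cD (fun s : R => cexp (s%:C%C * w)) (fun s => w * cexp (s%:C%C * w)).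
Proof. exact: cexp_cD (cD_scalel w). Qed.

Lemma nrm_cexp_sub1 w : nrm (cexp w - 1) <= nrm w * expR (nrm w).
Proof.
have c : ccont (fun s : R => w * cexp (s%:C%C * w)).
  by apply: ccontM; [exact: ccont_cst|exact: cD_cont (cexp_ray w)].
have := @cD_incr_le _ _ 0 1 (nrm w * expR (nrm w)) ltr01 (cexp_ray w) c.
rewrite add0r mul1r mul0r cexp0 mulr1; apply => q /andP[q0 q1].
rewrite add0r Normc.normcM ler_wpM2l ?normc_ge0// nrm_cexp ler_expR ReZ.
apply: le_trans (ler_norm _) _; rewrite normrM ger0_norm//.
apply: le_trans (nrm_Re w); by rewrite ler_piMl.
Qed.

(** Along the segment from 0 to [w] the function e^(sw) - sw has derivative w (e^(sw) - 1), which
    the first order estimate bounds. *)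
Lemma nrm_cexp_sub2 w : nrm (cexp w - 1 - w) <= nrm w ^+ 2 * expR (nrm w).
Proof.
have D : cD (fun s : R => cexp (s%:C%C * w) - s%:C%C * w)
    (fun s => w * (cexp (s%:C%C * w) - 1)).
  have := cDD (cexp_ray w) (cDZ (-1) (cD_scalel w)).
  have -> : (fun x : R => cexp (x%:C%C * w) + - 1 * (x%:C%C * w)) =
      fun s => cexp (s%:C%C * w) - s%:C%C * w by apply/funext => x; rewrite mulN1r.
  by move=> /cD_eq; apply => x; rewrite mulrBr mulr1 mulN1r.
have c : ccont (fun s : R => w * (cexp (s%:C%C * w) - 1)).
  apply: ccontM; first exact: ccont_cst.
  by apply: ccontD; [exact: cD_cont (cexp_ray w)|exact: ccont_cst].
have := @cD_incr_le _ _ 0 1 (nrm w ^+ 2 * expR (nrm w)) ltr01 D c.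
rewrite add0r mul1r mul0r cexp0 subr0 mulr1 addrAC; apply => q /andP[q0 q1].
rewrite add0r Normc.normcM expr2 -mulrA ler_wpM2l ?normc_ge0//.
have qw : nrm (q%:C%C * w) <= nrm w.
  by rewrite Normc.normcM nrm_real ger0_norm// ler_piMl ?normc_ge0.
apply: le_trans (nrm_cexp_sub1 _) _.
by apply: ler_pM; rewrite ?normc_ge0 ?expR_ge0// ler_expR.
Qed.

End complex_exponential.

Section holomorphic_families.
Context {R : realType}.
Implicit Types (z w eta zeta : R[i]) (c d : R[i] -> R[i]) (g D : R[i] -> R -> R[i]).

(* Complex differentiability in the right half-plane, of scalar functions and of
   L1-valued ones, with a quadratic remainder. *)
Definition hol c d := forall z, 0 < complex.Re z -> exists K r, [/\ 0 <= K, 0 < r &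
  forall eta, nrm eta < r -> nrm (c (z + eta) - c z - eta * d z) <= K * nrm eta ^+ 2].

Definition L1hol g D := [/\ forall z, 0 < complex.Re z -> cL1 (g z),
  forall z, 0 < complex.Re z -> cL1 (D z) &
  forall z, 0 < complex.Re z -> exists K r, [/\ 0 <= K, 0 < r &
    forall eta, nrm eta < r -> 0 < complex.Re (z + eta) /\
      nL1 (fun y => g (z + eta) y - g z y - eta * D z y) <= K * nrm eta ^+ 2]].

(** The counterpart of [hol] for curves with a real parameter; a holomorphic function is
    differentiated along curves in the half-plane, where real calculus applies. *)
Definition qderive (F f : R -> R[i]) := forall x, exists K r, [/\ 0 <= K, 0 < r &
  forall h : R, `|h| < r -> nrm (F (x + h) - F x - h%:C%C * f x) <= K * h ^+ 2].

Lemma Re_gt0_near z eta : nrm eta < complex.Re z -> 0 < complex.Re (z + eta).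
Proof. by move=> ez; rewrite ReD; have := nrm_Re eta; rewrite ler_norml; lra. Qed.

Let real_qderive (u : R -> R) (x d K r : R) : 0 < r -> 0 <= K ->
  (forall h, `|h| < r -> `|u (x + h) - u x - h * d| <= K * h ^+ 2) ->
  is_derive x (1 : R) u d.
Proof.
move=> r0 K0 H.
have C : h^-1 *: (u (h *: 1 + x) - u x) @[h --> 0^'] --> d.
  apply/(@cvgrPdist_le _ R^o) => e e0; near=> h.
  have h0 : h != 0 by near: h; exact: nbhs_dnbhs_neq.
  have hr : `|h| < Num.min r (e / (K + 1)).
    near: h; apply: dnbhs0_lt; rewrite lt_min r0 divr_gt0//; lra.
  move: hr; rewrite lt_min => /andP[hr he].
  have -> : d - h^-1 *: (u (h *: 1 + x) - u x) = - h^-1 * (u (x + h) - u x - h * d).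
    by rewrite /GRing.scale/= mulr1 [h + x]addrC; field.
  rewrite normrM normrN normfV mulrC ler_pdivrMr ?normr_gt0//.
  apply: le_trans (H h hr) _; rewrite -[h ^+ 2]ger0_norm ?sqr_ge0// normrX expr2 mulrA.
  rewrite ler_wpM2r//; move: he; rewrite ltr_pdivlMr; last lra.
  by have := normr_ge0 h; nra.
apply: DeriveDef; first by apply/cvg_ex; exists d.
exact: cvg_lim.
Unshelve. all: by end_near. Qed.

Lemma qderive_at F (d : R[i]) (x K r : R) : 0 <= K -> 0 < r ->
  (forall h : R, `|h| < r -> nrm (F (x + h) - F x - h%:C%C * d) <= K * h ^+ 2) ->
  is_derive x (1 : R) (fun y => complex.Re (F y)) (complex.Re d) /\
  is_derive x (1 : R) (fun y => complex.Im (F y)) (complex.Im d).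
Proof.
move=> K0 r0 H; split.
  apply: (real_qderive r0 K0) => h /H; apply: le_trans.
  by rewrite -ReZ -!ReN -!ReD; exact: nrm_Re.
apply: (real_qderive r0 K0) => h /H; apply: le_trans.
by rewrite -ImZ -!ImN -!ImD; exact: nrm_Im.
Qed.

Lemma qderive_cD F f : qderive F f -> cD F f.
Proof. by move=> q x; have [K [r [K0 r0 H]]] := q x; exact: qderive_at K0 r0 H. Qed.

(** No continuity of [f] is asked: the mean value theorem is applied to the real and the imaginary
    part separately, which costs the factor 2. *)
Lemma nrm_mvt F f (x y M : R) : x < y ->
  (forall s, x <= s <= y -> is_derive s (1 : R) (fun y => complex.Re (F y)) (complex.Re (f s)) /\
    is_derive s (1 : R) (fun y => complex.Im (F y)) (complex.Im (f s))) ->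
  (forall s, x <= s <= y -> nrm (f s) <= M) -> nrm (F y - F x) <= 2 * M * (y - x).
Proof.
move=> xy D fM.
have H (u u' : R -> R) : (forall s, x <= s <= y -> is_derive s (1 : R) u (u' s)) ->
    (forall s, x <= s <= y -> `|u' s| <= M) -> `|u y - u x| <= M * (y - x).
  move=> Du u'M; have [r|r|c] := @MVT R u u' x y xy.
  - by rewrite in_itv/= => /andP[r1 r2]; apply: Du; rewrite !ltW.
  - by apply: derivable_within_continuous => q; rewrite in_itv/= => /Du[].
  rewrite in_itv/= => /andP[c1 c2] ->; rewrite normrM (gtr0_norm (_ : 0 < y - x)) ?subr_gt0//.
  by apply: ler_wpM2r; [rewrite subr_ge0 ltW|apply: u'M; rewrite !ltW].
have HR : `|complex.Re (F y) - complex.Re (F x)| <= M * (y - x).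
  apply: (H (fun s => complex.Re (F s)) (fun s => complex.Re (f s))).
    by move=> s /D[].
  by move=> s /fM; apply: le_trans; exact: nrm_Re.
have HI : `|complex.Im (F y) - complex.Im (F x)| <= M * (y - x).
  apply: (H (fun s => complex.Im (F s)) (fun s => complex.Im (f s))).
    by move=> s /D[].
  by move=> s /fM; apply: le_trans; exact: nrm_Im.
apply: le_trans (nrm_le_ReIm _) _; rewrite ReD ImD ReN ImN; lra.
Qed.

Lemma hol_qderive c d F f : hol c d -> qderive F f -> (forall x, 0 < complex.Re (F x)) ->
  qderive (fun x => c (F x)) (fun x => f x * d (F x)).
Proof.
move=> hc q F0 x; have [K [r [K0 r0 H]]] := q x; have [K' [r' [K'0 r'0 H']]] := hc _ (F0 x).
(* For [|h| < 1] the increment of [F] is at most [A * |h|], linear term and remainder together. The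
   radius [r' / (A + 1)] keeps this increment inside the disc where the expansion of [c] holds. *)
pose A := nrm (f x) + K; have A0 : 0 <= A by rewrite addr_ge0 ?normc_ge0.
exists (K' * A ^+ 2 + K * nrm (d (F x))), (Num.min 1 (Num.min r (r' / (A + 1)))).
split; first by rewrite addr_ge0 ?mulr_ge0 ?exprn_ge0 ?normc_ge0.
  by rewrite !lt_min ltr01 r0 divr_gt0// ltr_wpDl.
move=> h; rewrite !lt_min => /and3P[h1 hr hr'].
set th := F (x + h) - F x; have FE : F (x + h) = F x + th by rewrite /th [RHS]addrC subrK.
have nth : nrm th <= `|h| * A.
  have -> : th = h%:C%C * f x + (F (x + h) - F x - h%:C%C * f x) by rewrite [RHS]addrC subrK.
  apply: le_trans (nrmD _ _) _; rewrite Normc.normcM nrm_real mulrDr lerD2l.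
  apply: le_trans (H h hr) _; rewrite -[h ^+ 2]ger0_norm ?sqr_ge0// normrX expr2 mulrC.
  by rewrite -mulrA ler_wpM2l// ler_piMl// ltW.
have th_r : nrm th < r'.
  apply: le_lt_trans nth _; move: hr'; rewrite ltr_pdivlMr; last by rewrite ltr_wpDl.
  by have := normr_ge0 h; nra.
rewrite FE; have := H' _ th_r; set e := _ - _ - th * _ => He.
have -> : c (F x + th) - c (F x) - h%:C%C * (f x * d (F x)) =
    e + (F (x + h) - F x - h%:C%C * f x) * d (F x).
  by rewrite /e -/th; ring.
apply: le_trans (nrmD _ _) _; rewrite [leRHS]mulrDl; apply: lerD.
  apply: le_trans He _; rewrite -mulrA ler_wpM2l//.
  rewrite -[h ^+ 2]ger0_norm ?sqr_ge0// normrX -exprMn mulrC.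
  by rewrite lerXn2r// nnegrE ?normc_ge0// mulr_ge0.
rewrite Normc.normcM mulrAC ler_wpM2r ?normc_ge0//; exact: H.
Qed.

Lemma L1hol_cint g D : L1hol g D -> hol (fun z => cint (g z)) (fun z => cint (D z)).
Proof.
move=> [ig iD H] z z0; have [K [r [K0 r0 Hr]]] := H z z0; exists K, r; split=> // eta /Hr[z'0].
apply: le_trans; have i1 := ig _ z0; have i2 := ig _ z'0; have i3 := cintZ eta (iD _ z0).
rewrite -cintegralZ; last exact: iD.
rewrite -(cintegralB i2 i1) -(cintegralB (cintB i2 i1) i3).
exact/nrm_cintegral/(cintB (cintB i2 i1) i3).
Qed.

Lemma hol_id : hol id (fun=> 1).
Proof.
move=> z _; exists 0, 1; split=> // eta _.
by rewrite /= mulr1 addrAC addrK subrr Normc.normc0 mul0r.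
Qed.

Lemma L1holM c d g D : hol c d -> L1hol g D ->
  L1hol (fun z y => c z * g z y) (fun z y => d z * g z y + c z * D z y).
Proof.
move=> hc [ig iD H]; split=> [z z0|z z0|z z0].
- exact/cintZ/ig.
- by apply: cintD; [exact/cintZ/ig|exact/cintZ/iD].
have [K [r [K0 r0 Hr]]] := hc z z0; have [K' [r' [K'0 r'0 Hr']]] := H z z0.
have i1 := ig _ z0; have i3 := iD _ z0.
(* The three summands bound, in this order, the three terms of the decomposition [E] of the
   remainder below; the first parenthesis bounds [c (z + eta)] for [nrm eta < 1]. *)
exists ((nrm (c z) + nrm (d z) + K) * K' + K * (nL1 (g z) + nL1 (D z)) +
  nrm (d z) * nL1 (D z)), (Num.min 1 (Num.min r r')).
have g0 : 0 <= nL1 (g z) by exact: L1_ge0.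
have D0 : 0 <= nL1 (D z) by exact: L1_ge0.
split.
- by rewrite !addr_ge0 ?mulr_ge0 ?addr_ge0 ?normc_ge0.
- by rewrite !lt_min ltr01 r0.
move=> eta; rewrite !lt_min => /and3P[e1 er er']; have [z'0 He] := Hr' _ er'; split=> //.
have {}Hr := Hr _ er; set rho := c (z + eta) - c z - eta * d z in Hr.
pose s y := g (z + eta) y - g z y - eta * D z y.
have is_ : cL1 s by apply: cintB (cintB (ig _ z'0) i1) (cintZ eta i3).
have e0 := normc_ge0 eta.
have nc' : nrm (c (z + eta)) <= nrm (c z) + nrm (d z) + K.
  have -> : c (z + eta) = c z + eta * d z + rho by rewrite /rho; ring.
  apply: le_trans (nrmD _ _) _; apply: lerD; last first.
    by apply: le_trans Hr _; rewrite ler_piMr// exprn_ile1// ltW.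
  apply: le_trans (nrmD _ _) _; rewrite lerD2l Normc.normcM.
  by rewrite ler_piMl ?normc_ge0// ltW.
have E y : c (z + eta) * g (z + eta) y - c z * g z y - eta * (d z * g z y + c z * D z y) =
    c (z + eta) * s y + (rho * (g z y + eta * D z y) + eta ^+ 2 * d z * D z y).
  by rewrite /s /rho; ring.
rewrite (eq_nL1 E).
have j1 := cintZ (c (z + eta)) is_.
have j4 := cintD i1 (cintZ eta i3).
have j2 := cintZ rho j4; have j3 := cintZ (eta ^+ 2 * d z) i3.
apply: le_trans (L1D j1 (cintD j2 j3)) _; rewrite -addrA mulrDl; apply: lerD.
  rewrite (L1Z _ is_) -[leRHS]mulrA; apply: ler_pM => //; first exact: normc_ge0.
  exact: L1_ge0.
apply: le_trans (L1D j2 j3) _; rewrite mulrDl; apply: lerD.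
  rewrite (L1Z _ j4) mulrAC; apply: ler_pM => //; first exact: normc_ge0.
    exact: L1_ge0.
  apply: le_trans (L1D i1 (cintZ eta i3)) _; rewrite lerD2l (L1Z _ i3).
  by rewrite ler_piMl// ltW.
rewrite (L1Z _ i3).
have -> : nrm (eta ^+ 2 * d z) = nrm eta ^+ 2 * nrm (d z) by rewrite !expr2 !Normc.normcM.
by rewrite -mulrA mulrC.
Qed.

Lemma L1hol_comp c d g D : (forall z, 0 < complex.Re z -> 0 < complex.Re (c z)) ->
  hol c d -> L1hol g D -> L1hol (fun z => g (c z)) (fun z y => d z * D (c z) y).
Proof.
move=> c0 hc [ig iD H]; split=> [z z0|z z0|z z0].
- exact/ig/c0.
- exact/cintZ/iD/c0.
have [K [r [K0 r0 Hr]]] := hc z z0; have [K' [r' [K'0 r'0 Hr']]] := H _ (c0 _ z0).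
pose A := nrm (d z) + K; have A0 : 0 <= A by rewrite addr_ge0 ?normc_ge0.
have i1 := ig _ (c0 _ z0); have i3 := iD _ (c0 _ z0).
have D0 : 0 <= nL1 (D (c z)) by exact: L1_ge0.
exists (K' * A ^+ 2 + K * nL1 (D (c z))),
  (Num.min (complex.Re z) (Num.min 1 (Num.min r (r' / (A + 1))))).
split; first by rewrite addr_ge0 ?mulr_ge0 ?exprn_ge0.
  by rewrite !lt_min z0 ltr01 r0 divr_gt0// ltr_wpDl.
move=> eta; rewrite !lt_min => /and4P[ez e1 er er']; have e0 := normc_ge0 eta.
split; first exact: Re_gt0_near.
have {}Hr := Hr _ er; set rho := c (z + eta) - c z - eta * d z in Hr.
set th := c (z + eta) - c z; have cE : c (z + eta) = c z + th by rewrite /th [RHS]addrC subrK.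
have nth : nrm th <= nrm eta * A.
  have -> : th = eta * d z + rho by rewrite /rho /th; ring.
  apply: le_trans (nrmD _ _) _; rewrite Normc.normcM mulrDr lerD2l.
  apply: le_trans Hr _; rewrite expr2 mulrC.
  by rewrite -mulrA ler_wpM2l// ler_piMl// ltW.
have th_r : nrm th < r'.
  apply: le_lt_trans nth _; move: er'; rewrite ltr_pdivlMr; last by rewrite ltr_wpDl.
  by nra.
have [z'0 He] := Hr' _ th_r; pose s y := g (c z + th) y - g (c z) y - th * D (c z) y.
have E y : g (c (z + eta)) y - g (c z) y - eta * (d z * D (c z) y) = s y + rho * D (c z) y.
  by rewrite cE /s /rho /th; ring.
rewrite (eq_nL1 E).
have is_ : cL1 s by apply: cintB (cintB (ig _ z'0) i1) (cintZ th i3).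
apply: le_trans (L1D is_ (cintZ rho i3)) _; rewrite mulrDl; apply: lerD.
  apply: le_trans He _; rewrite -mulrA ler_wpM2l// -exprMn mulrC.
  by rewrite lerXn2r// nnegrE ?normc_ge0// mulr_ge0.
by rewrite (L1Z _ i3) mulrAC ler_wpM2r.
Qed.

End holomorphic_families.

Section gaussian_kernel.
Context {R : realType}.
Implicit Types (z w eta zeta : R[i]) (p y : R).

Let gp p y := expR (- (p * y ^+ 2)).

Let gp_L1 p : 0 < p -> cL1 (fun y => (gp p y)%:C%C).
Proof.
move=> p0; have sp : Num.sqrt p != 0 by rewrite sqrtr_eq0 -ltNge.
have ig : cL1 (fun x : R => (gauss_fun x)%:C%C).
  by split; [exact: integrableT_gauss|exact: integrable0].
have := cL1_affine 0 sp ig.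
have -> // : (fun x : R => (gauss_fun (Num.sqrt p * x + 0))%:C%C) = fun y => (gp p y)%:C%C.
by apply/funext => y; rewrite addr0 /gauss_fun /gp exprMn sqr_sqrtr// ltW.
Qed.

(** A quadratic factor is absorbed by half of the exponent, since x e^(-x) <= 1 at x = p y^2 / 2. *)
Let sqr_gp p y : 0 < p -> y ^+ 2 * gp p y <= 2 / p * gp (p / 2) y.
Proof.
move=> p0; set x := p / 2 * y ^+ 2.
have -> : y ^+ 2 = 2 / p * x by rewrite /x; field; rewrite gt_eqF.
have -> : gp p y = gp (p / 2) y * expR (- x).
  by rewrite /gp -expRD; congr expR; rewrite /x; field.
rewrite [leLHS](_ : _ = 2 / p * (gp (p / 2) y * (x * expR (- x)))); last by ring.
rewrite ler_wpM2l//; first by rewrite ltW// divr_gt0.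
rewrite ler_piMr ?expR_ge0//.
rewrite expRN ler_pdivrMr ?expR_gt0// mul1r.
by apply: le_trans (expR_ge1Dx x); rewrite lerDr.
Qed.

Definition gE zeta y : R[i] := cexp (- zeta * (y ^+ 2)%:C%C).

Let nrm_gE zeta y : nrm (gE zeta y) = gp (complex.Re zeta) y.
Proof. by rewrite nrm_cexp ReM ReN /= mulr0 subr0 mulNr. Qed.

Let gED zeta eta y : gE (zeta + eta) y = gE zeta y * gE eta y.
Proof. by rewrite /gE -cexpD opprD mulrDl. Qed.

Lemma gE_cD zeta : cD (gE zeta) (fun y => - (2 * zeta) * y%:C%C * gE zeta y).
Proof.
have D : cD (fun y : R => - zeta * (y ^+ 2)%:C%C) (fun y : R => - zeta * (2 * y)%:C%C).
  apply: cDZ; apply: cD_real => y; apply: is_derive_eq.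
  by rewrite /GRing.scale/=; ring.
apply: cD_eq (cexp_cD D) _ => y; rewrite /gE; congr (_ * _).
by rewrite rmorphM/= rmorph_nat; ring.
Qed.

Lemma gE_ccont zeta : ccont (gE zeta). Proof. exact: cD_cont (gE_cD zeta). Qed.

Lemma gE_L1M zeta (q : R -> R) (C : R) : 0 < complex.Re zeta -> continuous q -> 0 <= C ->
  (forall y, `|q y| <= C * (1 + y ^+ 2)) -> cL1 (fun y => (q y)%:C%C * gE zeta y).
Proof.
set p := complex.Re zeta => p0 cq C0 qC; have p2 : 0 < p / 2 by rewrite divr_gt0.
pose G y := C * (gp p y + 2 / p * gp (p / 2) y).
have iG : cL1 (fun y => (G y)%:C%C).
  have := cintZ C%:C%C (cintD (gp_L1 p0) (cintZ (2 / p)%:C%C (gp_L1 p2))).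
  have -> // : (fun y => C%:C%C * ((gp p y)%:C%C + (2 / p)%:C%C * (gp (p / 2) y)%:C%C)) =
    fun y => (G y)%:C%C.
  by apply/funext => y; rewrite /G [RHS]rmorphM/= rmorphD/= [(2 / p * _)%:C%C]rmorphM.
apply: (cint_dom _ iG.1).
  apply: cmeasM; last exact: ccont_meas (gE_ccont zeta).
  by apply: ccont_meas; split=> // y; exact: cvg_cst.
move=> y; rewrite Normc.normcM nrm_real nrm_gE -/p /G.
apply: le_trans (ler_wpM2r (expR_ge0 _) (qC y)) _; rewrite -[leLHS]mulrA -[leRHS]/(C * _) ler_wpM2l//.
by rewrite mulrDl mul1r lerD2l sqr_gp.
Qed.

Lemma gE_L1 zeta : 0 < complex.Re zeta -> cL1 (gE zeta).
Proof.
move=> z0; have := @gE_L1M zeta (fun=> 1) 1 z0 (fun=> @cst_continuous _ _ _ _) ler01.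
have -> : (fun y : R => (1 : R)%:C%C * gE zeta y) = gE zeta by apply/funext => y; rewrite mul1r.
by apply => y; rewrite normr1 mul1r lerDl sqr_ge0.
Qed.

Lemma gE_yL1 zeta : 0 < complex.Re zeta -> cL1 (fun y => y%:C%C * gE zeta y).
Proof.
move=> z0; apply: (@gE_L1M zeta id 1) => //; first by move=> y; exact: cvg_id.
move=> y; rewrite mul1r ler_norml; apply/andP; split; nra.
Qed.

Lemma gE_y2L1 zeta : 0 < complex.Re zeta -> cL1 (fun y => (y ^+ 2)%:C%C * gE zeta y).
Proof.
move=> z0; apply: (@gE_L1M zeta (fun y => y ^+ 2) 1) => //; first exact: exprn_continuous.
by move=> y; rewrite mul1r ger0_norm ?sqr_ge0// lerDr.
Qed.

Lemma gE_hol : L1hol gE (fun zeta y => - ((y ^+ 2)%:C%C * gE zeta y)).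
Proof.
split=> [z z0|z z0|z z0]; [exact: gE_L1|exact/cintN/gE_y2L1|].
set p := complex.Re z in z0; have p2 : 0 < p / 2 by rewrite divr_gt0.
have p4 : 0 < p / 2 / 2 by rewrite divr_gt0.
have p8 : 0 < p / 2 / 2 / 2 by rewrite divr_gt0.
(* For [nrm eta < p / 2] the exponential in the remainder uses up half of [p], and each of the two
   factors [y ^+ 2] halves the exponent again: hence [p / 2 / 2 / 2]. The constant [k] collects the
   two constants of [sqr_gp]. *)
pose k := 2 / (p / 2) * (2 / (p / 2 / 2)).
have k0 : 0 <= k by rewrite mulr_ge0// divr_ge0// ltW.
pose G y := k * gp (p / 2 / 2 / 2) y.
have iG : (@lebesgue_measure R).-integrable [set: R] (EFin \o G).
  by apply: (integrableZl measurableT k (gp_L1 p8).1).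
exists (\int[leb]_y G y)%R, (p / 2); split=> //.
  by apply: Rintegral_ge0 => y _; rewrite mulr_ge0// expR_ge0.
move=> eta ep; have z'0 : 0 < complex.Re (z + eta).
  by apply: Re_gt0_near; rewrite -/p; lra.
split=> //.
have B y : nrm (gE (z + eta) y - gE z y - eta * (- ((y ^+ 2)%:C%C * gE z y))) <=
    nrm eta ^+ 2 * G y.
  have -> : gE (z + eta) y - gE z y - eta * (- ((y ^+ 2)%:C%C * gE z y)) =
      gE z y * (cexp (- eta * (y ^+ 2)%:C%C) - 1 - (- eta * (y ^+ 2)%:C%C)).
    by rewrite gED /gE; ring.
  rewrite Normc.normcM nrm_gE -/p.
  have nw : nrm (- eta * (y ^+ 2)%:C%C) = nrm eta * y ^+ 2.
    by rewrite Normc.normcM nrmN nrm_real ger0_norm ?sqr_ge0.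
  apply: le_trans (ler_wpM2l (expR_ge0 _) (nrm_cexp_sub2 _)) _; rewrite nw.
  have E1 : gp p y * expR (nrm eta * y ^+ 2) <= gp (p / 2) y.
    rewrite /gp -expRD ler_expR; have := sqr_ge0 y; nra.
  have E2 : y ^+ 2 * (y ^+ 2 * gp (p / 2) y) <= G y.
    apply: le_trans (ler_wpM2l (sqr_ge0 y) (sqr_gp y p2)) _.
    have -> : y ^+ 2 * (2 / (p / 2) * gp (p / 2 / 2) y) =
        2 / (p / 2) * (y ^+ 2 * gp (p / 2 / 2) y) by rewrite mulrCA.
    have -> : G y = 2 / (p / 2) * (2 / (p / 2 / 2) * gp (p / 2 / 2 / 2) y) by rewrite /G /k !mulrA.
    rewrite ler_wpM2l//; last exact: sqr_gp.
    by rewrite ltW// divr_gt0.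
  have -> : gp p y * ((nrm eta * y ^+ 2) ^+ 2 * expR (nrm eta * y ^+ 2)) =
      nrm eta ^+ 2 * (y ^+ 2 * (y ^+ 2 * (gp p y * expR (nrm eta * y ^+ 2)))) by ring.
  rewrite ler_wpM2l ?exprn_ge0 ?normc_ge0//; apply: le_trans E2.
  by rewrite ler_wpM2l ?sqr_ge0// ler_wpM2l ?sqr_ge0.
have i1 := gE_L1 z0; have i3 := cintZ eta (cintN (gE_y2L1 z0)).
have iL := cintB (cintB (gE_L1 z'0) i1) i3.
have iR : (@lebesgue_measure R).-integrable [set: R] (EFin \o (fun y => nrm eta ^+ 2 * G y)).
  by apply: (integrableZl measurableT (nrm eta ^+ 2) iG).
by apply: le_trans (L1_le iL iR B) _; rewrite RintegralZl// mulrC.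
Qed.

Definition gN zeta := cint (gE zeta).

Let gN' zeta := cint (fun y => - ((y ^+ 2)%:C%C * gE zeta y)).

Lemma gN_hol : hol gN gN'. Proof. exact: L1hol_cint gE_hol. Qed.

Lemma gN_scale (l : R) zeta : 0 < l -> 0 < complex.Re zeta ->
  gN ((l ^+ 2)%:C%C * zeta) = l^-1%:C%C * gN zeta.
Proof.
move=> l0 z0; have := cint_affine 0 (lt0r_neq0 l0) (gE_L1 z0).
rewrite gtr0_norm// => <-.
have E (y : R) : gE ((l ^+ 2)%:C%C * zeta) y = gE zeta (l * y + 0).
  rewrite addr0 /gE; congr cexp.
  have -> : ((l * y) ^+ 2)%:C%C = (l ^+ 2)%:C%C * (y ^+ 2)%:C%C :> R[i].
    by rewrite exprMn rmorphM.
  ring.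
by apply: eq_cintegral => y; exact: E.
Qed.

(* differentiate [gN (e^(2s) zeta) = e^(-s) gN zeta] at s = 0 *)
Lemma gN_deriv zeta : 0 < complex.Re zeta -> 2 * zeta * gN' zeta = - gN zeta.
Proof.
move=> z0; pose ga (s : R) := (expR (2 * s))%:C%C * zeta.
have Ds (c : R) : cD (fun s : R => (expR (c * s))%:C%C) (fun s => c%:C%C * (expR (c * s))%:C%C).
  have Dc : cD (fun s : R => s%:C%C * c%:C%C) (fun=> c%:C%C) by exact: cD_scalel.
  have := cexp_cD Dc.
  have -> : (fun x : R => cexp (x%:C%C * c%:C%C)) = fun s => (expR (c * s))%:C%C.
    by apply/funext => x; rewrite -rmorphM/= cexp_real mulrC.
  move=> /cD_eq; apply => x; congr (_ * _).
  by rewrite -rmorphM/= cexp_real mulrC.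
have qga : qderive ga (fun s => 2 * ga s).
  move=> s; exists (4 * expR 2 * nrm (ga s)), 1; split=> //.
    by rewrite !mulr_ge0 ?expR_ge0 ?normc_ge0.
  move=> h h1.
  have -> : ga (s + h) - ga s - h%:C%C * (2 * ga s) =
      ga s * (cexp (2 * h)%:C%C - 1 - (2 * h)%:C%C).
    rewrite /ga mulrDr expRD cexp_real !rmorphM/= rmorph_nat; ring.
  rewrite Normc.normcM.
  have := nrm_cexp_sub2 (2 * h)%:C%C; rewrite nrm_real => H.
  have h2 : `|2 * h| <= 2 by rewrite normrM gtr0_norm//; lra.
  have -> : 4 * expR 2 * nrm (ga s) * h ^+ 2 = nrm (ga s) * (`|2 * h| ^+ 2 * expR 2).
    by rewrite -normrX ger0_norm ?sqr_ge0//; ring.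
  rewrite ler_wpM2l ?normc_ge0//; apply: le_trans H _.
  by rewrite ler_wpM2l ?exprn_ge0// ler_expR.
have ga0 s : 0 < complex.Re (ga s) by rewrite ReZ mulr_gt0// expR_gt0.
have D1 := qderive_cD (hol_qderive gN_hol qga ga0).
have E : (fun x => gN (ga x)) = fun x : R => (expR (- 1 * x))%:C%C * gN zeta.
  apply/funext => x; rewrite /ga expRM_natl.
  by rewrite gN_scale ?expR_gt0// -expRN mulN1r.
have D2 : cD (fun x : R => (expR (- 1 * x))%:C%C * gN zeta)
    (fun x => - 1 * (expR (- 1 * x))%:C%C * gN zeta).
  apply: cD_eq (cDM (Ds (- 1)) (cD_cst (gN zeta))) _ => x.
  by rewrite mulr0 addr0 rmorphN1.
rewrite E in D1; have := congr1 (fun f => f 0) (cD_unique D1 D2).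
by rewrite /ga !mulr0 expR0 !mul1r mulN1r mulN1r.
Qed.

Lemma gN_real p : 0 < p -> gN p%:C%C = (complex.Re (gN p%:C%C))%:C%C /\ 0 < complex.Re (gN p%:C%C).
Proof.
move=> p0; have gpE : gE p%:C%C = fun y => (gp p y)%:C%C.
  by apply/funext => y; rewrite /gE -rmorphN -rmorphM/= cexp_real mulNr.
have Im0 : complex.Im (gN p%:C%C) = 0.
  by rewrite /gN gpE /= /Rintegral integral_cst//= mul0e.
split; first by apply: complex_ext; rewrite ?Im0.
have nE : nL1 (gE p%:C%C) = complex.Re (gN p%:C%C).
  rewrite /gN gpE /=; apply: eq_Rintegral => y _.
  by rewrite nrm_real ger0_norm// expR_ge0.
rewrite -nE lt0r L1_ge0 andbT; apply/eqP => L0.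
have ip : cL1 (gE p%:C%C) by exact: gE_L1.
have [N [mN N0 PN]] := ae_L1_eq0 ip L0.
have NT : N = setT.
  apply/seteqP; split=> // y _; apply: PN => /= /eqP.
  by rewrite -nrm_eq0 nrm_gE gt_eqF// expR_gt0.
have {}N0 : (@lebesgue_measure R) [set: R] = 0 by rewrite -NT.
have RE : [set: R] = `]-oo, +oo[%classic by apply/seteqP; split => x; rewrite /= in_itv.
by move: N0; rewrite RE lebesgue_measure_itv.
Qed.

(** By [gN_deriv] the left side has derivative 0 along the vertical line through [zeta], which leads
    to the real point [p]. From there the scaling by the square root of [p] leads to 1. *)
Lemma gN_sqr zeta : 0 < complex.Re zeta -> zeta * gN zeta ^+ 2 = gN 1 ^+ 2.
Proof.
move=> z0; set p := complex.Re zeta in z0.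
pose ga (s : R) := p%:C%C + s%:C%C * 'i%C.
have ga0 s : 0 < complex.Re (ga s) by rewrite ReD ReZ/= mulr0 addr0.
have qga : qderive ga (fun=> 'i%C).
  move=> s; exists 0, 1; split=> // h _; rewrite mul0r.
  rewrite [X in nrm X](_ : _ = 0) ?Normc.normc0// /ga rmorphD/=; ring.
have DN := qderive_cD (hol_qderive gN_hol qga ga0).
have Dg := qderive_cD qga.
have D0 : cD (fun s => ga s * (gN (ga s) * gN (ga s))) (fun=> 0).
  apply: cD_eq (cDM Dg (cDM DN DN)) _ => s.
  have := gN_deriv (ga0 s); set n := gN (ga s); set n' := gN' (ga s) => H.
  have -> : 'i%C * (n * n) + ga s * ('i%C * n' * n + n * ('i%C * n')) =
    'i%C * n * (n + 2 * ga s * n') by ring.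
  by rewrite H subrr mulr0.
have := cD0_cst D0 (complex.Im zeta) 0.
have -> : ga (complex.Im zeta) = zeta.
  by rewrite /ga; apply: complex_ext; rewrite ?(ReD, ImD, ReZ, ImZ)/= ?mulr0 ?mulr1 ?addr0 ?add0r.
have -> : ga 0 = p%:C%C by rewrite /ga mul0r addr0.
rewrite -!expr2 => ->; have sp : 0 < Num.sqrt p by rewrite sqrtr_gt0.
have pE : (Num.sqrt p ^+ 2)%:C%C * 1 = p%:C%C :> R[i] by rewrite mulr1 sqr_sqrtr// ltW.
have := gN_scale (zeta := 1) sp ltr01; rewrite pE => ->.
rewrite exprMn mulrA -rmorphXn/= -rmorphM/= exprVn sqr_sqrtr; last exact: ltW.
by rewrite mulfV ?gt_eqF// mul1r.
Qed.

Lemma gN_neq0 zeta : 0 < complex.Re zeta -> gN zeta != 0.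
Proof.
move=> z0; apply/eqP => N0; have := gN_sqr z0; rewrite N0 expr0n/= mulr0.
have [-> Np] := gN_real (@ltr01 R).
by move=> /esym/eqP; rewrite sqrf_eq0 eq_complex/= eqxx andbT gt_eqF.
Qed.

End gaussian_kernel.

Section heat_kernel.
Context {R : realType}.
Implicit Types (z w eta zeta : R[i]) (y t : R).

Lemma Re_inv_gt0 z : 0 < complex.Re z -> 0 < complex.Re z^-1.
Proof.
case: z => x y /= x0; rewrite divr_gt0// ltr_pwDl ?sqr_ge0//.
by rewrite exprn_gt0.
Qed.

Let Re4_gt0 z : 0 < complex.Re z -> 0 < complex.Re (4 * z).
Proof.
move=> z0; have -> : 4 * z = (4 : R)%:C%C * z by rewrite rmorph_nat.
by rewrite ReZ mulr_gt0.
Qed.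

(** The exponent of the kernel at time [z]; inversion preserves the right half-plane, so [gN] and
    [gE] are defined there. *)
Let hz z := (4 * z)^-1.

Let hz_gt0 z : 0 < complex.Re z -> 0 < complex.Re (hz z).
Proof. by move=> z0; apply/Re_inv_gt0/Re4_gt0. Qed.

Let Re_neq0 z : 0 < complex.Re z -> z != 0.
Proof. by move=> z0; apply/eqP => zE; rewrite zE ltxx in z0. Qed.

(* e^(- y^2 / 4z) / sqrt (4 pi z) *)
Definition heat z y : R[i] := (gN (hz z))^-1 * gE (hz z) y.
Definition heat1 z y : R[i] := - (2 * z)^-1 * y%:C%C * heat z y.
(** The second derivative in [y] and, by [heat_hol], also the derivative in [z]: the heat equation
    in closed form. *)
Definition heat2 z y : R[i] := ((y ^+ 2)%:C%C * (4 * z ^+ 2)^-1 - (2 * z)^-1) * heat z y.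

Lemma heat_cD z : 0 < complex.Re z -> cD (heat z) (heat1 z).
Proof.
move=> z0; apply: cD_eq (cDZ (gN (hz z))^-1 (gE_cD (hz z))) _ => y.
rewrite /heat1 /heat (_ : 2 * hz z = (2 * z)^-1); first by ring.
by rewrite /hz; field; exact: Re_neq0.
Qed.

Lemma heat1_cD z : 0 < complex.Re z -> cD (heat1 z) (heat2 z).
Proof.
move=> z0; have Dy : cD (fun y : R => - (2 * z)^-1 * y%:C%C) (fun=> - (2 * z)^-1).
  have := cD_scalel (- (2 * z)^-1).
  by have -> // : (fun s : R => s%:C%C * (- (2 * z)^-1)) = fun y => - (2 * z)^-1 * y%:C%C;
    first by apply/funext => s; rewrite mulrC.
apply: cD_eq (cDM Dy (heat_cD z0)) _ => y; rewrite /heat2 /heat1 rmorphXn/=.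
have z'0 := Re_neq0 z0.
by rewrite (_ : (4 * z ^+ 2)^-1 = (2 * z)^-1 ^+ 2); [ring|field].
Qed.

Lemma heat_ccont z : 0 < complex.Re z -> ccont (heat z).
Proof. by move=> /heat_cD/cD_cont. Qed.

Lemma heat1_ccont z : 0 < complex.Re z -> ccont (heat1 z).
Proof. by move=> /heat1_cD/cD_cont. Qed.

Lemma heat2_ccont z : 0 < complex.Re z -> ccont (heat2 z).
Proof.
move=> z0; apply: ccontM; last exact: heat_ccont.
apply: ccontD; last exact: ccont_cst.
apply: ccontM; last exact: ccont_cst.
by split=> /= x; [exact: exprn_continuous|exact: cvg_cst].
Qed.

Lemma heat_L1 z : 0 < complex.Re z -> cL1 (heat z).
Proof. by move=> z0; apply/cintZ/gE_L1/hz_gt0. Qed.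

Lemma heat1_L1 z : 0 < complex.Re z -> cL1 (heat1 z).
Proof.
move=> z0; have := cintZ (- (2 * z)^-1 * (gN (hz z))^-1) (gE_yL1 (hz_gt0 z0)).
rewrite (_ : (fun x => _) = heat1 z)//; apply/funext => y; rewrite /heat1 /heat; ring.
Qed.

Lemma heat2_L1 z : 0 < complex.Re z -> cL1 (heat2 z).
Proof.
move=> z0; have := cintD (cintZ ((4 * z ^+ 2)^-1 * (gN (hz z))^-1) (gE_y2L1 (hz_gt0 z0)))
  (cintZ (- (2 * z)^-1) (heat_L1 z0)).
rewrite (_ : (fun x => _) = heat2 z)//; apply/funext => y; rewrite /heat2 /heat; ring.
Qed.

Lemma heat_cint z : 0 < complex.Re z -> cint (heat z) = 1.
Proof.
move=> z0; have z'0 := hz_gt0 z0.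
by rewrite (cintegralZ _ (gE_L1 z'0)) mulVf// gN_neq0.
Qed.

Let gE0 zeta : gE zeta 0 = 1.
Proof. by rewrite /gE expr0n mulr0 cexp0. Qed.

Let gEVr zeta y : gE (- zeta) y * gE zeta y = 1.
Proof. by rewrite /gE -cexpD opprK mulNr subrr cexp0. Qed.

Lemma heat_bdd z : 0 < complex.Re z -> bdd (heat z).
Proof.
move=> z0; split; first exact/ccont_meas/heat_ccont.
exists (nrm (gN (hz z))^-1) => y; rewrite Normc.normcM ler_piMr ?normc_ge0//.
rewrite nrm_cexp ReM ReN /= mulr0 subr0 mulNr -[leRHS]expR0 ler_expR oppr_le0.
by rewrite mulr_ge0 ?sqr_ge0// ltW// hz_gt0.
Qed.

(* [K = heat z * heat w] solves [(z + w) K' = - (y / 2) K] *)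
Lemma heat_conv z w : 0 < complex.Re z -> 0 < complex.Re w ->
  conv (heat z) (heat w) = heat (z + w).
Proof.
move=> z0 w0; have zw0 : 0 < complex.Re (z + w) by rewrite ReD addr_gt0.
have [iz iw] := (heat_L1 z0, heat_L1 w0).
have [bz bw] := (heat_bdd z0, heat_bdd w0).
set K := conv (heat z) (heat w).
have DK := conv_cD iz (heat1_L1 z0) (heat_cD z0) (heat1_ccont z0) bw; rewrite -/K in DK.
have DK' := conv_cD iw (heat1_L1 w0) (heat_cD w0) (heat1_ccont w0) bz.
rewrite (conv_comm (cint_meas iw) (cint_meas iz)) -/K in DK'.
have E1 := cD_unique DK DK'.
(* K' has two expressions, with the derivative on either kernel. Weighted by [z] and [w], they
   contribute the factors - (y - r) / 2 and - r / 2, whose sum does not depend on [r]. *)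
have ODE y : conv (heat1 z) (heat w) y = - (2 * hz (z + w)) * y%:C%C * K y.
  have i1 := conv_int y (heat1_L1 z0) bw.
  have i2 : cL1 (fun s => heat1 w s * heat z (y - s)).
    exact: cL1_bddr (bdd_refl y bz) (heat1_L1 w0).
  have E2 : conv (heat1 z) (heat w) y = cint (fun s => heat1 w s * heat z (y - s)).
    by rewrite E1 (convE y (cint_meas (heat1_L1 w0)) bz.1).
  have z'0 := Re_neq0 z0; have w'0 := Re_neq0 w0; have zw'0 := Re_neq0 zw0.
  have E3 : (z + w) * conv (heat1 z) (heat w) y = - 2^-1 * y%:C%C * K y.
    rewrite mulrDl [in X in _ + X]E2 /conv -(cintegralZ z i1) -(cintegralZ w i2).
    rewrite -(cintegralD (cintZ z i1) (cintZ w i2)) /K /conv -(cintegralZ _ (conv_int y iz bw)).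
    have H (r : R) : z * (heat1 z (y - r) * heat w r) + w * (heat1 w r * heat z (y - r)) =
        - 2^-1 * y%:C%C * (heat z (y - r) * heat w r).
      by rewrite /heat1 rmorphB/=; field; apply/andP.
    by apply: eq_cintegral => r; exact: H.
  apply: (mulfI zw'0); rewrite E3 /hz; field; exact: zw'0.
have D0 : cD (fun y => K y * gE (- hz (z + w)) y) (fun=> 0).
  apply: cD_eq (cDM DK (gE_cD (- hz (z + w)))) _ => y.
  by rewrite ODE; ring.
have KE y : K y = K 0 * gE (hz (z + w)) y.
  have := cD0_cst D0 y 0; rewrite gE0 mulr1 => <-.
  by rewrite -mulrA gEVr mulr1.
have hN := gN_neq0 (hz_gt0 zw0).
(* The differential equation fixes [K] up to a constant, and the total mass 1 fixes the constant. *)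
have K0 : K 0 * gN (hz (z + w)) = 1.
  rewrite /gN -cintegralZ; last exact/gE_L1/hz_gt0.
  rewrite -(@eq_cintegral _ (mR R) _ _ _ _ KE).
  by rewrite /K (conv_cint iz iw) !heat_cint// mulr1.
apply/funext => y; rewrite KE /heat; congr (_ * _).
by apply: (mulIf hN); rewrite K0 mulVf.
Qed.

(** At real times the kernels are an approximate identity obtained from [heat 1] by dilation; the
    continuity of the semigroup at 0 is thereby that of mollification. *)
Lemma heat_scale t : 0 < t -> scale (Num.sqrt t) (heat 1) = heat t%:C%C.
Proof.
move=> t0; have st0 : 0 < Num.sqrt t by rewrite sqrtr_gt0.
have l0 : 0 < (Num.sqrt t)^-1 by rewrite invr_gt0.
have hE : hz t%:C%C = ((Num.sqrt t)^-1 ^+ 2)%:C%C * hz 1.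
  rewrite exprVn sqr_sqrtr; last exact: ltW.
  by rewrite /hz mulr1 invfM fmorphV mulrC.
have h1 : 0 < complex.Re (hz (1 : R[i])) by apply: hz_gt0; exact: ltr01.
apply/funext => x; rewrite /scale /heat hE (gN_scale l0 h1) invrK invfM -fmorphV -mulrA.
do 2!congr (_ * _); rewrite /gE; apply: congr1; rewrite exprMn.
have -> : ((Num.sqrt t)^-1 ^+ 2 * x ^+ 2)%:C%C =
  ((Num.sqrt t)^-1 ^+ 2)%:C%C * (x ^+ 2)%:C%C :> R[i] by rewrite rmorphM.
ring.
Qed.

Lemma heat_real t y : 0 < t -> exists2 r : R, 0 <= r & heat t%:C%C y = r%:C%C.
Proof.
move=> t0; have hE : hz t%:C%C = ((4 * t)^-1)%:C%C :> R[i].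
  by rewrite /hz fmorphV rmorphM/= rmorph_nat.
have p0 : 0 < (4 * t)^-1 by rewrite invr_gt0 mulr_gt0.
have [n n0 NE] : exists2 n : R, 0 < n & gN ((4 * t)^-1)%:C%C = n%:C%C.
  by have [NE N0] := gN_real p0; eexists; [exact: N0|exact: NE].
exists (n^-1 * expR (- (4 * t)^-1 * y ^+ 2)).
  by rewrite mulr_ge0 ?expR_ge0// invr_ge0 ltW.
rewrite /heat hE NE.
transitivity (n%:C%C^-1 * (expR (- (4 * t)^-1 * y ^+ 2))%:C%C : R[i]); last first.
  by rewrite rmorphM/= fmorphV.
congr (_ * _).
by rewrite /gE -rmorphN -rmorphM/= cexp_real.
Qed.

Lemma heat_nL1 t : 0 < t -> nL1 (heat t%:C%C) = 1.
Proof.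
move=> t0; have tC : 0 < complex.Re (t%:C%C : R[i]) by [].
transitivity ((\int[leb]_y complex.Re (heat t%:C%C y))%R).
  apply: eq_Rintegral => y _; have [r r0 ->] := heat_real y t0.
  by rewrite nrm_real ger0_norm.
by rewrite -[RHS]/(complex.Re (1 : R[i])) -(heat_cint tC).
Qed.

Let hol_hz : hol hz (fun z => - (4 * z ^+ 2)^-1).
Proof.
move=> z z0; have z'0 := Re_neq0 z0; have nz : 0 < nrm z by rewrite nrm_gt0.
exists (nrm (4 * z ^+ 2)^-1 * (2 / nrm z)), (Num.min (complex.Re z) (nrm z / 2)); split.
- by rewrite mulr_ge0 ?normc_ge0// divr_ge0// ltW.
- by rewrite lt_min z0 divr_gt0.
move=> eta; rewrite lt_min => /andP[e1 e2].
have w0 : z + eta != 0 by apply/Re_neq0/Re_gt0_near.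
have -> : hz (z + eta) - hz z - eta * - (4 * z ^+ 2)^-1 =
    (4 * z ^+ 2)^-1 * (z + eta)^-1 * eta ^+ 2 by rewrite /hz; field; apply/andP.
have nX (u : R[i]) : nrm (u ^+ 2) = nrm u ^+ 2 by rewrite !expr2 Normc.normcM.
rewrite Normc.normcM nX Normc.normcM ler_wpM2r ?exprn_ge0 ?normc_ge0//.
rewrite ler_wpM2l ?normc_ge0// Normc.normcV.
rewrite -[2 / _]invrK invf_div lef_pV2 ?posrE ?divr_gt0 ?nrm_gt0//.
have := nrmD (z + eta) (- eta); rewrite addrK nrmN; lra.
Qed.

Let L1hol_eq (g g' D D' : R[i] -> R -> R[i]) :
  (forall z, 0 < complex.Re z -> g z = g' z) -> (forall z, 0 < complex.Re z -> D z = D' z) ->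
  L1hol g D -> L1hol g' D'.
Proof.
move=> gE DE [ig iD H]; split=> [z z0|z z0|z z0]; [by rewrite -gE//; exact: ig|
  by rewrite -DE//; exact: iD|].
have [K [r [K0 r0 Hr]]] := H z z0; exists K, r; split=> // eta /Hr[z'0].
by rewrite (gE _ z0) (gE _ z'0) (DE _ z0).
Qed.

Let hol_cst (k : R[i]) : hol (fun=> k) (fun=> 0).
Proof.
move=> z _; exists 0, 1; split=> // eta _.
by rewrite subrr mulr0 subr0 Normc.normc0 mul0r.
Qed.

(** By [gN_sqr] the inverse normalization is [k * (zeta * gN zeta)], so the kernel is a product of
    holomorphic factors composed with [hz]. *)
Lemma heat_hol : L1hol heat heat2.
Proof.
pose k : R[i] := (gN 1 ^+ 2)^-1.
have kE zeta : 0 < complex.Re zeta -> (gN zeta)^-1 = k * (zeta * gN zeta).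
  move=> z0; have N0 := gN_neq0 z0; have z'0 := Re_neq0 z0.
  rewrite /k -(gN_sqr z0); field; by rewrite N0 z'0.
have H1 := L1hol_cint (L1holM (@hol_id R) (@gE_hol R)).
have H2 := L1holM (@hol_cst k) (L1holM H1 (@gE_hol R)).
have := L1hol_comp hz_gt0 hol_hz H2; apply: L1hol_eq => z z0.
  apply/funext => y; rewrite /heat kE; last exact: hz_gt0.
  by rewrite (cintegralZ _ (gE_L1 (hz_gt0 z0))) !mulrA.
apply/funext => y; rewrite /heat2 /heat.
have z'0 := Re_neq0 z0; set ze := hz z; have ze0 : 0 < complex.Re ze := hz_gt0 z0.
have i1 := gE_L1 ze0; have i2 := cintN (gE_y2L1 ze0).
rewrite (cintegralZ _ i1).
(* The derivative of zeta N is N + zeta N', and [gN_deriv] says zeta N' = - N / 2. *)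
have -> : cint (fun y => 1 * gE ze y + ze * - ((y ^+ 2)%:C%C * gE ze y)) = gN ze / 2.
  rewrite (cintegralD (cintZ 1 i1) (cintZ ze i2)) (cintegralZ _ i1) (cintegralZ _ i2) mul1r.
  have := gN_deriv ze0; set n' := cint _ => Hn.
  apply: (@mulfI _ (2 : R[i])); first by rewrite pnatr_eq0.
  by rewrite mulrDr mulrA Hn -/(gN ze); field.
have N0 := gN_neq0 ze0; have ze'0 := Re_neq0 ze0.
rewrite -/(gN ze) mul0r add0r.
have -> : (y ^+ 2)%:C%C * (4 * z ^+ 2)^-1 - (2 * z)^-1 =
  - (4 * z ^+ 2)^-1 * ((2 * ze)^-1 - (y ^+ 2)%:C%C) by rewrite /ze /hz; field.
have kz : k = (ze * gN ze ^+ 2)^-1 by rewrite /k (gN_sqr ze0).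
rewrite kz; field; by rewrite N0 ze'0.
Qed.

End heat_kernel.

(** Differentiability is known only for s > 0. Adding [s c] to [phi] leaves the derivative [c - g],
    small near 0; the mean value bound is used on [[x, t]] with x > 0, and then [x] tends to 0. *)
Lemma right_difference_quotient {R : realType} (phi g : R -> R[i]) (p0 c : R[i]) :
  (forall s, 0 < s -> exists K r, [/\ 0 <= K, 0 < r & forall q, `|q| < r ->
    nrm (phi (s + q) - phi s - q%:C%C * - g s) <= K * q ^+ 2]) ->
  (forall e, 0 < e -> exists2 d, 0 < d & forall s, 0 < s -> s < d -> nrm (g s - c) < e) ->
  (forall e, 0 < e -> exists2 d, 0 < d & forall s, 0 < s -> s < d -> nrm (phi s - p0) < e) ->
  nrm ((t^-1)%:C%C * (p0 - phi t) - c) @[t --> 0^'+] --> (0 : R).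
Proof.
move=> Dphi Hg Hphi; pose psi (s : R) := phi s + s%:C%C * c.
have Dpsi (s : R) : 0 < s ->
    is_derive s (1 : R) (fun y => complex.Re (psi y)) (complex.Re (c - g s)) /\
    is_derive s (1 : R) (fun y => complex.Im (psi y)) (complex.Im (c - g s)).
  move=> s0; have [K [r [K0 r0 H]]] := Dphi s s0.
  apply: (qderive_at K0 r0) => q /H.
  have -> // : psi (s + q) - psi s - q%:C%C * (c - g s) =
    phi (s + q) - phi s - q%:C%C * - g s.
  by rewrite /psi rmorphD/=; ring.
apply/(@cvgr0Pnorm_le R R^o) => e e0.
have e2 : 0 < e / 2 by rewrite divr_gt0.
have [d d0 Hd] := Hg _ e2.
near=> t; rewrite ger0_norm ?normc_ge0//.
have t0 : 0 < t by near: t; exact: nbhs_right_gt.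
have td : t < d by near: t; exact: nbhs_right_lt.
have -> : (t^-1)%:C%C * (p0 - phi t) - c = - (t^-1)%:C%C * (psi t - p0).
  have tc : t%:C%C != 0 :> R[i] by rewrite eq_complex/= eqxx andbT gt_eqF.
  rewrite /psi fmorphV; field; exact: tc.
rewrite Normc.normcM nrmN nrm_real gtr0_norm ?invr_gt0// mulrC ler_pdivrMr//.
apply/ler_addgt0Pr => e' e'0.
have e'2 : 0 < e' / 2 by rewrite divr_gt0.
have [d' d'0 Hd'] := Hphi _ e'2.
(* The three bounds keep [x] below [t], bring [phi x] within [e' / 2] of [p0], and keep [x c] below
   [e' / 2]. *)
pose x := Num.min (t / 2) (Num.min (d' / 2) (e' / 2 / (nrm c + 1))).
have nc1 : 0 < nrm c + 1 by rewrite ltr_wpDl ?normc_ge0.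
have x0 : 0 < x by rewrite !lt_min !divr_gt0.
have /and3P[xt xd' xe'] : [&& x <= t / 2, x <= d' / 2 & x <= e' / 2 / (nrm c + 1)].
  by rewrite -!le_min.
have xt' : x < t by lra.
have M : nrm (psi t - psi x) <= 2 * (e / 2) * (t - x).
  apply: (@nrm_mvt _ psi (fun s => c - g s) x t (e / 2) xt').
    by move=> s /andP[xs _]; apply: Dpsi; exact: lt_le_trans x0 xs.
  move=> s /andP[xs st]; rewrite nrmB ltW// Hd//; first exact: lt_le_trans x0 xs.
  exact: le_lt_trans st td.
have P1 : nrm (phi x - p0) < e' / 2 by apply: Hd' => //; lra.
have P2 : nrm (x%:C%C * c) <= e' / 2.
  rewrite Normc.normcM nrm_real gtr0_norm//; move: xe'; rewrite ler_pdivlMr// => xe'.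
  by apply: le_trans xe'; rewrite ler_wpM2l//; [exact: ltW|rewrite lerDl].
have -> : psi t - p0 = (psi t - psi x) + ((phi x - p0) + x%:C%C * c).
  by rewrite /psi; ring.
apply: le_trans (nrmD _ _) _; have := nrmD (phi x - p0) (x%:C%C * c).
have : e * (t - x) <= e * t by apply: ler_wpM2l; [exact: ltW|rewrite lerBlDr lerDl ltW].
move: M; have -> : 2 * (e / 2) = e by rewrite mulrC divfK.
lra.
Unshelve. all: by end_near. Qed.

(** * Operators on the weighted L_infty *)

Section Linf_flow.
Context {R : realType}.
Variables (a rho tau sigma : R -> R).
Hypotheses (a_gt0 : forall x, 0 < a x) (a_cont : continuous a).
Hypotheses (rho_gt0 : forall x, 0 < rho x) (rho_cont : continuous rho).
Hypotheses (tauK : cancel tau sigma) (sigmaK : cancel sigma tau).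
Hypothesis Dtau : forall x, is_derive x (1 : R) tau (a x)^-1.
Hypothesis Dsigma : forall y, is_derive y (1 : R) sigma (a (sigma y)).
Hypothesis sigma_incr : {homo sigma : x y / x < y}.
Local Notation mu := (weighted_lebesgue rho).
Local Notation L := (Linf mu).
Local Notation J := (flow_density a rho sigma).

Let aeflow := ae_flow a_gt0 a_cont rho_gt0 rho_cont tauK sigmaK Dtau Dsigma sigma_incr.
Let wflow := weighted_flow a_gt0 a_cont rho_gt0 rho_cont tauK Dsigma sigma_incr.
Let mJ : measurable_fun [set: R] J := flow_density_meas a_cont rho_cont Dsigma.
Let J0 y : 0 <= J y. Proof. exact/ltW/flow_density_gt0. Qed.
Let msigma : measurable_fun [set: mR R] (sigma : mR R -> mR R) := sigma_meas Dsigma.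
Let mtau : measurable_fun [set: mR R] (tau : mR R -> mR R) := tau_meas Dtau.

(** The norm with exponent infinity is the essential supremum only for a measure of positive
    mass. *)
Let muT : (0 < mu [set: R])%E.
Proof.
rewrite lt0e measure_ge0 andbT; apply/eqP => mu0.
have : (@lebesgue_measure R) [set: R] = 0.
  apply/(weighted_flow_null a_gt0 a_cont rho_gt0 rho_cont Dsigma measurableT).
  by rewrite -mu0 (wflow measurableT).
have -> : [set: R] = `]-oo, +oo[%classic by apply/seteqP; split => x; rewrite /= in_itv.
by rewrite lebesgue_measure_itv.
Qed.

Lemma Linf_meas (u : L) : cmeasurable (u : mR R -> R[i]).
Proof. by have /in_LinfP[] := Linf_funP (repr u). Qed.

Let LnormE (u : L) : (Linf_norm u)%:E = ess_sup mu (EFin \o cnorm u).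
Proof.
have := Linf_funP (repr u); rewrite inE/= /finite_norm => -[_].
rewrite /Linf_norm unlock /Lnorm muT.
have -> : abse \o (EFin \o cnorm (repr u)) = EFin \o cnorm u.
  by apply/funext => x /=; rewrite ger0_norm// /cnorm normc_ge0.
move=> fin; rewrite fineK// fin_real// fin andbT.
apply: lt_le_trans (ltNyr 0) _; apply: ess_sup_ger => // x.
by rewrite lee_fin normc_ge0.
Qed.

Let aemS (P Q : mR R -> Prop) : (forall x, P x -> Q x) ->
  (\forall x \ae mu, P x) -> \forall x \ae mu, Q x.
Proof. exact: (@filterS _ _ (ae_filter_ringOfSetsType mu)). Qed.

Let Linf_norm_ae (u : L) : \forall x \ae mu, nrm (u x) <= Linf_norm u.
Proof.
have /ess_supP : (ess_sup mu (EFin \o cnorm u) <= (Linf_norm u)%:E)%E by rewrite LnormE.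
by apply: aemS => x; rewrite lee_fin.
Qed.

(* Bounded by the norm everywhere, so that no exceptional set has to be carried
   along in estimates. *)
Definition Linf_rep (u : L) : R -> R[i] := fun y =>
  if nrm (u (sigma y)) <= Linf_norm u then u (sigma y) else 0.
Local Notation U := Linf_rep.

Lemma Linf_norm_ge0 (u : L) : 0 <= Linf_norm u.
Proof.
by rewrite -lee_fin LnormE; apply: ess_sup_ger => // x; rewrite lee_fin normc_ge0.
Qed.

Lemma Linf_rep_le (u : L) y : nrm (U u y) <= Linf_norm u.
Proof. by rewrite /U; case: ifPn => // _; rewrite Normc.normc0 Linf_norm_ge0. Qed.

Lemma Linf_repE (u : L) : \forall y \ae (@lebesgue_measure R), U u y = u (sigma y).
Proof.
have := (aeflow (fun x => nrm (u x) <= Linf_norm u)).1 (Linf_norm_ae u).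
by apply: aeS => y; rewrite /U => ->.
Qed.

Lemma Linf_rep_bdd (u : L) : bdd (U u).
Proof.
split; last by exists (Linf_norm u) => x; exact: Linf_rep_le.
have mu' : cmes (fun y => u (sigma y)) by exact: cmeas_comp (Linf_meas u).
pose A := [set y : mR R | nrm (u (sigma y)) <= Linf_norm u].
have mA : measurable A.
  rewrite /A -[X in measurable X]setTI.
  have -> : [set y : mR R | nrm (u (sigma y)) <= Linf_norm u] =
    (fun y => nrm (u (sigma y))) @^-1` `]-oo, Linf_norm u]%classic.
    by apply/seteqP; split => y; rewrite /= in_itv.
  by apply: (cmeas_nrm mu').
have -> : U u = fun y => (\1_A y)%:C%C * u (sigma y).
  apply/funext => y; rewrite /U indicE.
  have -> : (y \in A) = (nrm (u (sigma y)) <= Linf_norm u) by apply/idP/idP; rewrite inE.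
  by case: ifP => _; rewrite ?mul1r ?mul0r.
by apply: cmeasM => //; apply: cmeas_real; exact: measurable_indic.
Qed.

Lemma Linf_ext (u v : L) : (\forall y \ae (@lebesgue_measure R), U u y = U v y) -> u = v.
Proof.
move=> uv; apply/Linf_eqP; apply/aeflow.
by apply: aeS3 (Linf_repE u) (Linf_repE v) uv => y -> ->.
Qed.

Lemma Linf_norm_le (u : L) M : 0 <= M ->
  (\forall y \ae (@lebesgue_measure R), nrm (U u y) <= M) -> Linf_norm u <= M.
Proof.
move=> M0 uM; rewrite -lee_fin LnormE; apply/ess_supP.
apply/(aeflow (fun x => (EFin \o cnorm u) x <= M%:E)%E).
by apply: aeS2 (Linf_repE u) uM => y E; rewrite lee_fin /cnorm -E.
Qed.

Lemma mk_in f : bdd f -> (f \o tau : mR R -> R[i]) \in in_Linf mu.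
Proof.
move=> [mf [M fM]]; apply/in_LinfP; split; first exact: cmeas_comp mf.
exists M; apply: (@filterE _ _ (ae_filter_ringOfSetsType mu)) => x.
by rewrite /cnorm fM.
Qed.

(** Total, with default value 0 for a function that is not [bdd]: the term carries no proof, so
    equal functions give equal classes by [congr]. *)
Definition Linf_mk f : L :=
  if pselect (bdd f) is left b then (\pi_(Linf mu) (LinfFun (mk_in b)))%qT else 0.
Local Notation mk := Linf_mk.

Lemma Linf_mkE f : bdd f -> \forall y \ae (@lebesgue_measure R), U (mk f) y = f y.
Proof.
move=> bf; rewrite /mk; case: pselect => // b.
have /aeflow E := Linf_piE (LinfFun (mk_in b)).
have U_ := Linf_repE (\pi_(Linf mu) (LinfFun (mk_in b)))%qT.
by apply: aeS2 U_ E => y -> ->; rewrite /= sigmaK.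
Qed.

Lemma Linf_repD (u v : L) : \forall y \ae (@lebesgue_measure R), U (u + v) y = U u y + U v y.
Proof.
have /aeflow uv := Linf_addE u v.
have uv' : \forall y \ae (@lebesgue_measure R), U u y + U v y = u (sigma y) + v (sigma y).
  by apply: aeS2 (Linf_repE u) (Linf_repE v) => y -> ->.
by apply: aeS3 (Linf_repE (u + v)) uv uv' => y -> -> ->.
Qed.

Lemma Linf_repZ c (u : L) : \forall y \ae (@lebesgue_measure R), U (c *: u) y = c * U u y.
Proof.
have /aeflow cu := Linf_scaleE c u.
by apply: aeS3 (Linf_repE (c *: u)) cu (Linf_repE u) => y -> -> ->.
Qed.

Lemma Linf_representsE f (u : L) :
  represents rho f u <-> \forall y \ae (@lebesgue_measure R), U u y = f (sigma y).
Proof.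
split => [/aeflow H|H]; first by apply: aeS2 (Linf_repE u) H => y -> ->.
by apply/aeflow; apply: aeS2 (Linf_repE u) H => y -> ->.
Qed.

Lemma Linf_nonnegE (u : L) :
  Linf_nonneg u <-> \forall y \ae (@lebesgue_measure R), 0 <= U u y.
Proof.
split => [/aeflow H|H]; first by apply: aeS2 (Linf_repE u) H => y ->.
by apply/aeflow; apply: aeS2 (Linf_repE u) H => y ->.
Qed.

(** * The weak* topology through pairings with L1(dy) *)

Definition pr (h : R -> R[i]) (u : L) : R[i] := cint (fun y => U u y * h y).

Lemma pr_int h u : cL1 h -> cL1 (fun y => U u y * h y).
Proof. exact/cL1_bdd/Linf_rep_bdd. Qed.

Lemma prE h u f : cL1 h -> cmes f ->
  (\forall y \ae (@lebesgue_measure R), U u y = f y) ->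
  pr h u = cint (fun y => f y * h y).
Proof.
move=> ih mf uf; apply: ae_eq_cintegral.
- exact: cint_meas (pr_int u ih).
- by apply: cmeasM => //; exact: cint_meas ih.
- by apply: aeS uf => y ->.
Qed.

Lemma pr_mk h f : cL1 h -> bdd f -> pr h (mk f) = cint (fun y => f y * h y).
Proof. by move=> ih bf; apply: prE => //; [exact: bf.1|exact: Linf_mkE]. Qed.

Lemma prD h u v : cL1 h -> pr h (u + v) = pr h u + pr h v.
Proof.
move=> ih; rewrite (prE ih _ (Linf_repD u v)).
  by rewrite -cintegralD; [apply: eq_cintegral => y; rewrite mulrDl|exact: pr_int|exact: pr_int].
by apply: cmeasD; exact: (Linf_rep_bdd _).1.
Qed.

Lemma prZ h c u : cL1 h -> pr h (c *: u) = c * pr h u.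
Proof.
move=> ih; rewrite (prE ih _ (Linf_repZ c u)).
  by rewrite -cintegralZ; [apply: eq_cintegral => y; rewrite mulrA|exact: pr_int].
by apply: cmeasM; [exact: cmeas_cst|exact: (Linf_rep_bdd _).1].
Qed.

Lemma prB h u v : cL1 h -> pr h (u - v) = pr h u - pr h v.
Proof. by move=> ih; rewrite prD// -scaleN1r prZ// mulN1r. Qed.

Lemma prN h u : cL1 h -> pr h (- u) = - pr h u.
Proof. by move=> ih; rewrite -scaleN1r prZ// mulN1r. Qed.

Lemma nrm_pr h u : cL1 h -> nrm (pr h u) <= Linf_norm u * nL1 h.
Proof.
move=> ih; have [mu' _] := Linf_rep_bdd u.
exact: nrm_cintegralMb ih mu' (Linf_rep_le u).
Qed.

(* test the difference against its conjugate times a Gaussian *)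
Lemma pr_inj u v : (forall h, cL1 h -> pr h u = pr h v) -> u = v.
Proof.
move=> E; apply: Linf_ext.
pose d y := U u y - U v y.
have bd : bdd d by apply: bddB; exact: Linf_rep_bdd.
have bc : bdd (fun y => (d y)^*%C).
  have [[d1 d2] [M dM]] := bd; split; last first.
    exists M => y; apply: le_trans (dM y).
    by case: (d y) => p q; rewrite /Normc.normc/= sqrrN.
  split.
    by rewrite (_ : (fun y => _) = fun y => complex.Re (d y))//; apply/funext => y; case: (d y).
  rewrite (_ : (fun y => _) = fun y => - complex.Im (d y)); last by apply/funext => y; case: (d y).
  exact: measurableT_comp.
have ig : cL1 (fun x : R => (gauss_fun x)%:C%C).
  by split; [exact: integrableT_gauss|exact: integrable0].
have ih := cL1_bdd bc ig.
have i1 := cL1_bdd bd ih.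
have I0 : cint (fun y => d y * ((d y)^*%C * (gauss_fun y)%:C%C)) = 0.
  rewrite (@eq_cintegral _ (mR R) _ _ _ (fun y => U u y * ((d y)^*%C * (gauss_fun y)%:C%C) -
    U v y * ((d y)^*%C * (gauss_fun y)%:C%C))); last by move=> y; rewrite -mulrBl.
  rewrite cintegralB; [|exact: pr_int|exact: pr_int].
  by rewrite -/(pr _ u) -/(pr _ v) E// subrr.
have nE y : nrm (d y * ((d y)^*%C * (gauss_fun y)%:C%C)) =
    complex.Re (d y * ((d y)^*%C * (gauss_fun y)%:C%C)).
  rewrite !Normc.normcM nrm_real ger0_norm ?gauss_fun_ge0//.
  have -> : nrm (d y)^*%C = nrm (d y) by case: (d y) => p q; rewrite /Normc.normc/= sqrrN.
  rewrite mulrA -expr2 nrm_sqr; case: (d y) => p q; rewrite /=; ring.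
have L0 : nL1 (fun y => d y * ((d y)^*%C * (gauss_fun y)%:C%C)) = 0.
  rewrite -[RHS]/(complex.Re (0 : R[i])) -I0.
  by apply: eq_Rintegral => y _; rewrite nE.
apply: aeS (ae_L1_eq0 i1 L0) => y /eqP.
rewrite !mulf_eq0 => /or3P[/eqP/subr0_eq //|/eqP|].
  move=> dc; apply/eqP; rewrite -subr_eq0 -/(d y).
  move: dc; case: (d y) => p q []/= -> /eqP; rewrite oppr_eq0 => /eqP ->.
  by [].
by rewrite eq_complex/= gt_eqF// expR_gt0.
Qed.

(** The predual in the coordinate y: a function in L1(rho dx) becomes one in L1(dy). Dividing by the
    density inverts this, so both families of pairings define the same topology. *)
Let gmul (g : R -> R[i]) y := (J y)%:C%C * g (sigma y).

Let pairing_pr (g : L1_fun mu) (u : L) :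
  cL1 (gmul (sval g)) /\ Linf_pairing g u = pr (gmul (sval g)) u.
Proof.
have [mg ig] := (cint_meas (svalP g), svalP g).
have ih : cL1 (gmul (sval g)).
  exact/(cintegrable_image mJ J0 msigma wflow mg).1.
split => //; rewrite /Linf_pairing (cintegral_image mJ J0 msigma wflow); last first.
  by apply: cmeasM => //; exact: Linf_meas.
apply/esym; rewrite (prE ih _ (Linf_repE u)); last exact: cmeas_comp (Linf_meas u).
by apply: eq_cintegral => y; rewrite /gmul; ring.
Qed.

Let pr_pairing h : cL1 h -> exists g : L1_fun mu, forall u, pr h u = Linf_pairing g u.
Proof.
move=> ih; pose g x := (J (tau x))^-1%:C%C * h (tau x).
have mg : cmeasurable (g : mR R -> R[i]).
  apply: cmeasM; last exact: cmeas_comp (cint_meas ih).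
  apply: cmeas_real; apply: continuous_measurable_fun => x.
  apply: (@cvgV R _ _ _ (fun x => J (tau x))); first by rewrite gt_eqF// flow_density_gt0.
  apply: (@continuous_comp _ _ _ tau J); first exact: tau_cont Dtau x.
  exact: flow_density_cont Dsigma _.
have gE : gmul g = h.
  apply/funext => y; rewrite /gmul /g sigmaK mulrA -rmorphM/= mulfV ?mul1r//.
  by rewrite gt_eqF// flow_density_gt0.
have ig : cintegrable mu g.
  by apply/(cintegrable_image mJ J0 msigma wflow mg); rewrite -/(gmul g) gE.
exists (exist _ g ig) => u; have [_ ->] := pairing_pr (exist _ g ig) u.
by rewrite /= gE.
Qed.

Lemma weakstar_cvgP (F : set_system L) (u : L) : Filter F ->
  F --> u <-> forall h, cL1 h -> nrm (pr h v - pr h u) @[v --> F] --> (0 : R).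
Proof.
move=> FF; split=> [/Linf_cvgP H h ih|H].
  have [g gE] := pr_pairing ih; have /cvg_nrmP := H g.
  have -> : (fun v => nrm (pr h v - pr h u)) =
    fun v => nrm (Linf_pairing g v - Linf_pairing g u); last by [].
  by apply/funext => v; rewrite !gE.
apply/Linf_cvgP => g; apply/cvg_nrmP.
have [ih gE] := pairing_pr g u; have := H _ ih.
have pE v : Linf_pairing g v = pr (gmul (sval g)) v by have [] := pairing_pr g v.
have -> : (fun v => nrm (pr (gmul (sval g)) v - pr (gmul (sval g)) u)) =
  fun v => nrm (Linf_pairing g v - Linf_pairing g u); last by [].
by apply/funext => v; rewrite !pE.
Qed.

Lemma pr_cvg (F : set_system L) (u : L) h : Filter F -> F --> u -> cL1 h ->
  nrm (pr h v - pr h u) @[v --> F] --> (0 : R).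
Proof. by move=> FF /weakstar_cvgP; apply. Qed.

(** Linearity is not part of the definition; it follows because the pairings are linear and separate
    points. Weak* continuity is immediate as well. *)
Definition preadj (B : L -> L) := forall h, cL1 h ->
  exists2 h', cL1 h' & forall u, pr h (B u) = pr h' u.

Lemma preadj_cont B : preadj B -> continuous B.
Proof.
move=> pB u; have FB : Filter (B @ nbhs u) by exact: fmap_filter.
apply/(weakstar_cvgP (B u) FB) => h /pB[h' ih' E].
have Fu : Filter (nbhs u) := nbhs_filter u.
have := pr_cvg Fu (@cvg_id _ (nbhs u)) ih'.
have -> : (fun v => nrm (pr h' v - pr h' u)) = fun v => nrm (pr h (B v) - pr h (B u)).
  by apply/funext => v; rewrite !E.
by [].
Qed.

Lemma preadj_linear B : preadj B -> linear B.
Proof.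
move=> pB c u v; apply: pr_inj => h ih; have [h' ih' E] := pB h ih.
by rewrite E !(prD,prZ)// !E.
Qed.

Lemma preadjB0 B u v : preadj B -> B (u - v) = B u - B v.
Proof. by move=> /preadj_linear lB; rewrite addrC -scaleN1r lB scaleN1r addrC. Qed.

Lemma preadjZ0 B c u : preadj B -> B (c *: u) = c *: B u.
Proof.
move=> pB; apply: pr_inj => h ih; have [h' ih' E] := pB h ih.
by rewrite E !prZ// E.
Qed.

Lemma preadj_id : preadj id. Proof. by move=> h ih; exists h. Qed.

Lemma preadj_comp B1 B2 : preadj B1 -> preadj B2 -> preadj (B1 \o B2).
Proof.
move=> p1 p2 h /p1[h1 /p2[h2 i2 E2] E1]; exists h2 => // u.
by rewrite /= E1 E2.
Qed.

Lemma pr_sub h1 h2 u : cL1 h1 -> cL1 h2 -> pr (fun y => h1 y - h2 y) u = pr h1 u - pr h2 u.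
Proof.
move=> i1 i2; rewrite /pr -cintegralB; [|exact: pr_int|exact: pr_int].
by apply: eq_cintegral => y; rewrite mulrBr.
Qed.

Lemma preadjB B1 B2 : preadj B1 -> preadj B2 -> preadj (fun u => B1 u - B2 u).
Proof.
move=> p1 p2 h ih; have [h1 i1 E1] := p1 h ih; have [h2 i2 E2] := p2 h ih.
exists (fun y => h1 y - h2 y); first exact: cintB.
by move=> u; rewrite prB// E1 E2 pr_sub.
Qed.

Lemma preadjN B : preadj B -> preadj (fun u => - B u).
Proof.
move=> pB h ih; have [h1 i1 E1] := pB h ih.
exists (fun y => -1 * h1 y); first exact: cintZ.
move=> u; rewrite -scaleN1r prZ// E1 /pr -cintegralZ; last exact: pr_int.
by apply: eq_cintegral => y; rewrite mulrCA.
Qed.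

(** Tested against [h], the equation compares two pairings, one in each coordinate, and both are
    continuous for the product topology. An arbitrary point of the closure is reached in this way,
    without a sequence. *)
Lemma closure_eq (B1 B2 : L -> L) (M : set (L * L)) : preadj B1 -> preadj B2 ->
  (forall p, M p -> B1 p.1 = B2 p.2) -> forall p, closure M p -> B1 p.1 = B2 p.2.
Proof.
move=> p1 p2 H p clp; apply: pr_inj => h ih.
have [h1 i1 E1] := p1 h ih; have [h2 i2 E2] := p2 h ih.
rewrite E1 E2; apply/eqP; rewrite -subr_eq0 -nrm_eq0; apply/eqP.
apply/eqP; rewrite eq_le normc_ge0 andbT; apply/ler_addgt0Pr => e e0; rewrite add0r.
have e2 : 0 < e / 2 by rewrite divr_gt0.
have F1 : Filter (fst @ nbhs p) by exact: fmap_filter.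
have F2 : Filter (snd @ nbhs p) by exact: fmap_filter.
have c1 := pr_cvg F1 (@cvg_fst L L (nbhs p.1) (nbhs p.2) _) i1.
have c2 := pr_cvg F2 (@cvg_snd L L (nbhs p.1) (nbhs p.2) _) i2.
have {}c1 := c1 (nbhs_filter p.2); have {}c2 := c2 (nbhs_filter p.1).
have n1 : nbhs p [set q | nrm (pr h1 q.1 - pr h1 p.1) < e / 2].
  have /cvgr0Pnorm_lt/(_ _ e2) : nrm (pr h1 q.1 - pr h1 p.1) @[q --> nbhs p] --> (0 : R) := c1.
  by apply: filterS => q; rewrite ger0_norm ?normc_ge0.
have n2 : nbhs p [set q | nrm (pr h2 q.2 - pr h2 p.2) < e / 2].
  have /cvgr0Pnorm_lt/(_ _ e2) : nrm (pr h2 q.2 - pr h2 p.2) @[q --> nbhs p] --> (0 : R) := c2.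
  by apply: filterS => q; rewrite ger0_norm ?normc_ge0.
have [q [Mq [/= q1 q2]]] := clp _ (filterI n1 n2).
have Eq : pr h1 q.1 = pr h2 q.2 by rewrite -E1 -E2 H.
have -> : pr h1 p.1 - pr h2 p.2 = (pr h2 q.2 - pr h2 p.2) - (pr h1 q.1 - pr h1 p.1).
  by rewrite Eq; ring.
by rewrite (le_trans (nrmD _ _))// nrmN; lra.
Qed.

(** The only way in which points are put into a closure below; dominated convergence provides the
    sequences. *)
Lemma seq_closure (M : set (L * L)) (m : nat -> L * L) p : (forall n, M (m n)) ->
  (forall h, cL1 h -> nrm (pr h (m n).1 - pr h p.1) @[n --> \oo] --> (0 : R)) ->
  (forall h, cL1 h -> nrm (pr h (m n).2 - pr h p.2) @[n --> \oo] --> (0 : R)) ->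
  closure M p.
Proof.
move=> Mm c1 c2 B nB.
have m1 : (fun n => (m n).1) @ \oo --> p.1 by apply/weakstar_cvgP => h /c1.
have m2 : (fun n => (m n).2) @ \oo --> p.2 by apply/weakstar_cvgP => h /c2.
have cm : (fun n => ((m n).1, (m n).2)) @ \oo `=>` filter_prod (nbhs p.1) (nbhs p.2).
  exact: cvg_pair m1 m2.
have [N _ NB] := cm _ nB; exists (m N); split; first exact: Mm.
by have := NB N (leqnn N); rewrite /= -surjective_pairing.
Qed.

Lemma seq_limit_unique (x : nat -> R[i]) (l l' : R[i]) :
  nrm (x n - l) @[n --> \oo] --> (0 : R) -> nrm (x n - l') @[n --> \oo] --> (0 : R) -> l = l'.
Proof.
move=> /(@cvg_nrmP _ _ _ _ x) h1 /(@cvg_nrmP _ _ _ _ x) h2.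
exact: (cvg_unique _ h1 h2).
Qed.

(** * Convolutions, translations and averages on L_infty *)

Definition Cv k u : L := mk (conv k (U u)).

Definition Tr s u : L := mk (fun y => U u (y + s)).

Definition Av s := Cv (kavg s).

Lemma CvE k u : cL1 k -> \forall y \ae (@lebesgue_measure R), U (Cv k u) y = conv k (U u) y.
Proof. by move=> ik; apply: Linf_mkE; apply: conv_bdd ik (Linf_rep_bdd u). Qed.

Lemma pr_Cv k h u : cL1 k -> cL1 h -> pr h (Cv k u) = pr (adj k h) u.
Proof.
move=> ik ih; have bu := Linf_rep_bdd u.
by rewrite (pr_mk ih (conv_bdd ik bu)) (conv_adj ik bu ih).
Qed.

Lemma Cv_preadj k : cL1 k -> preadj (Cv k).
Proof.
by move=> ik h ih; exists (adj k h); [exact: adj_L1|move=> u; exact: pr_Cv].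
Qed.

Lemma Tr_preadj s : preadj (Tr s).
Proof.
move=> h ih; exists (fun y => h (y - s)); first exact: (cL1_shift (- s)).
move=> u; have bu := Linf_rep_bdd u.
rewrite (pr_mk ih (bdd_shift s bu)) /pr -(cint_shift (- s)).
  by apply: eq_cintegral => y; rewrite subrK.
apply: cmeasM; last exact: cint_meas ih.
exact: cmes_shift bu.1.
Qed.

Lemma Av_preadj s : preadj (Av s). Proof. exact/Cv_preadj/kavg_L1. Qed.

Lemma mk_ext f g : bdd f -> bdd g -> (\forall y \ae (@lebesgue_measure R), f y = g y) ->
  mk f = mk g.
Proof.
move=> bf bg fg; apply: Linf_ext.
by apply: aeS3 (Linf_mkE bf) (Linf_mkE bg) fg => y -> ->.
Qed.

Lemma Cv_mk k f : cL1 k -> bdd f -> Cv k (mk f) = mk (conv k f).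
Proof.
move=> ik bf; congr mk; apply: (conv_ae (cint_meas ik) _ bf.1 (Linf_mkE bf)).
exact: (Linf_rep_bdd _).1.
Qed.

Lemma Cv_comp k l u : cL1 k -> cL1 l -> Cv k (Cv l u) = Cv (conv k l) u.
Proof.
move=> ik il; have bu := Linf_rep_bdd u.
by rewrite [in LHS]/Cv -/(Cv l u) -/(Cv k _) (Cv_mk ik (conv_bdd il bu)) (conv_assoc ik il bu).
Qed.

Lemma CvC k l u : cL1 k -> cL1 l -> Cv k (Cv l u) = Cv l (Cv k u).
Proof.
move=> ik il; rewrite (Cv_comp u ik il) (Cv_comp u il ik).
by rewrite (conv_comm (cint_meas ik) (cint_meas il)).
Qed.

Lemma TrCv s k u : cL1 k -> Tr s (Cv k u) = Cv k (Tr s u).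
Proof.
move=> ik; have bu := Linf_rep_bdd u; have bk := conv_bdd ik bu.
rewrite [in RHS]/Tr (Cv_mk ik (bdd_shift s bu)).
transitivity (mk (fun y => conv k (U u) (y + s))).
  apply: mk_ext; [exact/bdd_shift/Linf_rep_bdd|exact: bdd_shift|].
  exact: ae_shift (CvE u ik).
congr mk; apply/funext => y; rewrite /conv -[LHS](cint_shift s).
  by apply: eq_cintegral => r; congr (k _ * _); rewrite opprD addrACA subrr addr0.
by apply: cmeasM; [exact/cmes_refl/(cint_meas ik)|exact: bu.1].
Qed.

Lemma Tr_mk s f : bdd f -> Tr s (mk f) = mk (fun y => f (y + s)).
Proof.
move=> bf; apply: mk_ext; [exact/bdd_shift/Linf_rep_bdd|exact: bdd_shift|].
exact: ae_shift (Linf_mkE bf).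
Qed.

Lemma mkD f g : bdd f -> bdd g -> mk f + mk g = mk (fun y => f y + g y).
Proof.
move=> bf bg; apply: pr_inj => h ih.
rewrite prD// (pr_mk ih bf) (pr_mk ih bg) (pr_mk ih (bddD bf bg)).
rewrite -cintegralD; [|exact: cL1_bdd|exact: cL1_bdd].
by apply: eq_cintegral => y; rewrite mulrDl.
Qed.

Lemma mkZ c f : bdd f -> c *: mk f = mk (fun y => c * f y).
Proof.
move=> bf; apply: pr_inj => h ih.
rewrite prZ// (pr_mk ih bf) (pr_mk ih (bddZ c bf)) -cintegralZ; last exact: cL1_bdd.
by apply: eq_cintegral => y; rewrite mulrA.
Qed.

Lemma mkN f : bdd f -> - mk f = mk (fun y => - f y).
Proof.
move=> bf; rewrite -scaleN1r mkZ//; congr mk; apply/funext => y.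
by rewrite mulN1r.
Qed.

Lemma mkB f g : bdd f -> bdd g -> mk f - mk g = mk (fun y => f y - g y).
Proof.
move=> bf bg; rewrite (mkN bg) mkD//.
by have := bddZ (-1) bg; congr bdd; apply/funext => y; rewrite mulN1r.
Qed.

Lemma Av_mk s f : bdd f -> Av s (mk f) = mk (avg s f).
Proof. by move=> bf; rewrite /Av (Cv_mk (kavg_L1 s) bf) (avgE s bf). Qed.

Lemma CvZl c k u : cL1 k -> Cv (fun x => c * k x) u = c *: Cv k u.
Proof.
move=> ik; have bu := Linf_rep_bdd u.
rewrite [RHS](mkZ c (conv_bdd ik bu)); congr mk; apply/funext => y.
exact: convZl.
Qed.

Lemma CvB k u v : cL1 k -> Cv k (u - v) = Cv k u - Cv k v.
Proof. by move=> ik; apply: preadjB0; exact: Cv_preadj. Qed.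

(* distributional graph of d/dy, expressed through increments *)
Definition Xt : set (L * L) :=
  [set p | forall s, 0 < s -> Tr s p.1 - p.1 = Av s p.2].

Lemma Xt_closure M : M `<=` Xt -> closure M `<=` Xt.
Proof.
move=> MX p clp s s0.
have := closure_eq (preadjB (Tr_preadj s) preadj_id) (Av_preadj s).
by move=> /(_ M _ p clp); apply => q /MX; exact.
Qed.

Definition en (n : nat) : R := n.+1%:R^-1.

Lemma en_gt0 n : 0 < en n. Proof. by rewrite invr_gt0. Qed.

Lemma en_cvg : en n @[n --> \oo] --> (0 : R). Proof. exact: cvg_harmonic. Qed.

Lemma Cv_approx k u h (e : nat -> R) : cL1 k -> cint k = 1 -> cL1 h ->
  (forall n, 0 < e n) -> e n @[n --> \oo] --> (0 : R) ->
  nrm (pr h (Cv (scale (e n) k) u) - pr h u) @[n --> \oo] --> (0 : R).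
Proof.
move=> ik k1 ih e0 ce; have bu := Linf_rep_bdd u.
have := conv_approx ik k1 bu ih e0 ce.
have -> : (fun n => nrm (pr h (Cv (scale (e n) k) u) - pr h u)) = fun n =>
  nrm (cint (fun y => conv (scale (e n) k) (U u) y * h y) - cint (fun y => U u y * h y)).
  by apply/funext => n; rewrite (pr_mk ih (conv_bdd (scale_L1 (e0 n) ik) bu)).
by [].
Qed.

Lemma Cv_approx_inj k u v : cL1 k -> cint k = 1 ->
  (forall n, Cv (scale (en n) k) u = Cv (scale (en n) k) v) -> u = v.
Proof.
move=> ik k1 E; apply: pr_inj => h ih.
apply: seq_limit_unique (Cv_approx u ik k1 ih en_gt0 en_cvg) _.
by under eq_fun do rewrite E; exact: Cv_approx ik k1 ih en_gt0 en_cvg.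
Qed.

Lemma kavg_scale s : 0 < s -> kavg s = (fun x : R => s%:C%C * scale s (kavg (1 : R)) x).
Proof.
move=> s0; apply/funext => x.
rewrite /scale mulrA -rmorphM/= mulfV ?gt_eqF// mul1r /kavg /cind.
congr ((_ : R)%:C%C); rewrite !indicE; congr ((nat_of_bool _)%:R).
rewrite -mulrN; apply/idP/idP; rewrite !inE/= !in_itv/=.
  by rewrite [_^-1 * _]mulrC ler_pdivrMr// mul1r pmulr_lge0 ?invr_gt0.
by rewrite [_^-1 * _]mulrC ler_pdivrMr// mul1r pmulr_lge0 ?invr_gt0.
Qed.

Lemma Linf_scale_inj (t : R) (u v : L) : t != 0 -> t%:C%C *: u = t%:C%C *: v -> u = v.
Proof.
move=> t0; apply: scalerI; first by rewrite eq_complex/= negb_and t0.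
Qed.

Lemma kavg1_cint : cint (kavg (1 : R)) = 1.
Proof.
rewrite -(cint_refl 0); last exact: cint_meas (kavg_L1 (1 : R)).
apply: complex_ext => /=; last first.
  by rewrite /Rintegral integral_cst//= mul0e.
transitivity (fine (\int[@lebesgue_measure R]_x (\1_(`[0, 1]%classic : set R) x)%:E)%E).
  by congr fine; apply: eq_integral => x _; rewrite sub0r opprK.
have -> : (\int[@lebesgue_measure R]_x (\1_(`[0, 1]%classic : set R) x)%:E)%E =
    leb (`[0, 1]%classic : set (mR R)).
  rewrite (integral_indic leb (measurableT : measurable [set: mR R])) ?setIT//.
by rewrite (@lebesgue_measure_itv R `[0, 1])/= lte_fin ltr01 -EFinB subr0.
Qed.

(** The averages [Av s], divided by [s], form an approximate identity as [s] tends to 0, so the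
    increments of [u] determine [v]. *)
Lemma Xt_functional u v w : Xt (u, v) -> Xt (u, w) -> v = w.
Proof.
move=> Xv Xw; apply: (Cv_approx_inj (kavg_L1 (1 : R)) kavg1_cint) => n.
have e0 := en_gt0 n; have isc := scale_L1 e0 (kavg_L1 (1 : R)).
have := Xw _ e0; rewrite /= (Xv _ e0) /= /Av (kavg_scale e0).
rewrite (CvZl _ v isc) (CvZl _ w isc); apply: Linf_scale_inj.
by rewrite gt_eqF.
Qed.

Lemma Xt_C1 F f : cD F f -> ccont f -> bdd F -> bdd f -> Xt (mk F, mk f).
Proof.
move=> D cf bF bf s s0 /=.
rewrite (Tr_mk s bF) (mkB (bdd_shift s bF) bF) (Av_mk s bf); congr mk.
by apply/funext => y; rewrite /avg (cFTC y s0 D cf).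
Qed.

Lemma Xt_Cv_deriv k k' u : cL1 k -> cL1 k' -> cD k k' -> ccont k' ->
  Xt (Cv k u, Cv k' u).
Proof.
move=> ik ik' D c; have bu := Linf_rep_bdd u.
apply: Xt_C1; [exact: conv_cD|exact: conv_cont|exact: conv_bdd|exact: conv_bdd].
Qed.

Lemma Xt_Cv k u v : cL1 k -> Xt (u, v) -> Xt (Cv k u, Cv k v).
Proof.
move=> ik X s s0 /=; rewrite (TrCv s u ik) -(CvB _ _ ik) (X s s0)/=.
exact: CvC ik (kavg_L1 s).
Qed.

(** Both sides are the derivative of [Cv k u], computed once on the kernel and once on [u]; the
    derivative is unique. *)
Lemma Xt_Cv_swap k k' u v : cL1 k -> cL1 k' -> cD k k' -> ccont k' -> Xt (u, v) ->
  Cv k' u = Cv k v.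
Proof.
move=> ik ik' D c X.
exact: Xt_functional (Xt_Cv_deriv u ik ik' D c) (Xt_Cv ik X).
Qed.

(** * Test functions in the two coordinates *)

Let tau_incr : {homo tau : x y / x < y}.
Proof.
move=> x y xy; rewrite ltNge; apply/negP; rewrite le_eqVlt => /orP[/eqP|/sigma_incr].
  by move=> /(congr1 sigma); rewrite !tauK => yx; rewrite yx ltxx in xy.
by rewrite !tauK ltNge ltW.
Qed.

Lemma csupp_flow N f : csupp N f -> exists M, csupp M (fun y => f (sigma y)).
Proof.
move=> fN; exists (`|tau (- N)| + `|tau N|) => y yM; apply: fN.
rewrite ltNge; apply/negP; rewrite ler_norml => /andP[].
have le_tau x x' : x <= x' -> tau x <= tau x'.
  by rewrite le_eqVlt => /orP[/eqP ->//|/tau_incr/ltW].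
move=> /le_tau + /le_tau; rewrite sigmaK => y1 y2.
move: yM; apply/negP; rewrite -leNgt ler_norml.
have := ler_norm (tau N); have := ler_norm (- tau (- N)); rewrite normrN.
have := normr_ge0 (tau N); have := normr_ge0 (tau (- N)); lra.
Qed.

Lemma csupp_unflow N f : csupp N f -> exists M, csupp M (fun x => f (tau x)).
Proof.
move=> fN; exists (`|sigma (- N)| + `|sigma N|) => y yM; apply: fN.
rewrite ltNge; apply/negP; rewrite ler_norml => /andP[].
have le_s x x' : x <= x' -> sigma x <= sigma x'.
  by rewrite le_eqVlt => /orP[/eqP ->//|/sigma_incr/ltW].
move=> /le_s + /le_s; rewrite tauK => y1 y2.
move: yM; apply/negP; rewrite -leNgt ler_norml.
have := ler_norm (sigma N); have := ler_norm (- sigma (- N)); rewrite normrN.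
have := normr_ge0 (sigma N); have := normr_ge0 (sigma (- N)); lra.
Qed.

Lemma represents_mk f u : bdd (fun y => f (sigma y)) ->
  represents rho f u <-> u = mk (fun y => f (sigma y)).
Proof.
move=> bf; split => [/Linf_representsE H|->]; last exact/Linf_representsE/Linf_mkE.
by apply: Linf_ext; apply: aeS2 H (Linf_mkE bf) => y -> ->.
Qed.

Definition C1test (F f : R -> R[i]) := [/\ cD F f, ccont f & exists N, csupp N F].

Lemma C1test_bdd F f : C1test F f -> bdd F /\ bdd f.
Proof.
move=> [D c [N s]]; split; first exact: ccont_csupp_bdd (cD_cont D) s.
exact: ccont_csupp_bdd c (csupp_deriv D s).
Qed.

Lemma C1_c_flow f : C1_c f ->
  C1test (fun y => f (sigma y)) (fun y => (a (sigma y))%:C%C * cderive1 f (sigma y)).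
Proof.
move=> [f1 f2 /compactly_supported_csupp[N sN]]; have [D c] := C1_cD f1 f2.
have cs : continuous sigma := sigma_cont Dsigma.
split; [exact: cD_comp|apply: ccontM|exact: csupp_flow sN].
  split; last by move=> y; exact: cvg_cst.
  by move=> y; apply: (@continuous_comp _ _ _ sigma a); [exact: cs|exact: a_cont].
exact: (ccont_comp c cs).
Qed.

Lemma X_op_flow (D : set (R -> R[i])) u v : D `<=` C1_c -> X_op rho a D (u, v) <->
  exists2 f, D f & u = mk (fun y => f (sigma y)) /\
    v = mk (fun y => (a (sigma y))%:C%C * cderive1 f (sigma y)).
Proof.
move=> DC; split => -[f Df [fu fv]]; exists f => //;
  have [b1 b2] := C1test_bdd (C1_c_flow (DC _ Df)).
  by split; [apply/represents_mk|apply/(@represents_mk (fun x => (a x)%:C%C * cderive1 f x))].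
by split; [apply/represents_mk|apply/(@represents_mk (fun x => (a x)%:C%C * cderive1 f x))].
Qed.

(** As [a] is continuous and positive, [tau] and [sigma] are C1 and monotone, so that compactly
    supported C1 functions correspond to each other. No such statement holds for smooth ones unless
    [a] is smooth. *)
Lemma X_maxP u v : X_max rho a (u, v) <->
  exists F f, [/\ C1test F f, u = mk F & v = mk f].
Proof.
split.
  move/X_op_flow => /(_ (@subset_refl _ _))[f /C1_c_flow Cf [-> ->]].
  by exists (fun y => f (sigma y)), (fun y => (a (sigma y))%:C%C * cderive1 f (sigma y)).
move=> [F [f [[D c [N sN]] -> ->]]]; apply/X_op_flow => //.
have D' : cD (fun x => F (tau x)) (fun x => (a x)^-1%:C%C * f (tau x)) by exact: cD_comp.
have ct : continuous tau := tau_cont Dtau.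
have c' : ccont (fun x => (a x)^-1%:C%C * f (tau x)).
  apply: ccontM; last exact: (ccont_comp c ct).
  split; last by move=> y; exact: cvg_cst.
  move=> x; apply: (@cvgV R); last exact: a_cont.
  by rewrite gt_eqF.
exists (fun x => F (tau x)); last first.
  rewrite (cD_cderive1 D'); split; congr mk; apply/funext => y; rewrite sigmaK//.
  by rewrite mulrA -rmorphM/= mulfV ?gt_eqF// mul1r.
split.
- split; first by move=> x; have [[]] := D' x.
  have -> : derive1 (fun x => complex.Re (F (tau x))) =
      fun x => complex.Re ((a x)^-1%:C%C * f (tau x)).
    by apply/funext => x; have [[_ <-] _] := D' x; rewrite derive1E.
  exact: c'.1.
- split; first by move=> x; have [_ []] := D' x.
  have -> : derive1 (fun x => complex.Im (F (tau x))) =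
      fun x => complex.Im ((a x)^-1%:C%C * f (tau x)).
    by apply/funext => x; have [_ [_ <-]] := D' x; rewrite derive1E.
  exact: c'.2.
- have [M sM] := csupp_unflow sN; exact: csupp_compactly_supported sM.
Qed.

Lemma X_max_Xt : X_max rho a `<=` Xt.
Proof.
move=> [u v] /X_maxP[F [f [Cf -> ->]]]; have [bF bf] := C1test_bdd Cf.
by case: Cf => D c _; exact: Xt_C1.
Qed.

(** Bounded pointwise convergence implies weak* convergence, by domination with [M * nrm (h y)]. *)
Lemma mk_cvg (f_ : nat -> R -> R[i]) f M : (forall n, cmes (f_ n)) -> cmes f ->
  (forall n x, nrm (f_ n x) <= M) -> (forall x, nrm (f x) <= M) ->
  (forall x, nrm (f_ n x - f x) @[n --> \oo] --> (0 : R)) ->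
  forall h, cL1 h -> nrm (pr h (mk (f_ n)) - pr h (mk f)) @[n --> \oo] --> (0 : R).
Proof.
move=> m_ m b_ b c h ih.
have E : (fun n => nrm (pr h (mk (f_ n)) - pr h (mk f))) =
    fun n => nrm (cint (fun y => f_ n y * h y) - cint (fun y => f y * h y)).
  apply/funext => n; rewrite (pr_mk ih (_ : bdd (f_ n))); last by split=> //; exists M.
  by rewrite (pr_mk ih (_ : bdd f)) //; split=> //; exists M.
rewrite E; apply: (@cdominated_cintegral _ (mR R) R leb (fun n y => f_ n y * h y)
  (fun y => f y * h y) (fun y => M * nrm (h y))).
- by move=> n; apply: cmeasM => //; exact: cint_meas ih.
- by apply: cmeasM => //; exact: cint_meas ih.
- apply: aeW => x.
  have -> : (fun n => nrm (f_ n x * h x - f x * h x)) =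
      fun n => nrm (f_ n x - f x) * nrm (h x).
    by apply/funext => n; rewrite -mulrBl Normc.normcM.
  by rewrite -(mul0r (nrm (h x))); apply: cvgMl.
- by apply: (integrableZl measurableT M (cint_nrm ih)).
- by move=> n x; rewrite Normc.normcM ler_wpM2r ?normc_ge0.
- by move=> x; rewrite Normc.normcM ler_wpM2r ?normc_ge0.
Qed.

Lemma en_le1 n : en n <= 1.
Proof. by rewrite invf_le1// ler1n. Qed.

Lemma Cinfty_sub_C1 : @Cinfty_c R `<=` C1_c.
Proof.
move=> f [s1 s2 sf]; split => //.
- split; first by move=> x; exact: (s1 0 x).
  have : smooth (derive1 (fun x => complex.Re (f x))).
    by move=> n x; have := s1 n.+1 x; rewrite derive1Sn.
  exact: smooth_continuous.
- split; first by move=> x; exact: (s2 0 x).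
  have : smooth (derive1 (fun x => complex.Im (f x))).
    by move=> n x; have := s2 n.+1 x; rewrite derive1Sn.
  exact: smooth_continuous.
Qed.

Lemma closure_sub_closure (M N : set (L * L)) : M `<=` closure N -> closure M `<=` closure N.
Proof.
move=> MN; rewrite [X in _ `<=` X](closure_id _).1; last exact: closed_closure.
exact: closure_subset.
Qed.

Lemma scale_kernel (k : R -> R[i]) n : csmooth k -> csupp 1 k ->
  [/\ csmooth (scale (en n) k), csupp 1 (scale (en n) k) & cL1 (scale (en n) k)].
Proof.
move=> sk k1; have s := scale_csmooth (en n) sk.
have c := scale_csupp (en_gt0 n) (en_le1 n) k1.
by split=> //; exact: ccont_csupp_L1 (csmooth_ccont s) c.
Qed.

(** The mollification takes place in x, where it yields smooth functions whatever the regularity of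
    [tau]. The coefficient [a] stays outside of the convolution: the derivatives [conv (k n) f']
    converge pointwise and are multiplied by [a] afterwards. *)
Lemma X_max_closure_X_min : X_max rho a `<=` closure (X_min rho a).
Proof.
move=> [u v] /X_op_flow => /(_ (@subset_refl _ _))[f Cf [-> ->]].
have [f1 f2 /compactly_supported_csupp[N fN]] := Cf; have [D c'] := C1_cD f1 f2.
have c := cD_cont D; have f'N := csupp_deriv D fN.
set f' := cderive1 f in D c' f'N *.
have bf := ccont_csupp_bdd c fN; have bf' := ccont_csupp_bdd c' f'N.
have [b [sb bN b1]] := @bump_kernel R; have ib := ccont_csupp_L1 (csmooth_ccont sb) bN.
pose k n := scale (en n) b.
have kP n := scale_kernel n sb bN; rewrite -/(k _) in kP.
have ik n : cL1 (k n) by case: (kP n).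
have sf n : csmooth (conv (k n) f) by case: (kP n) => s s1 _; exact: conv_csmooth s s1 bf.
have Nf n : csupp (1 + N) (conv (k n) f) by case: (kP n) => _ s1 _; exact: conv_csupp.
have Nf' n : csupp (1 + N) (conv (k n) f') by case: (kP n) => _ s1 _; exact: conv_csupp.
have Df n : cD (conv (k n) f) (conv (k n) f') by exact: conv_cDr.
have Cn n : Cinfty_c (conv (k n) f).
  have [s1 s2] := csmooth_smooth (sf n).
  by split=> //; exact: csupp_compactly_supported (Nf n).
have cs : continuous sigma := sigma_cont Dsigma.
have nk n : nL1 (k n) = nL1 b by exact: nL1_scale (en_gt0 n) ib.
have [M M0 fM] := bddP bf; have [M' M'0 f'M] := bddP bf'.
have nb0 : 0 <= nL1 b by exact: L1_ge0.
have b_ n x : nrm (conv (k n) f x) <= M * nL1 b.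
  by rewrite -(nk n); exact: conv_bound (ik n) bf.1 fM.
have b'_ n x : nrm (conv (k n) f' x) <= M' * nL1 b.
  by rewrite -(nk n); exact: conv_bound (ik n) bf'.1 f'M.
(* [a] may be unbounded, but all mollified functions live on this interval: the support grows by at
   most 1, the support radius of the kernels. *)
have [A A0 aA] : exists2 A, 0 <= A & forall x, `|x| <= 1 + `|N| -> a x <= A.
  have le0 : - (1 + `|N|) <= 1 + `|N| by have := normr_ge0 N; lra.
  have [c0 _ Hc] := EVT_max le0 (continuous_subspaceT a_cont).
  exists (a c0); first exact/ltW.
  by move=> x; rewrite ler_norml => xN; apply: Hc; rewrite in_itv.
have ba (g : R -> R[i]) K : 0 <= K -> csupp (1 + N) g -> (forall x, nrm (g x) <= K) ->
    forall y, nrm ((a (sigma y))%:C%C * g (sigma y)) <= A * K.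
  move=> K0 gN gK y; rewrite Normc.normcM nrm_real ger0_norm; last exact/ltW.
  have [sy|sy] := ltP (1 + N) `|sigma y|.
    by rewrite gN// Normc.normc0 mulr0 mulr_ge0.
  apply: ler_pM; [exact/ltW|exact: normc_ge0| |exact: gK].
  by apply: aA; apply: le_trans sy _; rewrite lerD2l ler_norm.
have ca : ccont (fun y => (a (sigma y))%:C%C).
  split; last by move=> y; exact: cvg_cst.
  by move=> y; apply: (@continuous_comp _ _ _ sigma a); [exact: cs|exact: a_cont].
apply: (@seq_closure _ (fun n => (mk (fun y => conv (k n) f (sigma y)),
  mk (fun y => (a (sigma y))%:C%C * conv (k n) f' (sigma y))))).
- move=> n; apply/(X_op_flow _ _ Cinfty_sub_C1); exists (conv (k n) f) => //.
  by rewrite (cD_cderive1 (Df n)).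
- move=> h ih /=; apply: (mk_cvg _ _ (M := M * nL1 b + M)) => //.
  + by move=> n; apply/ccont_meas/(ccont_comp _ cs); exact: conv_cont.
  + by apply/ccont_meas/(ccont_comp _ cs).
  + by move=> n x; rewrite -[leLHS]addr0 lerD.
  + by move=> x; rewrite -[leLHS]add0r lerD// mulr_ge0.
  + by move=> x; exact: conv_approx_pt ib b1 bf c en_gt0 en_cvg.
- move=> h ih /=; apply: (mk_cvg _ _ (M := A * (M' * nL1 b + M'))) => //.
  + move=> n; apply/ccont_meas/(ccontM ca)/(ccont_comp _ cs); exact: conv_cont.
  + by apply/ccont_meas/(ccontM ca)/(ccont_comp _ cs).
  + move=> n; apply: ba => //; first by rewrite addr_ge0// mulr_ge0.
    by move=> x; rewrite -[leLHS]addr0 lerD.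
  + apply: ba; first by rewrite addr_ge0// mulr_ge0.
      by move=> x xN; apply: f'N; apply: le_lt_trans xN; rewrite lerDr.
    by move=> x; rewrite -[leLHS]add0r lerD// mulr_ge0.
  + move=> x; have := conv_approx_pt (sigma x) ib b1 bf' c' en_gt0 en_cvg.
    set z := (_%:C)%C => H.
    have -> : (fun n => nrm (z * conv (k n) f' (sigma x) - z * f' (sigma x))) =
        fun n => nrm z * nrm (conv (k n) f' (sigma x) - f' (sigma x)).
      by apply/funext => n; rewrite -mulrBr Normc.normcM.
    by rewrite -(mulr0 (nrm z)); apply: cvgMr.
Qed.

Lemma closure_X_min : closure (X_min rho a) = closure (X_max rho a).
Proof.
apply/seteqP; split; last exact/closure_sub_closure/X_max_closure_X_min.
apply: closure_subset => -[u v] [f Cf fE]; exists f => //.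
exact: Cinfty_sub_C1.
Qed.

(** Dilating the cutoff by n + 1 gives each derivative a factor 1/(n+1). In the product rule every
    term with a derivative of the cutoff therefore disappears in the limit. *)
Lemma cutoff_seq : exists c0 c1 c2 : nat -> R -> R[i], [/\
  forall n, csmooth (c0 n) /\ exists N, csupp N (c0 n),
  forall n, cD (c0 n) (c1 n) /\ cD (c1 n) (c2 n),
  exists M, forall n x, [/\ nrm (c0 n x) <= M, nrm (c1 n x) <= M & nrm (c2 n x) <= M] &
  forall x, [/\ nrm (c0 n x - 1) @[n --> \oo] --> (0 : R),
    nrm (c1 n x) @[n --> \oo] --> (0 : R) & nrm (c2 n x) @[n --> \oo] --> (0 : R)]].
Proof.
have [c [sc c1 c01]] := @cutoff R.
have [c' Dc sc'] := csmooth_deriv sc; have [c'' Dc' sc''] := csmooth_deriv sc'.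
have cc' := csmooth_ccont sc'; have cc'' := csmooth_ccont sc''.
have s1' := csupp_deriv Dc c1; have s1'' := csupp_deriv Dc' s1'.
have [M M0 cM] := bddP (ccont_csupp_bdd (csmooth_ccont sc) c1).
have [M' M'0 c'M] := bddP (ccont_csupp_bdd cc' s1').
have [M'' M''0 c''M] := bddP (ccont_csupp_bdd cc'' s1'').
pose z n : R[i] := (en n)%:C%C.
have nz n : nrm (z n) = en n by rewrite nrm_real ger0_norm// ltW// en_gt0.
exists (fun n x => c (en n * x)), (fun n x => z n * c' (en n * x)),
  (fun n x => z n * (z n * c'' (en n * x))).
have Den n x : is_derive x (1 : R) (fun y : R => en n * y) (en n).
  by apply: is_derive_eq; rewrite /GRing.scale/=; ring.
split.
- move=> n; split.
    have := csmooth_affine (en n) 0 sc.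
    have -> // : (fun x => c (en n * x + 0)) = fun x => c (en n * x).
    by apply/funext => x; rewrite addr0.
  exists (n.+1%:R) => x xn; apply: c1.
  by rewrite normrM gtr0_norm ?en_gt0// mulrC ltr_pdivlMr ?ltr0n// mul1r.
- move=> n; split; first exact: cD_comp Dc (Den n).
  exact: (cDZ (z n) (cD_comp Dc' (Den n))).
- exists (M + M' + M'') => n x; have e0 := ltW (en_gt0 n); have e1 := en_le1 n.
  have H (t K : R) : 0 <= t -> t <= K -> en n * t <= K.
    by move=> t0; apply: le_trans; rewrite ler_piMl.
  split.
  + by apply: le_trans (cM _) _; rewrite -addrA lerDl addr_ge0.
  + rewrite Normc.normcM nz; apply: (H); first exact: normc_ge0.
    by apply: le_trans (c'M _) _; rewrite addrAC lerDr addr_ge0.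
  + rewrite !Normc.normcM nz; apply: (H); first by rewrite mulr_ge0// normc_ge0.
    apply: (H); first exact: normc_ge0.
    by apply: le_trans (c''M _) _; rewrite lerDr addr_ge0.
- move=> x.
  have ex : en n * x @[n --> \oo] --> (0 : R).
    by rewrite -(mul0r x); apply: cvgM; [exact: en_cvg|exact: cvg_cst].
  have enM (K : R) : en n * K @[n --> \oo] --> (0 : R).
    by rewrite -(mul0r K); apply: cvgM; [exact: en_cvg|exact: cvg_cst].
  split.
  + by rewrite -c01; exact: (ccont_seq (csmooth_ccont sc) ex).
  + apply: (@squeeze_cvgr _ _ _ _ (fun=> 0) (fun n => en n * M')).
    * apply: nearW => n; rewrite normc_ge0/= Normc.normcM nz ler_wpM2l//.
      exact/ltW/en_gt0.
    * exact: cvg_cst.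
    * exact: enM.
  + apply: (@squeeze_cvgr _ _ _ _ (fun=> 0) (fun n => en n * M'')).
    * apply: nearW => n; rewrite normc_ge0/= !Normc.normcM nz.
      have e0 := ltW (en_gt0 n).
      apply: ler_wpM2l => //; apply: le_trans (c''M (en n * x)).
      by rewrite ler_piMl ?normc_ge0// en_le1.
    * exact: cvg_cst.
    * exact: enM.
Qed.

(** [XS] and [HS] are cores, consisting of functions smooth in y, for the closed derivative and its
    square. They are contained in the graphs of the maximal operators, and for smooth [a] also in
    those of the minimal ones. *)
Definition XS : set (L * L) := [set p | exists F f, [/\ csmooth F, exists N, csupp N F,
  cD F f & p = (mk F, mk f)]].

Definition HS : set (L * L) := [set p | exists F f1 f2, [/\ csmooth F, exists N, csupp N F,
  cD F f1, cD f1 f2 & p = (mk F, mk f2)]].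

Lemma cutoff_closure F f1 f2 : csmooth F -> cD F f1 -> cD f1 f2 ->
  bdd F -> bdd f1 -> bdd f2 ->
  closure XS (mk F, mk f1) /\ closure HS (mk F, mk f2).
Proof.
move=> sF D1 D2 bF b1 b2.
have [c0 [c1 [c2 [sc Dc [C cC] cl]]]] := cutoff_seq.
have [mF [M FM]] := bF; have [m1 [M1 f1M]] := b1; have [m2 [M2 f2M]] := b2.
have s1 := csmooth_cD sF D1; have s2 := csmooth_cD s1 D2.
have sc0 n : csmooth (c0 n) by case: (sc n).
have sc1 n : csmooth (c1 n) by case: (Dc n) => d _; exact: csmooth_cD (sc0 n) d.
have sc2 n : csmooth (c2 n) by case: (Dc n) => _ d; exact: csmooth_cD (sc1 n) d.
have mc0 n := ccont_meas (csmooth_ccont (sc0 n)).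
have mc1 n := ccont_meas (csmooth_ccont (sc1 n)).
have mc2 n := ccont_meas (csmooth_ccont (sc2 n)).
have C0 : 0 <= C by have [H _ _] := cC 0%N 0; apply: le_trans (normc_ge0 _) H.
have bM (c g : R -> R[i]) K : (forall x, nrm (c x) <= C) -> (forall x, nrm (g x) <= K) ->
    forall x, nrm (c x * g x) <= C * K.
  move=> Hc Hg x; rewrite Normc.normcM; apply: ler_pM => //; exact: normc_ge0.
have cB n x : [/\ nrm (c0 n x) <= C, nrm (c1 n x) <= C & nrm (c2 n x) <= C] by exact: cC.
have B0 (g : R -> R[i]) K n : (forall x, nrm (g x) <= K) -> forall x, nrm (c0 n x * g x) <= C * K.
  by move=> Hg; apply: bM => // x; case: (cB n x).
have B1 (g : R -> R[i]) K n : (forall x, nrm (g x) <= K) -> forall x, nrm (c1 n x * g x) <= C * K.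
  by move=> Hg; apply: bM => // x; case: (cB n x).
have B2 (g : R -> R[i]) K n : (forall x, nrm (g x) <= K) -> forall x, nrm (c2 n x * g x) <= C * K.
  by move=> Hg; apply: bM => // x; case: (cB n x).
have l0 (g : R -> R[i]) x : nrm (c0 n x * g x - g x) @[n --> \oo] --> (0 : R).
  have -> : (fun n => nrm (c0 n x * g x - g x)) = fun n => nrm (c0 n x - 1) * nrm (g x).
    by apply/funext => n; rewrite -Normc.normcM mulrBl mul1r.
  by rewrite -(mul0r (nrm (g x))); apply: cvgMl; case: (cl x).
have l1 (g : R -> R[i]) x : nrm (c1 n x * g x) @[n --> \oo] --> (0 : R).
  have -> : (fun n => nrm (c1 n x * g x)) = fun n => nrm (c1 n x) * nrm (g x).
    by apply/funext => n; rewrite -Normc.normcM.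
  by rewrite -(mul0r (nrm (g x))); apply: cvgMl; case: (cl x).
have l2 (g : R -> R[i]) x : nrm (c2 n x * g x) @[n --> \oo] --> (0 : R).
  have -> : (fun n => nrm (c2 n x * g x)) = fun n => nrm (c2 n x) * nrm (g x).
    by apply/funext => n; rewrite -Normc.normcM.
  by rewrite -(mul0r (nrm (g x))); apply: cvgMl; case: (cl x).
have K0 : 0 <= M by apply: le_trans (normc_ge0 _) (FM 0).
have K1 : 0 <= M1 by apply: le_trans (normc_ge0 _) (f1M 0).
have K2 : 0 <= M2 by apply: le_trans (normc_ge0 _) (f2M 0).
have CK0 := mulr_ge0 C0 K0; have CK1 := mulr_ge0 C0 K1; have CK2 := mulr_ge0 C0 K2.
have d1 n : cD (fun x => c0 n x * F x) (fun x => c1 n x * F x + c0 n x * f1 x).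
  by case: (Dc n) => d _; exact: cDM d D1.
have d2 n : cD (fun x => c1 n x * F x + c0 n x * f1 x)
    (fun x => (c2 n x * F x + c1 n x * f1 x) + (c1 n x * f1 x + c0 n x * f2 x)).
  by case: (Dc n) => d d'; apply: cDD; apply: cDM.
have s0 n : csmooth (fun x => c0 n x * F x) by exact: csmoothM.
have N0 n : exists N, csupp N (fun x => c0 n x * F x).
  by have [_ [N cN]] := sc n; exists N => x /cN ->; rewrite mul0r.
have cvF : forall h, cL1 h -> nrm (pr h (mk (fun x => c0 n x * F x)) - pr h (mk F))
    @[n --> \oo] --> (0 : R).
  apply: (mk_cvg _ _ (M := C * M + M)) => //.
  + by move=> n; exact: cmeasM.
  + by move=> n x; apply: le_trans (B0 _ _ n FM x) _; rewrite lerDl.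
  + by move=> x; apply: le_trans (FM x) _; rewrite lerDr.
split.
  apply: (@seq_closure XS (fun n => (mk (fun x => c0 n x * F x),
    mk (fun x => c1 n x * F x + c0 n x * f1 x)))); [|exact: cvF|].
    move=> n; exists (fun x => c0 n x * F x), (fun x => c1 n x * F x + c0 n x * f1 x).
    by split; [exact: s0|exact: N0|exact: d1|].
  apply: (mk_cvg _ _ (M := C * M + C * M1 + M1)) => //.
  + by move=> n; apply: cmeasD; exact: cmeasM.
  + move=> n x; apply: le_trans (nrmD _ _) _.
    have := B1 _ _ n FM x; have := B0 _ _ n f1M x; lra.
  + by move=> x; apply: le_trans (f1M x) _; rewrite lerDr addr_ge0.
  + move=> x; apply: (@squeeze_cvgr _ _ _ _ (fun=> 0) (fun n =>
      nrm (c1 n x * F x) + nrm (c0 n x * f1 x - f1 x))).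
    * by apply: nearW => n; rewrite normc_ge0/= -addrA; exact: nrmD.
    * exact: cvg_cst.
    * by rewrite -[X in _ --> X](addr0 (0 : R)); apply: cvgD; [exact: l1|exact: l0].
apply: (@seq_closure HS (fun n => (mk (fun x => c0 n x * F x),
  mk (fun x => (c2 n x * F x + c1 n x * f1 x) + (c1 n x * f1 x + c0 n x * f2 x))))); [|exact: cvF|].
  move=> n; exists (fun x => c0 n x * F x), (fun x => c1 n x * F x + c0 n x * f1 x).
  by eexists; split; [exact: s0|exact: N0|exact: d1|exact: d2|].
apply: (mk_cvg _ _ (M := C * M + C * M1 + C * M1 + C * M2 + M2)) => //.
+ by move=> n; apply: cmeasD; apply: cmeasD; exact: cmeasM.
+ move=> n x; apply: le_trans (nrmD _ _) _.
  have := nrmD (c2 n x * F x) (c1 n x * f1 x); have := nrmD (c1 n x * f1 x) (c0 n x * f2 x).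
  have := B2 _ _ n FM x; have := B1 _ _ n f1M x; have := B0 _ _ n f2M x; lra.
+ by move=> x; apply: le_trans (f2M x) _; rewrite lerDr !addr_ge0.
+ move=> x; apply: (@squeeze_cvgr _ _ _ _ (fun=> 0) (fun n =>
    (nrm (c2 n x * F x) + nrm (c1 n x * f1 x)) +
    (nrm (c1 n x * f1 x) + nrm (c0 n x * f2 x - f2 x)))).
  * apply: nearW => n; rewrite normc_ge0/=.
    have := nrmD (c2 n x * F x + c1 n x * f1 x) (c1 n x * f1 x + (c0 n x * f2 x - f2 x)).
    have := nrmD (c2 n x * F x) (c1 n x * f1 x).
    have := nrmD (c1 n x * f1 x) (c0 n x * f2 x - f2 x).
    by rewrite !addrA; lra.
  * exact: cvg_cst.
  * rewrite -[X in _ --> X](addr0 (0 : R)); apply: cvgD.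
      by rewrite -[X in _ --> X](addr0 (0 : R)); apply: cvgD; [exact: l2|exact: l1].
    by rewrite -[X in _ --> X](addr0 (0 : R)); apply: cvgD; [exact: l1|exact: l0].
Qed.

Lemma Cv_smooth_closure k k1 k2 N u : csmooth k -> csupp N k -> cD k k1 -> cD k1 k2 ->
  closure XS (Cv k u, Cv k1 u) /\ closure HS (Cv k u, Cv k2 u).
Proof.
move=> sk kN D1 D2; have bu := Linf_rep_bdd u.
have s1 := csmooth_cD sk D1; have s2 := csmooth_cD s1 D2.
have N1 := csupp_deriv D1 kN; have N2 := csupp_deriv D2 N1.
have ik := ccont_csupp_L1 (csmooth_ccont sk) kN.
have i1 := ccont_csupp_L1 (csmooth_ccont s1) N1.
have i2 := ccont_csupp_L1 (csmooth_ccont s2) N2.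
apply: cutoff_closure.
- exact: conv_csmooth sk kN bu.
- exact: (conv_cD ik i1 D1 (csmooth_ccont s1) bu).
- exact: (conv_cD i1 i2 D2 (csmooth_ccont s2) bu).
- exact: conv_bdd.
- exact: conv_bdd.
- exact: conv_bdd.
Qed.

Lemma Xt_sub_XS : Xt `<=` closure XS.
Proof.
move=> [u v] X; have [b [sb bN b1]] := @bump_kernel R.
have ib := ccont_csupp_L1 (csmooth_ccont sb) bN.
(* Mollification and cutoff are two successive limits. The mollified pairs already belong to
   [closure XS], which is closed, so no diagonal sequence is needed. *)
rewrite (closure_id (closure XS)).1; last exact: closed_closure.
apply: (@seq_closure _ (fun n => (Cv (scale (en n) b) u, Cv (scale (en n) b) v))).
- move=> n; have [sk kN ik] := scale_kernel n sb bN.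
  have [k1 D1 s1] := csmooth_deriv sk; have [k2 D2 s2] := csmooth_deriv s1.
  have c1 := csmooth_ccont s1; have i1 := ccont_csupp_L1 c1 (csupp_deriv D1 kN).
  have [H _] := Cv_smooth_closure u sk kN D1 D2.
  by rewrite -(Xt_Cv_swap ik i1 D1 c1 X).
- move=> h ih /=; have := Cv_approx u ib b1 ih en_gt0 en_cvg; exact.
- move=> h ih /=; have := Cv_approx v ib b1 ih en_gt0 en_cvg; exact.
Qed.

Lemma Xt2_sub_HS : op_sqr Xt `<=` closure HS.
Proof.
move=> [u v] [w /= X1 X2]; have [b [sb bN b1]] := @bump_kernel R.
have ib := ccont_csupp_L1 (csmooth_ccont sb) bN.
rewrite (closure_id (closure HS)).1; last exact: closed_closure.
apply: (@seq_closure _ (fun n => (Cv (scale (en n) b) u, Cv (scale (en n) b) v))).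
- move=> n; have [sk kN ik] := scale_kernel n sb bN.
  have [k1 D1 s1] := csmooth_deriv sk; have [k2 D2 s2] := csmooth_deriv s1.
  have c1 := csmooth_ccont s1; have N1 := csupp_deriv D1 kN.
  have i1 := ccont_csupp_L1 c1 N1.
  have c2 := csmooth_ccont s2; have i2 := ccont_csupp_L1 c2 (csupp_deriv D2 N1).
  have [_ H] := Cv_smooth_closure u sk kN D1 D2.
  rewrite -(Xt_Cv_swap ik i1 D1 c1 X2).
  by rewrite -(Xt_Cv_swap i1 i2 D2 c2 X1).
- move=> h ih /=; have := Cv_approx u ib b1 ih en_gt0 en_cvg; exact.
- move=> h ih /=; have := Cv_approx v ib b1 ih en_gt0 en_cvg; exact.
Qed.

Lemma XS_sub_X_max : XS `<=` X_max rho a.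
Proof.
move=> _ [F [f [sF sN D ->]]]; apply/X_maxP; exists F, f; split=> //; split=> //.
exact/csmooth_ccont/(csmooth_cD sF D).
Qed.

Lemma HS_sub_X_max2 : HS `<=` op_sqr (X_max rho a).
Proof.
move=> _ [F [f1 [f2 [sF [N sN] D1 D2 ->]]]]; have s1 := csmooth_cD sF D1.
exists (mk f1); apply/X_maxP.
  by exists F, f1; split=> //; split=> //; [exact: csmooth_ccont|exists N].
exists f1, f2; split=> //; split=> //.
  exact/csmooth_ccont/(csmooth_cD s1 D2).
by exists N; exact: csupp_deriv D1 sN.
Qed.

(** * The closure of X and the closedness of its square *)

Lemma closure_X_max : closure (X_max rho a) = Xt.
Proof.
apply/seteqP; split; first exact/Xt_closure/X_max_Xt.
by apply: subset_trans Xt_sub_XS _; apply: closure_subset; exact: XS_sub_X_max.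
Qed.

(** The weight 1 - q on [0, 1], reflected so that its convolution with [f] integrates (1 - q) f(y +
    q). It vanishes at q = 1, which leaves only the boundary term at [y]. *)
Let kib (r : R) : R[i] := kavg 1 r * (1 + r)%:C%C.

Let kib_L1 : cL1 kib.
Proof.
apply: (cint_dom _ (cint_nrm (kavg_L1 (1 : R)))).
  apply: cmeasM; first exact: cint_meas (kavg_L1 1).
  by apply: cmeas_real; apply: measurable_funD.
move=> r; rewrite Normc.normcM; have [r1|r1] := leP `|1 + r| 1.
  by rewrite nrm_real ler_piMr// normc_ge0.
rewrite {1}/kavg /cind indicE memNset ?Normc.normc0 ?mul0r ?normc_ge0//.
rewrite /= in_itv/= => /andP[r0 r1']; move: r1; apply/negP; rewrite -leNgt ler_norml.
by apply/andP; split; lra.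
Qed.

Let Bi := Cv kib.

(* integration by parts against [1 - q] on [0, 1] *)
Lemma Xt_ibp u v : Xt (u, v) -> Av 1 u = u + Bi v.
Proof.
have pB : preadj (fun v => Bi v) by exact: Cv_preadj kib_L1.
have pA : preadj (fun u => Av 1 u - u) by exact: preadjB (Av_preadj 1) preadj_id.
(* Both sides have preadjoints, so it suffices to integrate by parts for C1 test functions. *)
rewrite -closure_X_max => /(closure_eq pA pB) /= H.
apply: subr_eqD; apply: H => -[_ _] /X_maxP[F [f [Cf -> ->]]] /=.
have [bF bf] := C1test_bdd Cf; case: Cf => D c _.
rewrite (Av_mk 1 bF) (mkB (avg_bdd 1 bF) bF) [RHS](Cv_mk kib_L1 bf).
congr mk; apply/funext => y.
have mfy : cmes (fun s => f (y - s)) := cmes_refl y bf.1.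
rewrite (convE y (cint_meas kib_L1) bf.1) -[RHS](cint_refl 0); last first.
  by apply: cmeasM => //; exact: cint_meas kib_L1.
(* [G] vanishes at 1 and equals [F y] at 0; its derivative is [g]. *)
pose G q := (1 - q)%:C%C * F (y + q).
pose g q := - F (y + q) + (1 - q)%:C%C * f (y + q).
have DG : cD G g.
  have D1 : cD (fun q : R => (1 - q)%:C%C) (fun=> (- 1)%:C%C).
    by apply: cD_real => x; exact: is_derive_subr.
  have D2 : cD (fun q => F (y + q)) (fun q => f (y + q)).
    have := cD_shift y D; have -> : (fun x => F (x + y)) = fun q => F (y + q).
      by apply/funext => x; rewrite addrC.
    by have -> : (fun x => f (x + y)) = fun q => f (y + q); first by apply/funext => x; rewrite addrC.
  have := cDM D1 D2; have -> // : (fun x => (-1)%:C%C * F (y + x) + (1 - x)%:C%C * f (y + x)) = g.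
  by apply/funext => x; rewrite /g rmorphN1 mulN1r.
have cy : continuous (fun q : R => y + q).
  by apply: is_derive_continuous => x; exact: is_derive_addl.
have cg : ccont g.
  have -> : g = fun q => (-1) * F (y + q) + (1 - q)%:C%C * f (y + q).
    by apply/funext => q; rewrite mulN1r.
  apply: ccontD; apply: ccontM; [exact: ccont_cst|exact: (ccont_comp (cD_cont D) cy)| |
    exact: (ccont_comp c cy)].
  apply: (cD_cont (f := fun=> (- 1)%:C%C)).
  by apply: cD_real => x; exact: is_derive_subr.
have := cFTC 0 ltr01 DG cg; rewrite /G add0r subrr mul0r subr0 addr0 mul1r sub0r => E.
have iF : cL1 (fun q => cind 1 q * F (y + q)).
  apply: cL1_bddr (cind_L1 1).
  have := bdd_shift y bF; have -> // : (fun x => F (x + y)) = fun q => F (y + q).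
  by apply/funext => x; rewrite addrC.
have ik : cL1 (fun q => kib (- q) * f (y + q)).
  apply: cL1_bddr (cL1_opp kib_L1).
  have := bdd_shift y bf; have -> // : (fun x => f (x + y)) = fun q => f (y + q).
  by apply/funext => x; rewrite addrC.
have iE : cL1 (fun q => cind 1 q * g (0 + q)).
  have -> : (fun q => cind 1 q * g (0 + q)) =
      fun q => - (cind 1 q * F (y + q)) + kib (- q) * f (y + q).
    apply/funext => q; rewrite add0r /g /kib /kavg opprK mulrDr mulrN mulrA.
    by [].
  by apply: cintD ik; exact: cintN.
rewrite /avg -E -(cintegralD iF iE); apply: eq_cintegral => q; rewrite !sub0r /kib /kavg !opprK add0r /g.
by rewrite mulrDr mulrN addrA subrr add0r mulrA.
Qed.

(** If [w] is the middle term, then [Tr 1 u - u] is [Av 1 w] by the first membership and [w + Bi v]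
    by integration by parts in the second; hence this formula for [w]. *)
Let W u v := Tr 1 u - u - Bi v.

Lemma Xt_sqrP u v : op_sqr Xt (u, v) <-> Xt (u, W u v) /\ Xt (W u v, v).
Proof.
split=> [[w /= X1 X2]|[X1 X2]]; last by exists (W u v).
suff -> : W u v = w by [].
by apply: subr_eqK; rewrite (X1 1 ltr01)/= (Xt_ibp X2).
Qed.

(** With [W] as the middle term, membership amounts to two families of equations in [u] and [v]
    alone. Each is rearranged with all terms in [u] on one side and all terms in [v] on the other,
    the form that [closure_eq] carries over. *)
Lemma op_sqr_Xt_closure M : M `<=` op_sqr Xt -> closure M `<=` op_sqr Xt.
Proof.
move=> MX [u v] clp; apply/Xt_sqrP.
have pB : preadj Bi by exact: Cv_preadj kib_L1.
pose D1 := fun u : L => Tr 1 u - u.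
have pD : preadj D1 by exact: preadjB (Tr_preadj 1) preadj_id.
split=> s s0 /=.
- have pA : preadj (fun u => Tr s u - u - Av s (D1 u)).
    apply: preadjB; first exact: preadjB (Tr_preadj s) preadj_id.
    exact: preadj_comp (Av_preadj s) pD.
  have pC : preadj (fun v => - Av s (Bi v)).
    by apply: preadjN; exact: preadj_comp (Av_preadj s) pB.
  have /= E : forall p, M p -> Tr s p.1 - p.1 - Av s (D1 p.1) = - Av s (Bi p.2).
    move=> [u' v'] /MX /Xt_sqrP[/(_ s s0)/= + _] => ->.
    by rewrite /W -/(D1 u') (preadjB0 _ _ (Av_preadj s)); exact: subBBr.
  have /= Q := closure_eq pA pC E clp; rewrite /W -/(D1 u) (preadjB0 _ _ (Av_preadj s)).
  exact: (subr_eq_opp Q).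
- have pA : preadj (fun u => Tr s (D1 u) - D1 u).
    exact: preadjB (preadj_comp (Tr_preadj s) pD) pD.
  pose D2 := fun v => Tr s (Bi v) - Bi v.
  have pC : preadj (fun v => D2 v - (- Av s v)).
    apply: preadjB; first exact: preadjB (preadj_comp (Tr_preadj s) pB) pB.
    exact: preadjN (Av_preadj s).
  have WE u' v' : Tr s (W u' v') - W u' v' = (Tr s (D1 u') - D1 u') - D2 v'.
    by rewrite /W -/(D1 u') (preadjB0 _ _ (Tr_preadj s)) /D2; exact: subBB.
  have /= E : forall p, M p -> Tr s (D1 p.1) - D1 p.1 = D2 p.2 - (- Av s p.2).
    by move=> [u' v'] /MX /Xt_sqrP[_ /(_ s s0)/=]; rewrite WE; exact: subr_eq_subN.
  have /= Q := closure_eq pA pC E clp; rewrite WE; exact: (subN_subr_eq Q).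
Qed.

Lemma closure_op_opp (M : set (L * L)) : closure (op_opp M) = op_opp (closure M).
Proof.
have opp_cont (p : L * L) : (fun q : L * L => (q.1, - q.2)) @ p --> (p.1, - p.2).
  move=> B [[B1 B2] [/= n1 n2] sub]; exists (B1, (fun v => - v) @^-1` B2).
    by split => //=; exact: (preadj_cont (preadjN preadj_id)).
  by move=> [x y] [/= x1 y2]; apply: sub.
apply/seteqP; split => -[u v] clM B nB.
  have [[u' v'] [M' B']] := clM _ (opp_cont (u, v) _ nB).
  by exists (u', - v').
have nB' : nbhs (u, - - v) B by rewrite opprK.
have [[u' v'] [M' B']] := clM _ (opp_cont (u, - v) _ nB').
by exists (u', - v'); split => //; rewrite /op_opp/= opprK.
Qed.

Lemma op_sqr_mono (M N : set (L * L)) : M `<=` N -> op_sqr M `<=` op_sqr N.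
Proof. by move=> MN p [w M1 M2]; exists w; apply: MN. Qed.

Lemma closure_sqr_X_max : closure (op_sqr (X_max rho a)) = op_sqr Xt.
Proof.
apply/seteqP; split; first exact/op_sqr_Xt_closure/op_sqr_mono/X_max_Xt.
by apply: subset_trans Xt2_sub_HS _; apply: closure_subset; exact: HS_sub_X_max2.
Qed.

Lemma X_min_sub_X_max : X_min rho a `<=` X_max rho a.
Proof. by move=> p [f /Cinfty_sub_C1 Cf fE]; exists f. Qed.

Section smooth_coefficient.
Hypothesis a_smooth : smooth a.

(** For smooth [a] also tau' = 1/a is smooth, and functions smooth in y are smooth in x. Applied to
    F and then to its derivative, this places [HS] inside the square of the minimal operator. *)
Lemma smooth_X_min F f : csmooth F -> (exists N, csupp N F) -> cD F f ->
  X_min rho a (mk F, mk f).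
Proof.
move=> sF [N sN] D; apply/(X_op_flow _ _ Cinfty_sub_C1).
have D' : cD (fun x => F (tau x)) (fun x => (a x)^-1%:C%C * f (tau x)) by exact: cD_comp.
exists (fun x => F (tau x)); last first.
  rewrite (cD_cderive1 D'); split; congr mk; apply/funext => y; rewrite sigmaK//.
  by rewrite mulrA -rmorphM/= mulfV ?gt_eqF// mul1r.
have sFt : csmooth (fun x => F (tau x)).
  apply: (csmooth_comp Dtau) => //; apply: csmooth_inv => //; exact: smooth_csmooth.
have [s1 s2] := csmooth_smooth sFt; split=> //.
have [M sM] := csupp_unflow sN; exact: csupp_compactly_supported sM.
Qed.

Lemma closure_sqr_X_min : closure (op_sqr (X_min rho a)) = op_sqr Xt.
Proof.
apply/seteqP; split.
  apply/op_sqr_Xt_closure/op_sqr_mono.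
  exact: subset_trans X_min_sub_X_max X_max_Xt.
apply: subset_trans Xt2_sub_HS _; apply: closure_subset.
move=> _ [F [f1 [f2 [sF [N sN] D1 D2 ->]]]]; have s1 := csmooth_cD sF D1.
exists (mk f1); first by apply: smooth_X_min => //; exists N.
by apply: smooth_X_min => //; exists N; exact: csupp_deriv D1 sN.
Qed.

End smooth_coefficient.

(** * The heat semigroup and its generator *)

Lemma CvDl k l u : cL1 k -> cL1 l -> Cv (fun x => k x + l x) u = Cv k u + Cv l u.
Proof.
move=> ik il; have bu := Linf_rep_bdd u.
rewrite [RHS](mkD (conv_bdd ik bu) (conv_bdd il bu)); congr mk; apply/funext => y.
exact: convDl.
Qed.

Lemma Cv_norm k u : cL1 k -> Linf_norm (Cv k u) <= nL1 k * Linf_norm u.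
Proof.
move=> ik; apply: Linf_norm_le; first by rewrite mulr_ge0 ?L1_ge0 ?Linf_norm_ge0.
apply: aeS (CvE u ik) => y ->; rewrite mulrC.
exact: conv_bound ik (Linf_rep_bdd u).1 (Linf_rep_le u).
Qed.

Lemma Cv_bounded k : cL1 k -> bounded_op (Cv k).
Proof.
move=> ik; split; first exact: preadj_linear (Cv_preadj ik).
by exists (nL1 k) => u; exact: Cv_norm.
Qed.

Lemma Cv_ge0 k u : cL1 k -> (forall x, exists2 r : R, 0 <= r & k x = r%:C%C) ->
  Linf_nonneg u -> Linf_nonneg (Cv k u).
Proof.
move=> ik k0 /Linf_nonnegE u0; apply/Linf_nonnegE.
apply: aeS (CvE u ik) => y ->; have [mu' _] := Linf_rep_bdd u.
(* [U u] is nonnegative only almost everywhere; [f] is so everywhere and has the same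
   convolution. *)
pose f (x : R) := `|complex.Re (U u x)|%:C%C.
have mf : cmes f by apply: cmeas_real; apply: measurableT_comp => //; exact: mu'.1.
have Uf : \forall x \ae (@lebesgue_measure R), U u x = f x.
  apply: aeS u0 => x; rewrite /f lecE/= => /andP[/eqP I0 R0].
  by apply: complex_ext; rewrite /= ?ger0_norm.
rewrite (conv_ae (cint_meas ik) mu' mf Uf) /conv lecE; apply/andP; split.
  apply/eqP; rewrite /= -[RHS](_ : (\int[leb]_x (0 : R))%R = 0); last first.
    by rewrite /Rintegral integral_cst//= mul0e.
  apply: eq_Rintegral => x _; have [r r0 ->] := k0 (y - x).
  by rewrite /= mulr0 mul0r addr0.
apply: Rintegral_ge0 => x _; have [r r0 ->] := k0 (y - x).
by rewrite /= mulr0 subr0 mulr_ge0.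
Qed.

Lemma weakstar_unique (F : set_system L) (u v : L) : ProperFilter F ->
  F --> u -> F --> v -> u = v.
Proof.
move=> PF Fu Fv; apply: pr_inj => h ih; have FF : Filter F by exact: _.
have /(@cvg_nrmP _ _ _ _ (pr h)) cu := pr_cvg FF Fu ih.
have /(@cvg_nrmP _ _ _ _ (pr h)) cv := pr_cvg FF Fv ih.
exact: (cvg_unique _ cu cv).
Qed.

Lemma cvg_at_right_pr (g : R -> L) u :
  (forall h, cL1 h -> nrm (pr h (g t) - pr h u) @[t --> 0^'+] --> (0 : R)) ->
  g t @[t --> 0^'+] --> u.
Proof. by move=> H; apply/weakstar_cvgP => h /H. Qed.

Let S t := Cv (heat t%:C%C).

Let tC t : 0 < t -> 0 < complex.Re (t%:C%C : R[i]). Proof. by []. Qed.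

Lemma heat_quad z : 0 < complex.Re z -> exists K r, [/\ 0 <= K, 0 < r &
  forall eta, nrm eta < r -> forall u,
  Linf_norm (Cv (heat (z + eta)) u - Cv (heat z) u - eta *: Cv (heat2 z) u) <=
    K * nrm eta ^+ 2 * Linf_norm u].
Proof.
move=> z0; have [_ _ H] := @heat_hol R; have [K [r [K0 r0 Hr]]] := H z z0.
exists K, r; split=> // eta /Hr[z'0 He] u.
have [[i1 i2] i3] := (heat_L1 z'0, heat_L1 z0, heat2_L1 z0).
have E : Cv (fun y => heat (z + eta) y - heat z y - eta * heat2 z y) u =
    Cv (heat (z + eta)) u - Cv (heat z) u - eta *: Cv (heat2 z) u.
  have -> : (fun y => heat (z + eta) y - heat z y - eta * heat2 z y) =
      fun y => (heat (z + eta) y + (-1) * heat z y) + - eta * heat2 z y.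
    by apply/funext => y; rewrite mulN1r mulNr.
  rewrite (CvDl _ (cintD i1 (cintZ (-1) i2)) (cintZ (- eta) i3)).
  rewrite (CvDl _ i1 (cintZ (-1) i2)) (CvZl _ _ i2) (CvZl _ _ i3).
  by rewrite scaleN1r scaleNr.
rewrite -E; apply: le_trans (Cv_norm u (cintB (cintB i1 i2) (cintZ eta i3))) _.
by rewrite ler_wpM2r ?Linf_norm_ge0.
Qed.

Lemma Linf_scaleV_sub (c : R[i]) (x y d : L) : c != 0 ->
  c^-1 *: (x - y) - d = c^-1 *: (x - y - c *: d).
Proof.
by move=> c0; rewrite [RHS]scalerBr scalerA mulVf// scale1r.
Qed.

Lemma Linf_normZ c (u : L) : Linf_norm (c *: u) <= nrm c * Linf_norm u.
Proof.
apply: Linf_norm_le; first by rewrite mulr_ge0 ?normc_ge0 ?Linf_norm_ge0.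
apply: aeS (Linf_repZ c u) => y ->; rewrite Normc.normcM ler_wpM2l ?normc_ge0//.
exact: Linf_rep_le.
Qed.

Lemma heat_differentiable z : 0 < complex.Re z ->
  op_differentiable (fun z => Cv (heat z)) z.
Proof.
move=> z0; exists (Cv (heat2 z)); first exact/Cv_bounded/heat2_L1.
move=> e e0; have [K [r [K0 r0 H]]] := heat_quad z0.
exists (Num.min r (e / (K + 1))).
  by rewrite lt_min r0 divr_gt0// ltr_wpDl.
move=> w /andP[w1]; rewrite lt_min => /andP[w2 w3] u.
set eta := w - z in w1 w2 w3 *; have wE : w = z + eta by rewrite /eta [RHS]addrC subrK.
rewrite wE.
have eta0 : eta != 0 by rewrite -nrm_gt0.
rewrite (Linf_scaleV_sub _ _ _ eta0); apply: le_trans (Linf_normZ _ _) _.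
rewrite Normc.normcV mulrC ler_pdivrMr// mulrAC; apply: le_trans (H _ w2 u) _.
rewrite ler_wpM2r ?Linf_norm_ge0// expr2 mulrA ler_wpM2r ?normc_ge0//.
by move: w3; rewrite ltr_pdivlMr ?ltr_wpDl//; have := normc_ge0 eta; nra.
Qed.

Lemma pr_heat_quad h t u d : cL1 h -> 0 < t -> pr h (Cv (heat2 t%:C%C) u) = d ->
  exists K r, [/\ 0 <= K, 0 < r &
  forall s : R, `|s| < r -> nrm (pr h (S (t + s) u) - pr h (S t u) -
    s%:C%C * d) <= K * s ^+ 2].
Proof.
move=> ih t0 <-; have [K [r [K0 r0 H]]] := heat_quad (tC t0).
exists (K * Linf_norm u * nL1 h), r; split=> //.
  by rewrite !mulr_ge0 ?Linf_norm_ge0 ?L1_ge0.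
move=> s sr; have /H /(_ u) : nrm s%:C%C < r by rewrite nrm_real.
rewrite nrm_real -rmorphD/= -/(S _) -/(S _) => Hs.
rewrite -(prZ _ _ ih) -!(prB _ _ ih).
apply: le_trans (nrm_pr _ ih) _; rewrite mulrAC ler_wpM2r ?L1_ge0//.
by apply: le_trans Hs _; rewrite -normrX ger0_norm ?sqr_ge0// mulrAC.
Qed.

Lemma heat_cvg_gt0 t u : 0 < t -> {for t, continuous (S^~ u)}.
Proof.
move=> t0; have FF : Filter ((S^~ u) @ nbhs t) by exact: fmap_filter.
apply/(weakstar_cvgP (S t u) FF) => h ih.
pose d := pr h (Cv (heat2 t%:C%C) u).
have [K [r [K0 r0 H]]] := pr_heat_quad ih t0 (erefl d).
have H' s : `|s - t| < r -> nrm (pr h (S s u) - pr h (S t u)) <=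
    (K * r + nrm d) * `|s - t|.
  move=> sr; have := H _ sr; rewrite [t + _]addrC subrK => Hs.
  have -> : pr h (S s u) - pr h (S t u) =
    (pr h (S s u) - pr h (S t u) - (s - t)%:C%C * d) + (s - t)%:C%C * d by rewrite subrK.
  apply: le_trans (nrmD _ _) _; rewrite Normc.normcM nrm_real mulrDl [nrm d * _]mulrC lerD2r.
  apply: le_trans Hs _; rewrite -[_ ^+ 2]ger0_norm ?sqr_ge0// normrX expr2 mulrA.
  by rewrite ler_wpM2r// ler_wpM2l// ltW.
change (nrm (pr h (S s u) - pr h (S t u)) @[s --> t] --> (0 : R)).
apply: (@squeeze_cvgr _ _ _ _ (fun=> 0) (fun s => (K * r + nrm d) * `|s - t|)).
- near=> s; rewrite normc_ge0/=; apply: H'; near: s.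
  by have := @nbhsx_ballx R R^o t r r0; apply: filterS => s; rewrite /ball/= distrC.
- exact: cvg_cst.
- rewrite -[X in _ --> X](mulr0 (K * r + nrm d)); apply: cvgMr.
  have c : `|s - t| @[s --> t] --> `|t - t|.
    by apply: (@cvg_norm R R^o); apply: cvgB; [exact: cvg_id|exact: cvg_cst].
  by rewrite subrr normr0 in c.
Unshelve. all: by end_near. Qed.

Lemma heat_cvg0 u : S t u @[t --> 0^'+] --> u.
Proof.
apply: cvg_at_right_pr => h ih.
apply/cvg_at_rightP => s [s0 cs].
have e0 n : 0 < Num.sqrt (s n) by rewrite sqrtr_gt0.
have ce : Num.sqrt (s n) @[n --> \oo] --> (0 : R).
  by rewrite -(sqrtr0 R); exact: (cvg_comp _ _ cs (@sqrt_continuous R 0)).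
have i1 : cL1 (heat (1 : R[i])) by apply: heat_L1; exact: ltr01.
have c1 : cint (heat (1 : R[i])) = 1 by apply: heat_cint; exact: ltr01.
have E n : nrm (pr h (Cv (scale (Num.sqrt (s n)) (heat 1)) u) - pr h u) =
    nrm (pr h (S (s n) u) - pr h u) by rewrite (heat_scale (s0 n)).
have C := Cv_approx u i1 c1 ih e0 ce.
exact: (@eq_ind _ _ (fun f : nat -> R => f @ \oo --> (0 : R)) C _ (funext E)).
Qed.

(** The smoothing property: both derivatives fall on the kernel, so nothing is asked of [u]. *)
Lemma Xt2_heat t u : 0 < t -> op_sqr Xt (S t u, Cv (heat2 t%:C%C) u).
Proof.
move=> /tC t0; exists (Cv (heat1 t%:C%C) u) => /=.
  exact: Xt_Cv_deriv (heat_L1 t0) (heat1_L1 t0) (heat_cD t0) (heat1_ccont t0).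
exact: Xt_Cv_deriv (heat1_L1 t0) (heat2_L1 t0) (heat1_cD t0) (heat2_ccont t0).
Qed.

(** Both derivatives move from the kernel to [u], one for each membership in [Xt]: on its domain the
    generator commutes with the semigroup. *)
Lemma Xt2_heat_swap t u v : 0 < t -> op_sqr Xt (u, v) -> Cv (heat2 t%:C%C) u = S t v.
Proof.
move=> /tC t0 [w /= X1 X2].
have -> := Xt_Cv_swap (heat1_L1 t0) (heat2_L1 t0) (heat1_cD t0) (heat2_ccont t0) X1.
exact: Xt_Cv_swap (heat_L1 t0) (heat1_L1 t0) (heat_cD t0) (heat1_ccont t0) X2.
Qed.

Let pr_heat_cvg0 h u e : cL1 h -> 0 < e -> exists2 d : R, 0 < d &
  forall s : R, 0 < s -> s < d -> nrm (pr h (S s u) - pr h u) < e.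
Proof.
move=> ih e0.
have Ft : Filter (S t u @[t --> 0^'+]) by exact: fmap_filter.
have /cvgr0Pnorm_lt/(_ _ e0) : nrm (pr h (S t u) - pr h u) @[t --> 0^'+] --> (0 : R).
  exact: pr_cvg Ft (heat_cvg0 (u := u)) ih.
move=> /(@nbhs_ballP R R^o)[d /= d0 H]; exists d => // s s0 sd.
have := H s; rewrite /ball/= sub0r normrN gtr0_norm// => /(_ sd s0).
by rewrite ger0_norm// normc_ge0.
Qed.

(** Against any [h], the pairing with [S s u] has derivative minus the pairing with [S s v] for s >
    0, and both pairings are continuous at 0; [right_difference_quotient] carries this to s = 0. *)
Lemma heat_generator_fwd u v : op_sqr Xt (u, - v) ->
  (t^-1)%:C%C *: (u - S t u) @[t --> 0^'+] --> v.
Proof.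
move=> X; apply: cvg_at_right_pr => h ih.
have Dphi s : 0 < s -> pr h (Cv (heat2 s%:C%C) u) = - pr h (S s v).
  move=> s0; rewrite (Xt2_heat_swap s0 X) -[- v]scaleN1r.
  by rewrite /S (preadjZ0 _ _ (Cv_preadj (heat_L1 (tC s0)))) (prZ _ _ ih) mulN1r.
have E t : pr h ((t^-1)%:C%C *: (u - S t u)) = (t^-1)%:C%C * (pr h u - pr h (S t u)).
  by rewrite (prZ _ _ ih) (prB _ _ ih).
have H : nrm ((t^-1)%:C%C * (pr h u - pr h (S t u)) - pr h v) @[t --> 0^'+] --> (0 : R).
  apply: (@right_difference_quotient _ (fun s => pr h (S s u)) (fun s => pr h (S s v))).
  - by move=> s s0; exact: pr_heat_quad ih s0 (Dphi _ s0).
  - by move=> e e0; exact: pr_heat_cvg0.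
  - by move=> e e0; exact: pr_heat_cvg0.
have E' t : nrm ((t^-1)%:C%C * (pr h u - pr h (S t u)) - pr h v) =
  nrm (pr h ((t^-1)%:C%C *: (u - S t u)) - pr h v) by rewrite E.
exact: (@eq_ind _ _ (fun f : R -> R => f @ 0^'+ --> (0 : R)) H _ (funext E')).
Qed.

(** Apply [S e] to the given limit: by commutation, the difference quotients at [S e u] tend to
    [S e v]. Since [S e u] is in the domain by smoothing, the forward direction computes the same
    limit, and uniqueness gives the pair ([S e u], [- S e v]) in the square. Closedness lets [e]
    tend to 0. *)
Lemma heat_generator_bwd u v :
  (t^-1)%:C%C *: (u - S t u) @[t --> 0^'+] --> v -> op_sqr Xt (u, - v).
Proof.
move=> Cv0.
have E e : 0 < e -> - S e v = Cv (heat2 e%:C%C) u.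
  move=> e0; have ie := heat_L1 (tC e0).
  have X2 : op_sqr Xt (S e u, - (- Cv (heat2 e%:C%C) u)) by rewrite opprK; exact: Xt2_heat.
  have C1 := heat_generator_fwd X2.
  have C2 : (t^-1)%:C%C *: (S e u - S t (S e u)) @[t --> 0^'+] --> S e v.
    have C3 : S e ((t^-1)%:C%C *: (u - S t u)) @[t --> 0^'+] --> S e v.
      apply: (@cvg_comp _ _ _ (fun t => (t^-1)%:C%C *: (u - S t u)) (S e) _ (nbhs v) _ Cv0).
    exact: (preadj_cont (Cv_preadj ie)).
    apply: cvg_trans C3; apply: near_eq_cvg; near=> t.
    have t0 : 0 < t by near: t; exact: nbhs_right_gt.
    have is_ := heat_L1 (tC t0).
    rewrite /S (preadjZ0 _ _ (Cv_preadj ie)) (preadjB0 _ _ (Cv_preadj ie)).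
    by rewrite (CvC _ ie is_).
  have PF : ProperFilter ((t^-1)%:C%C *: (S e u - S t (S e u)) @[t --> 0^'+]).
    exact: fmap_proper_filter.
  by rewrite (weakstar_unique PF C2 C1) opprK.
have cl : closure (op_sqr Xt) (u, - v).
  apply: (@seq_closure _ (fun n => (S (en n) u, - S (en n) v))).
  - by move=> n; rewrite (E _ (en_gt0 n)); apply: Xt2_heat; exact: en_gt0.
  - move=> h ih /=; have Ft : Filter (S t u @[t --> 0^'+]) by exact: fmap_filter.
    have C : nrm (pr h (S t u) - pr h u) @[t --> 0^'+] --> (0 : R).
      exact: pr_cvg Ft (heat_cvg0 (u := u)) ih.
    by move/cvg_at_rightP : C; apply; split; [exact: en_gt0|exact: en_cvg].
  - move=> h ih /=; have Ft : Filter (S t v @[t --> 0^'+]) by exact: fmap_filter.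
    have C : nrm (pr h (S t v) - pr h v) @[t --> 0^'+] --> (0 : R).
      exact: pr_cvg Ft (heat_cvg0 (u := v)) ih.
    move/cvg_at_rightP : C => /(_ en) C.
    have C' := C (conj en_gt0 en_cvg).
    have E' n : nrm (pr h (S (en n) v) - pr h v) = nrm (pr h (- S (en n) v) - pr h (- v)).
      by rewrite (prN (S (en n) v) ih) (prN v ih) -opprD nrmN.
    exact: (@eq_ind _ _ (fun f : nat -> R => f @ \oo --> (0 : R)) C' _ (funext E')).
exact: op_sqr_Xt_closure cl.
Unshelve. all: by end_near. Qed.

Lemma heat_comp z w u : 0 < complex.Re z -> 0 < complex.Re w ->
  Cv (heat (z + w)) u = Cv (heat z) (Cv (heat w) u).
Proof.
move=> z0 w0; rewrite (Cv_comp u (heat_L1 z0) (heat_L1 w0)).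
by rewrite (heat_conv z0 w0).
Qed.

Lemma heat_semigroup : weakstar_continuous_semigroup S.
Proof.
split=> [t t0|s t u s0 t0|t u t0|u].
- split; first exact/Cv_bounded/heat_L1.
  exact/preadj_cont/Cv_preadj/heat_L1.
- by rewrite /S rmorphD; exact: heat_comp.
- exact: heat_cvg_gt0.
- exact: heat_cvg0.
Qed.

Lemma heat_positive : positive_semigroup S.
Proof.
move=> t u t0; apply: Cv_ge0; first exact/heat_L1/tC.
by move=> x; exact: heat_real.
Qed.

Lemma heat_contractive : contractive_semigroup S.
Proof.
move=> t u t0; apply: le_trans (Cv_norm u (heat_L1 (tC t0))) _.
by rewrite (heat_nL1 t0) mul1r.
Qed.

Lemma heat_holomorphic : holomorphic_right_half_plane S.
Proof.
exists (fun z => Cv (heat z)); split=> [t u t0|z z0|z w u z0 w0|z z0]; first by [].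
- exact/Cv_bounded/heat_L1.
- exact: heat_comp.
- exact: heat_differentiable.
Qed.

Lemma closure_H_max : closure (H_max rho a) = op_opp (op_sqr Xt).
Proof. by rewrite /H_max closure_op_opp closure_sqr_X_max. Qed.

Lemma heat_generates : generates (closure (H_max rho a)) S.
Proof.
move=> u v; rewrite closure_H_max; split; first exact: heat_generator_fwd.
exact: heat_generator_bwd.
Qed.

Lemma Xt_functional_graph : functional_graph Xt.
Proof. by move=> u v w; exact: Xt_functional. Qed.

Lemma opp_sqr_functional_graph : functional_graph (op_opp (op_sqr Xt)).
Proof.
move=> u v w [v1 /= X1 X2] [w1 /= Y1 Y2].
rewrite -(Xt_functional X1 Y1) in Y2.
by apply: oppr_inj; exact: Xt_functional X2 Y2.
Qed.

Lemma flow_conclusion :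
  [/\ [/\ weakstar_closable (X_min rho a),
          weakstar_closable (X_max rho a) &
          closure (X_min rho a) = closure (X_max rho a)],
      weakstar_closable (H_max rho a) /\
      (exists S : R -> L -> L,
        [/\ weakstar_continuous_semigroup S,
            generates (closure (H_max rho a)) S,
            positive_semigroup S,
            contractive_semigroup S &
            holomorphic_right_half_plane S]),
      closure (H_max rho a) = op_opp (op_sqr (closure (X_max rho a))) /\
      closed (op_sqr (closure (X_max rho a))) &
      smooth a ->
        weakstar_closable (H_min rho a) /\
        closure (H_min rho a) = closure (H_max rho a)].
Proof.
split.
- rewrite /weakstar_closable closure_X_min closure_X_max.
  by split=> //; exact: Xt_functional_graph.
- split; first by rewrite /weakstar_closable closure_H_max; exact: opp_sqr_functional_graph.
  exists S; split; [exact: heat_semigroup|exact: heat_generates|exact: heat_positive|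
    exact: heat_contractive|exact: heat_holomorphic].
- rewrite closure_H_max closure_X_max; split=> //.
  by rewrite -closure_sqr_X_max; exact: closed_closure.
- move=> a_smooth.
  have E : closure (H_min rho a) = closure (H_max rho a).
    by rewrite closure_H_max /H_min closure_op_opp (closure_sqr_X_min a_smooth).
  split=> //; rewrite /weakstar_closable E closure_H_max.
  exact: opp_sqr_functional_graph.
Qed.

End Linf_flow.

Theorem proposition2p1 (R : realType) (a rho : R -> R)
    (a_gt0 : forall x, 0 < a x)
    (a_bounded : locally_bounded a)
    (a_derivable : forall x, derivable a x 1)
    (a'_bounded : locally_bounded (derive1 a))
    (a_posdiv :
      (\int[lebesgue_measure]_(x in `[0%R, +oo[) (a x)^-1%:E = +oo)%E)
    (a_negdiv :
      (\int[lebesgue_measure]_(x in `]-oo, 0%R]) (a x)^-1%:E = +oo)%E)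
    (rho_gt0 : forall x, 0 < rho x)
    (rho_smooth : smooth rho) :
  [/\ [/\ weakstar_closable (X_min rho a),
          weakstar_closable (X_max rho a) &
          closure (X_min rho a) = closure (X_max rho a)],
      weakstar_closable (H_max rho a) /\
      (exists S : R -> Linf (weighted_lebesgue rho) ->
                       Linf (weighted_lebesgue rho),
        [/\ weakstar_continuous_semigroup S,
            generates (closure (H_max rho a)) S,
            positive_semigroup S,
            contractive_semigroup S &
            holomorphic_right_half_plane S]),
      closure (H_max rho a) = op_opp (op_sqr (closure (X_max rho a))) /\
      closed (op_sqr (closure (X_max rho a))) &
      smooth a ->
        weakstar_closable (H_min rho a) /\
        closure (H_min rho a) = closure (H_max rho a)].
Proof.
have a_cont : continuous a.
  by move=> x; apply/differentiable_continuous/derivable1_diffP.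
have rho_cont := smooth_continuous rho_smooth.
have [tau [sigma [tauK sigmaK Dtau Dsigma sigma_incr]]] :=
  travel_time a_gt0 a_cont a_posdiv a_negdiv.
exact: (flow_conclusion a_gt0 a_cont rho_gt0 rho_cont tauK sigmaK Dtau Dsigma sigma_incr).
Qed.
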